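(* Let $p,q\in\mathbb{N}$ be positive integers and suppose that $\theta\in(0,\frac{\pi}{3})$ satisfies $\tan\theta=\frac{\sqrt{3}\,p}{2q+p}$. Then there exist constants $\alpha(\theta),\beta(\theta)$ depending only on $\theta$ such that (1) for Lebesgue almost all $a\in\Delta_\theta$, $\dim_B E_{\theta,a}=\dim_H E_{\theta,a}=\alpha(\theta)<s-1$; (2) for $\nu_\theta$-almost all $a\in\Delta_\theta$, $\dim_B E_{\theta,a}=\dim_H E_{\theta,a}=\beta(\theta)>s-1$.
   Context: $\Delta\subset\mathbb{R}^2$ is the Sierpiński gasket: the unique non-empty compact set with $\Delta=S_0(\Delta)\cup S_1(\Delta)\cup S_2(\Delta)$, where $S_0(x,y)=(\frac x2,\frac y2)$, $S_1(x,y)=(\frac x2+\frac12,\frac y2)$, $S_2(x,y)=(\frac x2+\frac14,\frac y2+\frac{\sqrt3}{4})$. Put $s=\frac{\log 3}{\log 2}=\dim_H\Delta$. For an angle $\theta$ and $a\in\mathbb{R}$ let $L_{\theta,a}=\{(x,a+x\tan\theta):x\in\mathbb{R}\}$, let $\mathrm{proj}_\theta(x,y)=y-x\tan\theta$ (so $L_{\theta,a}=\mathrm{proj}_\theta^{-1}(a)$), $\Delta_\theta=\mathrm{proj}_\theta(\Delta)\subset\mathbb{R}$, and $E_{\theta,a}=L_{\theta,a}\cap\Delta$. $\nu$ is the unique Borel probability measure with $\nu=\sum_{i=0}^2\frac13\,\nu\circ S_i^{-1}$ and $\nu_\theta=\nu\circ\mathrm{proj}_\theta^{-1}$. $\dim_H$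 is Hausdorff dimension and $\dim_B$ is box dimension; an assertion about $\dim_B$ includes that the upper and lower box dimensions coincide. *)

(* Defs.v *)
From HB Require Import structures.
From mathcomp Require Import all_boot all_order all_algebra.
From mathcomp Require Import all_classical all_reals all_analysis.

Set Implicit Arguments.
Unset Strict Implicit.
Unset Printing Implicit Defensive.

Import Order.TTheory GRing.Theory Num.Theory.
Import numFieldNormedType.Exports.

Local Open Scope classical_set_scope.
Local Open Scope ring_scope.

(* The library norm on [R * R] is the sup norm, so the Euclidean distance is
   written out; the product topology and product sigma-algebra on [R * R] are
   the usual topology and Borel sigma-algebra of the plane. *)
Definition euclid_dist {R : realType} (z w : R * R) : R :=
  Num.sqrt ((z.1 - w.1) ^+ 2 + (z.2 - w.2) ^+ 2).

(* The maximum with 0 only matters for the empty set, whose diameter is 0. *)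
Definition diam {R : realType} (U : set (R * R)) : \bar R :=
  Order.max 0%E (ereal_sup [set (euclid_dist z w)%:E | z in U & w in U]).

(* [diam U ^ t], with the convention that the empty set is sent to 0 for every
   [t >= 0], including [t = 0] (otherwise [0 ^ 0 = 1] would be used). *)
Definition diam_pow {R : realType} (t : R) (U : set (R * R)) : \bar R :=
  if U == set0 then 0%E else poweR (diam U) t.

Definition hausdorff_premeasure {R : realType} (t r : R) (E : set (R * R))
    : \bar R :=
  ereal_inf [set (\sum_(0 <= i <oo) diam_pow t (U i))%E | U in
    [set U : nat -> set (R * R) |
      E `<=` \bigcup_i U i /\ forall i, (diam (U i) <= r%:E)%E]].

Definition hausdorff_measure {R : realType} (t : R) (E : set (R * R))
    : \bar R :=
  ereal_sup [set hausdorff_premeasure t r E | r in [set r : R | 0 < r]].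

Definition hausdorff_dim {R : realType} (E : set (R * R)) : \bar R :=
  ereal_inf [set t%:E | t in
    [set t : R | 0 <= t /\ hausdorff_measure t E = 0%E]].

(* Least number of sets of diameter at most [r] covering [E] ([+oo] if no
   finite family does). *)
Definition covering_number {R : realType} (r : R) (E : set (R * R)) : \bar R :=
  ereal_inf [set (n%:R : R)%:E | n in
    [set n : nat | exists U : 'I_n -> set (R * R),
      E `<=` \bigcup_i U i /\ forall i, (diam (U i) <= r%:E)%E]].

Definition box_ratio {R : realType} (E : set (R * R)) (r : R) : \bar R :=
  (lne (covering_number r E) * ((- ln r)^-1)%:E)%E.

Definition upper_box_dim {R : realType} (E : set (R * R)) : \bar R :=
  limf_esup (box_ratio E) (0 : R)^'+.

Definition lower_box_dim {R : realType} (E : set (R * R)) : \bar R :=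
  limf_einf (box_ratio E) (0 : R)^'+.

Definition has_box_dim {R : realType} (E : set (R * R)) (d : \bar R) : Prop :=
  lower_box_dim E = d /\ upper_box_dim E = d.

Definition gasket_shift {R : realType} (i : 'I_3) : R * R :=
  nth (0, 0) [:: (0, 0); (1 / 2, 0); (1 / 4, Num.sqrt 3 / 4)] i.

Definition gasket_map {R : realType} (i : 'I_3) (z : R * R) : R * R :=
  (z.1 / 2 + (gasket_shift i).1, z.2 / 2 + (gasket_shift i).2).

(* By Hutchinson's theorem exactly one set and exactly one probability measure
   satisfy the two predicates below. *)
Definition is_sierpinski_gasket {R : realType} (D : set (R * R)) : Prop :=
  [/\ D !=set0, compact D & D = \bigcup_(i : 'I_3) (gasket_map i @` D)].

Definition is_natural_measure {R : realType} (nu : probability (R * R)%type R)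
    : Prop :=
  forall A : set (R * R), measurable A ->
    nu A = (\sum_(i < 3) (3^-1)%:E * nu (gasket_map i @^-1` A))%E.

Definition angle_line {R : realType} (theta a : R) : set (R * R) :=
  [set (x, a + x * tan theta) | x in [set: R]].

Definition proj_theta {R : realType} (theta : R) (z : R * R) : R :=
  z.2 - z.1 * tan theta.

Definition gasket_slice {R : realType} (D : set (R * R)) (theta a : R)
    : set (R * R) :=
  angle_line theta a `&` D.

(* [nu_theta], on the Borel sets of [R]. *)
Definition proj_measure {R : realType} (nu : probability (R * R)%type R)
    (theta : R) : set R -> \bar R :=
  pushforward nu (proj_theta theta).

(* Main.v *)
(* Rescaling the projection to x = xproj z, the gasket maps become
   x |-> (x + d) / 2 with integer digits d = 0, p, p + q, and after division by
   gcd(p, q) one may take p, q coprime.  The number of level-n cylinders met by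
   the slice over x is then a sum of entries of a product of two nonnegative
   integer matrices of size p + q, chosen by the first n binary digits of x.  A
   word whose product is entrywise positive makes the logarithm of this number
   additive up to an error that is small on average, and block large deviations
   give an almost sure growth rate: the digits are independent fair bits under
   Lebesgue measure, and the image of uniform gasket words under a finite
   transducer under the projected natural measure.

   Growth gives the box dimension and the upper Hausdorff bound.  For the lower
   Hausdorff bound, mass is split over the cylinders block by block, and a Kraft
   inequality bounds the mass of any finite cover.

   The sum of the two matrices has an integral eigenvector v for the eigenvalue 3,
   so pairing the product with v gives a martingale after the factor (2/3)^n.
   Since V (3/2)^n is not an integer for large n, the martingale increments are
   not degenerate, and strict Jensen puts the Lebesgue rate below ln (3/2) and
   the rate of the natural measure, which is size-biased, above it. *)
Require Import Defs.
From HB Require Import structures.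
From mathcomp Require Import all_boot all_order all_algebra.
From mathcomp Require Import all_classical all_reals all_analysis.
From mathcomp Require Import measurable_realfun lra ring zify.

Set Implicit Arguments.
Unset Strict Implicit.
Unset Printing Implicit Defensive.

Import Order.TTheory GRing.Theory Num.Theory.
Import numFieldNormedType.Exports.

Local Open Scope classical_set_scope.
Local Open Scope ring_scope.

(** * Averages over words *)

Section WordAverage.
Context {R : realType} {X : finType}.

(** The counts [tot] and [mincnt] are only sub- and supermultiplicative, and under the projected
    natural measure consecutive bit blocks are dependent, because the carry of one block enters the
    next. One word meets both difficulties: reading it, the transducer forgets the incoming carry,
    and the bits it emits have a positive matrix product. The number of blocks before it occurs has
    a geometric tail, so the price of treating blocks as independent and of comparing [tot] with
    [mincnt] has a mean bounded independently of the block length. Bounds are therefore stated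
    through functions of the input word that hold for all carries, and elementary Chernoff estimates
    take the place of a subadditive ergodic theorem. Lebesgue measure is the case of a transducer
    with one state, so both exponents come from the same theorem. Coprimality enters twice: it
    provides digits of both parities, so that any bit can be emitted, and it makes the rotation by
    [q] modulo [p + q] transitive, so that positive products exist. *)

Fixpoint wavg (n : nat) (G : seq X -> R) : R :=
  if n is m.+1 then #|X|%:R^-1 * \sum_(x : X) wavg m (fun s => G (x :: s))
  else G [::].

Lemma le_wavg n G G' : (forall s, size s = n -> G s <= G' s) ->
  wavg n G <= wavg n G'.
Proof.
elim: n G G' => [|n IH] G G' h /=; first exact: h.
rewrite ler_wpM2l ?invr_ge0 ?ler0n//; apply: ler_sum => x _.
by apply: IH => s hs; apply: h; rewrite /= hs.
Qed.

Lemma eq_wavg n G G' : (forall s, size s = n -> G s = G' s) ->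
  wavg n G = wavg n G'.
Proof.
by move=> h; apply/eqP; rewrite eq_le !le_wavg// => s /h ->.
Qed.

Lemma wavgD n G G' : wavg n (fun s => G s + G' s) = wavg n G + wavg n G'.
Proof.
elim: n G G' => [//|n IH] G G' /=; rewrite -mulrDr -big_split/=.
by congr (_ * _); apply: eq_bigr => x _; rewrite IH.
Qed.

Lemma wavgZ n c G : wavg n (fun s => c * G s) = c * wavg n G.
Proof.
elim: n G => [//|n IH] G /=; rewrite mulrCA; congr (_ * _).
by rewrite mulr_sumr; apply: eq_bigr => x _; rewrite IH.
Qed.

Lemma wavgN n G : wavg n (fun s => - G s) = - wavg n G.
Proof.
by rewrite -mulN1r -wavgZ; apply: eq_wavg => s _; rewrite mulN1r.
Qed.

Lemma wavg_sum n (I : finType) (G : I -> seq X -> R) :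
  wavg n (fun s => \sum_i G i s) = \sum_i wavg n (G i).
Proof.
elim: n G => [//|n IH] G /=; rewrite -mulr_sumr; congr (_ * _).
by rewrite exchange_big/=; apply: eq_bigr => x _; rewrite IH.
Qed.

Lemma wavg_cat m n G : wavg (m + n) G =
  wavg m (fun s => wavg n (fun t => G (s ++ t))).
Proof.
elim: m G => [//|m IH] G; rewrite addSn /=; congr (_ * _).
by apply: eq_bigr => x _; rewrite IH.
Qed.

Lemma wavg_ge0 n G : (forall s, size s = n -> 0 <= G s) -> 0 <= wavg n G.
Proof.
elim: n G => [|n IH] G h /=; first exact: h.
rewrite mulr_ge0 ?invr_ge0 ?ler0n// sumr_ge0// => x _.
by apply: IH => s hs; apply: h; rewrite /= hs.
Qed.

Lemma wavg_bounded (G : seq X -> R) n :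
  exists2 B, 0 < B & forall s, size s = n -> `|G s| <= B.
Proof.
elim: n G => [|n IH] G.
  exists (`|G [::]| + 1); first by rewrite ltr_wpDl.
  by move=> s /size0nil ->; rewrite lerDl.
have /choice[B hB] : forall x, exists B, 0 < B /\
    forall s, size s = n -> `|G (x :: s)| <= B.
  by move=> x; have [B ? ?] := IH (fun s => G (x :: s)); exists B.
exists (1 + \sum_x B x).
  by rewrite ltr_pwDl// sumr_ge0// => x _; rewrite ltW//; have [] := hB x.
move=> [//|x s] [hs]; have [_ /(_ _ hs) h] := hB x.
apply: (le_trans h); rewrite (bigD1 x)//= addrCA lerDl addr_ge0//.
by rewrite sumr_ge0// => y _; rewrite ltW//; have [] := hB y.
Qed.

Hypothesis X0 : (0 < #|X|)%N.

Let cX : #|X|%:R != 0 :> R. Proof. by rewrite pnatr_eq0 -lt0n. Qed.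

Lemma wavg_cst n c : wavg n (fun=> c) = c.
Proof.
elim: n => [//|n IH] /=; rewrite IH sumr_const cardT/= -cardT.
by rewrite -[c *+ _]mulr_natl mulKf.
Qed.

Lemma wavg_norm n G : `|wavg n G| <= wavg n (fun s => `|G s|).
Proof.
rewrite ler_norml -wavgN; apply/andP; split; apply: le_wavg => s _.
  by rewrite lerNl -normrN ler_norm.
exact: ler_norm.
Qed.

Lemma wavg_eq_pos (w : seq X) : 0 < wavg (size w) (fun s => (s == w)%:R).
Proof.
elim: w => [|x w IH]; first by rewrite /= ltr01.
rewrite /= mulr_gt0 ?invr_gt0 ?ltr0n//.
rewrite (bigD1 x)//= ltr_wpDr//.
  by apply: sumr_ge0 => y _; apply: wavg_ge0 => s _; rewrite ler0n.
rewrite (_ : wavg _ _ = wavg (size w) (fun s => (s == w)%:R))//.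
by apply: eq_wavg => s _; rewrite eqseq_cons eqxx.
Qed.

End WordAverage.

(** * Transfer matrices *)

(** The values of the rescaled projection at the fixed points of the three gasket maps, in the order
    of these maps. *)
Definition dig (p q : nat) (i : 'I_3) : nat := nth 0%N [:: p; 0; p + q]%N i.

Section TransferMatrices.
Context (R : realType) (p q : nat).
Let N := (p + q)%N.

(** Let [s], [t] be the integer parts of [x] and [y], and [b] the first binary digit of the
    fractional part of [x]. Integer parts in [2 x = y + d] give [2 s + b = t + d]; the entry counts
    the digits [d] that allow this step. *)
Definition tmx (b : bool) : 'M[R]_(p + q) :=
  \matrix_(s, t) \sum_(i < 3) (s.*2 + b == t + dig p q i)%N%:R.

Fixpoint wmx (u : seq bool) : 'M[R]_(p + q) :=
  if u is b :: v then tmx b *m wmx v else 1%:M.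

Definition cnt u s : R := \sum_t wmx u s t.
Definition tot u : R := \sum_s cnt u s.
(** The default value [tot u] does not affect the minimum, since it bounds every [cnt u s]. *)
Definition mincnt u : R := \big[Order.min/tot u]_s cnt u s.

Lemma wmx_cat u v : wmx (u ++ v) = wmx u *m wmx v.
Proof. by elim: u => [|b u IH] /=; rewrite ?mul1mx// IH mulmxA. Qed.

Lemma tmx_ge0 b s t : 0 <= tmx b s t.
Proof. by rewrite mxE sumr_ge0// => i _; rewrite ler0n. Qed.

Lemma wmx_ge0 u s t : 0 <= wmx u s t.
Proof.
elim: u s t => [|b u IH] s t /=; first by rewrite mxE ler0n.
by rewrite mxE sumr_ge0// => r _; rewrite mulr_ge0// tmx_ge0.
Qed.

Lemma wmx_nat u s t : wmx u s t \is a Num.nat.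
Proof.
elim: u s t => [|b u IH] s t /=; first by rewrite mxE natr_nat.
rewrite mxE rpred_sum// => r _; rewrite rpredM// mxE rpred_sum// => i _.
by rewrite natr_nat.
Qed.

Lemma cnt_cat u v s : cnt (u ++ v) s = \sum_t wmx u s t * cnt v t.
Proof.
rewrite /cnt wmx_cat; under eq_bigr do rewrite mxE.
by rewrite exchange_big/=; apply: eq_bigr => t _; rewrite mulr_sumr.
Qed.

Lemma cnt_nil s : cnt [::] s = 1.
Proof.
rewrite /cnt (bigD1 s)//= mxE eqxx big1 ?addr0// => t ts.
by rewrite mxE eq_sym (negPf ts).
Qed.

Lemma sum_eq_shift (n m d : nat) :
  \sum_(t < n) (m == t + d)%N%:R = (d <= m < d + n)%N%:R :> R.
Proof.
have [/andP[dm mn]|h] := boolP (d <= m < d + n)%N; last first.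
  rewrite big1// => t _; case: eqP => // e; move: h.
  by rewrite e leq_addl addnC ltn_add2l ltn_ord.
have mdn : (m - d < n)%N by rewrite ltn_subLR.
rewrite (bigD1 (Ordinal mdn))//= subnK// eqxx big1 ?addr0// => t.
rewrite -val_eqE/= => tm; case: eqP => // e; move: tm.
by rewrite e addnK eqxx.
Qed.

(** The digits 0 and [p + q] admit [2 s + b] in [0, N) and in [N, 2N), so exactly one of them
    applies; the digit [p] adds at most one more entry. *)
Lemma tmx_row_sum b s : 1 <= \sum_t tmx b s t <= 2.
Proof.
under eq_bigr do rewrite mxE.
rewrite exchange_big/=; under eq_bigr do rewrite sum_eq_shift.
rewrite !big_ord_recl big_ord0/= addr0 /dig/= /bump/= -!natrD ler1n ler_nat.
have := ltn_ord s; case: b => /=; lia.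
Qed.

Lemma dig_half k i : (k < N -> (k + dig p q i)./2 < N)%N.
Proof. by rewrite /N; case: i => -[|[|[]]]//= i; rewrite /dig/=; lia. Qed.

Lemma sum_tmx (psi : bool -> nat -> R) t :
  \sum_b \sum_s tmx b s t * psi b s =
  \sum_(i < 3) psi (odd (t + dig p q i)) (t + dig p q i)./2.
Proof.
transitivity (\sum_(i < 3) \sum_(b : bool) \sum_(s < p + q)
    (s.*2 + b == t + dig p q i)%N%:R * psi b s).
  rewrite [RHS]exchange_big/=; apply: eq_bigr => b _.
  rewrite [RHS]exchange_big/=; apply: eq_bigr => s _.
  by rewrite mxE mulr_suml.
apply: eq_bigr => i _; set m := (t + _)%N.
rewrite (bigD1 (odd m))//= [X in _ + X]big1 ?addr0 => [|b bm]; last first.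
  rewrite big1// => s _; case: eqP => [e|]; last by rewrite mul0r.
  by move: bm; rewrite -e oddD odd_double/= oddb eqxx.
rewrite (bigD1 (Ordinal (dig_half i (ltn_ord t))))//=.
rewrite big1 ?addr0 => [|s]; first by rewrite addnC odd_double_half eqxx mul1r.
rewrite -val_eqE/= => sm; case: eqP => [e|]; last by rewrite mul0r.
by move: sm; rewrite -/m -e [X in _ != X./2]addnC half_bit_double eqxx.
Qed.

Lemma tmx_col_sumD t : \sum_b \sum_s tmx b s t = 3.
Proof.
have := sum_tmx (fun _ _ => 1) t; under eq_bigr do under eq_bigr do rewrite mulr1.
by move=> ->; rewrite sumr_const card_ord.
Qed.

Hypotheses (p0 : (0 < p)%N) (q0 : (0 < q)%N) (pq : coprime p q).

Let i0 : 'I_N. Proof. by exists 0%N; rewrite /N addn_gt0 p0. Qed.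

(** The digit 0 is even; if [p] is even too, coprimality forces [q], hence [p + q], to be odd. *)
Lemma dig_parity (k : nat) (b : bool) : exists i, odd (k + dig p q i) = b.
Proof.
have [kb|kb] := eqVneq (odd k) b.
  by exists 1; rewrite /dig/= addn0.
have [pe|po] := boolP (odd p).
  by exists 0; rewrite /dig/= oddD pe; case: (odd k) b kb => [] [].
exists (inord 2); rewrite /dig inordK//= oddD oddD (negPf po)/=.
have -> : odd q.
  apply: contraTT pq => qe; rewrite /coprime.
  have : (2 %| gcdn p q)%N by rewrite dvdn_gcd !dvdn2 po qe.
  by apply: contraTneq => ->.
by case: (odd k) b kb => [] [].
Qed.

Lemma tmx_col_ge1 b t : 1 <= \sum_s tmx b s t.
Proof.
have [i hi] := dig_parity t b.
rewrite (bigD1 (Ordinal (dig_half i (ltn_ord t))))//=.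
rewrite -[leLHS]addr0 lerD//; last by rewrite sumr_ge0// => s _; rewrite tmx_ge0.
rewrite mxE (bigD1 i)//= -[leLHS]addr0 lerD//; last first.
  by rewrite sumr_ge0// => s _; rewrite ler0n.
by rewrite -hi addnC odd_double_half eqxx.
Qed.

Lemma wmx_col_ge1 u t : 1 <= \sum_s wmx u s t.
Proof.
elim: u t => [|b u IH] t /=.
  rewrite (bigD1 t)//= mxE eqxx big1 ?addr0// => s st.
  by rewrite mxE (negPf st).
under eq_bigr do rewrite mxE.
rewrite exchange_big/= (le_trans (IH t))// ler_sum// => s _.
by rewrite -mulr_suml ler_peMl ?wmx_ge0// tmx_col_ge1.
Qed.

Lemma cnt_cons_bounds b u s c d : (forall t, c <= cnt u t) -> 0 <= c ->
  (forall t, cnt u t <= d) -> c <= cnt (b :: u) s <= 2 * d.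
Proof.
move=> hc c0 hd; have /andP[h1 h2] := tmx_row_sum b s.
rewrite -cat1s cnt_cat /= mulmx1; apply/andP; split.
  apply: (@le_trans _ _ (\sum_t tmx b s t * c)).
    by rewrite -mulr_suml ler_peMl.
  by apply: ler_sum => t _; rewrite ler_wpM2l ?tmx_ge0.
apply: (@le_trans _ _ (\sum_t tmx b s t * d)).
  by apply: ler_sum => t _; rewrite ler_wpM2l ?tmx_ge0.
by rewrite -mulr_suml ler_wpM2r// (le_trans c0)// (le_trans (hc i0)).
Qed.

Lemma cnt_bounds u s : 1 <= cnt u s <= 2 ^+ size u.
Proof.
elim: u s => [|b u IH] s; first by rewrite cnt_nil expr0 lexx.
rewrite /= exprS; apply: cnt_cons_bounds => // t; by case/andP: (IH t).
Qed.

Lemma cnt_ge1 u s : 1 <= cnt u s. Proof. by case/andP: (cnt_bounds u s). Qed.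

Lemma cnt_le_tot u s : cnt u s <= tot u.
Proof.
rewrite /tot (bigD1 s)//= lerDl sumr_ge0// => t _.
by rewrite (le_trans ler01)// cnt_ge1.
Qed.

Lemma tot_ge1 u : 1 <= tot u.
Proof. exact: le_trans (cnt_ge1 u i0) (cnt_le_tot u i0). Qed.

Lemma tot_gt0 u : 0 < tot u.
Proof. exact: lt_le_trans ltr01 (tot_ge1 u). Qed.

Lemma tot_le u : tot u <= N%:R * 2 ^+ size u.
Proof.
rewrite /tot; apply: (@le_trans _ _ (\sum_(s < p + q) 2 ^+ size u)).
  by apply: ler_sum => s _; case/andP: (cnt_bounds u s).
by rewrite sumr_const card_ord -[X in X <= _]mulr_natl.
Qed.

Lemma mincnt_le u s : mincnt u <= cnt u s.
Proof. exact: bigmin_le. Qed.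

Lemma le_mincnt u c : (forall s, c <= cnt u s) -> c <= mincnt u.
Proof.
move=> h; apply/bigmin_geP; split => //.
exact: le_trans (h i0) (cnt_le_tot _ _).
Qed.

Lemma mincnt_ge1 u : 1 <= mincnt u.
Proof. by apply: le_mincnt => s; rewrite cnt_ge1. Qed.

Lemma mincnt_gt0 u : 0 < mincnt u.
Proof. exact: lt_le_trans ltr01 (mincnt_ge1 u). Qed.

Lemma tot_cat u v : tot (u ++ v) <= tot u * tot v.
Proof.
rewrite {1}/tot; under eq_bigr do rewrite cnt_cat.
rewrite {1}/tot mulr_suml; apply: ler_sum => s _.
rewrite mulr_suml; apply: ler_sum => t _.
by rewrite ler_wpM2l ?wmx_ge0 ?cnt_le_tot.
Qed.

Lemma cnt_cat_ge u v s : cnt u s * mincnt v <= cnt (u ++ v) s.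
Proof.
rewrite cnt_cat mulr_suml; apply: ler_sum => t _.
by rewrite ler_wpM2l ?wmx_ge0 ?mincnt_le.
Qed.

Lemma mincnt_cat u v : mincnt u * mincnt v <= mincnt (u ++ v).
Proof.
apply: le_mincnt => s; apply: le_trans (cnt_cat_ge _ _ _).
by rewrite ler_wpM2r ?mincnt_le// ltW// mincnt_gt0.
Qed.

Lemma tot_cat_ge u v : tot u <= tot (u ++ v).
Proof.
apply: ler_sum => s _; apply: le_trans (cnt_cat_ge _ _ _).
by rewrite ler_peMr ?mincnt_ge1// (le_trans ler01) ?cnt_ge1.
Qed.

(** After a positive prefix every row sees every state, so even the smallest row of the product
    collects all of [tot v]. This is how [mincnt] gets compared with [tot]. *)
Lemma mincnt_pos_cat u v : (forall s t, 1 <= wmx u s t) ->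
  tot v <= mincnt (u ++ v).
Proof.
move=> u1; apply: le_mincnt => s; rewrite cnt_cat; apply: ler_sum => t _.
by rewrite ler_peMl ?u1// (le_trans ler01) ?cnt_ge1.
Qed.

Lemma pos_cat u v : (forall s t, 1 <= wmx u s t) ->
  forall s t, 1 <= wmx (u ++ v) s t.
Proof.
move=> u1 s t; rewrite wmx_cat mxE (le_trans (wmx_col_ge1 v t))//.
by apply: ler_sum => r _; rewrite ler_peMl ?wmx_ge0.
Qed.

End TransferMatrices.

(** * The digit transducer and positive words *)

Section Transducer.
Context {X : finType} (e : X -> nat).

(* A word [io] of digits, fed from its right end into the state [l], outputs the
   first [size io] binary digits of [g_io y] when [l] is the integer part of
   [y], where [g_x y = (y + e x) / 2]; the final state is the integer part of
   [g_io y]. *)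
Fixpoint state (io : seq X) (l : nat) : nat :=
  if io is x :: io' then (state io' l + e x)./2 else l.

Fixpoint output (io : seq X) (l : nat) : seq bool :=
  if io is x :: io' then odd (state io' l + e x) :: output io' l else [::].

Lemma state_cat a b l : state (a ++ b) l = state a (state b l).
Proof. by elim: a => //= x a ->. Qed.

Lemma output_cat a b l : output (a ++ b) l = output a (state b l) ++ output b l.
Proof. by elim: a => //= x a ->; rewrite state_cat. Qed.

Lemma size_output a l : size (output a l) = size a.
Proof. by elim: a => //= x a ->. Qed.

Lemma state_lt K a l : (forall k x, k < K -> (k + e x)./2 < K)%N ->
  (l < K -> state a l < K)%N.
Proof. by move=> h lK; elim: a => //= x a /h; exact. Qed.

End Transducer.

(** * Existence of positive products and of synchronizing digit words *)

Section PositiveWord.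
Context (R : realType) (p q : nat).
Let N := (p + q)%N.
Hypotheses (p0 : (0 < p)%N) (q0 : (0 < q)%N) (pq : coprime p q).

Let N0 : (0 < N)%N. Proof. by rewrite /N addn_gt0 p0. Qed.

Let succs (b : bool) (s t : 'I_N) := [exists i, s.*2 + b == t + dig p q i]%N.
Let pre b (L : pred 'I_N) : pred 'I_N := [pred s | [exists t, L t && succs b s t]].

Let succs_tmx b s t : succs b s t -> 1 <= tmx R p q b s t.
Proof.
move=> /existsP[i hi]; rewrite mxE (bigD1 i)//= hi lerDl sumr_ge0//.
Qed.

(** [q] is prime to [N], so the rotation by [q] is a single cycle and no proper nonempty set of
    residues is invariant. *)
Let rotate_closed (L : pred 'I_N) : (exists l, L l) -> (exists l, ~~ L l) ->
  exists l l' : 'I_N, [/\ ~~ L l, L l' & l' = (l + q) %% N :> nat]%N.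
Proof.
move=> [t tL] [l0 l0L]; apply/not_existsP => h.
have cl l : ~~ L l -> ~~ L (Ordinal (ltn_pmod (l + q) N0)).
  move=> lC; apply/negP => l'L; apply: (h l).
  by exists (Ordinal (ltn_pmod (l + q) N0)).
have iterC j : ~~ L (Ordinal (ltn_pmod (l0 + j * q) N0)).
  elim: j => [|j /cl]; last first.
    by congr (~~ L _); apply: val_inj => /=; rewrite modnDml mulSnr addnA.
  suff -> : Ordinal (ltn_pmod (l0 + 0 * q) N0) = l0 by [].
  by apply: val_inj => /=; rewrite mul0n addn0 modn_small.
have g1 : gcdn q N = 1%N.
  by rewrite /N gcdnDr gcdnC; exact/eqP.
(* [u] inverts [q] modulo [N], so [u * (t + (N - l0))] rotations lead from [l0] to [t]. *)
case: (egcdnP N q0) => u k; rewrite g1 => ukN _.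
have := iterC (u * (t + (N - l0)))%N; rewrite (_ : Ordinal _ = t) ?tL//.
apply: val_inj => /=; rewrite mulnAC ukN mulnDl mul1n addnCA.
rewrite (_ : k * N * _ = k * (t + (N - l0)) * N)%N; last by rewrite mulnAC.
rewrite modnMDl addnCA subnKC ?modnDr ?modn_small//.
exact/ltnW.
Qed.

(* Every [m = 2 s + b < 2 N] has [m mod N] among its successors, and the residue
   map is two-to-one: counting pairs (s, b) that miss L gives at most twice the
   complement of L, and strictly less since that complement is not invariant
   under the rotation by q. *)
Let shrink (L : pred 'I_N) : (exists l, L l) -> (exists l, ~~ L l) ->
  exists b, (#|predC (pre b L)| < #|predC L|)%N.
Proof.
move=> L1 L0; have [l [l' [lL l'L ll']]] := rotate_closed L1 L0.
pose h (x : 'I_N * bool) : 'I_N * bool :=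
  (Ordinal (ltn_pmod (x.1.*2 + x.2) N0), (N <= x.1.*2 + x.2)%N).
have lt2 (x : 'I_N * bool) : (x.1.*2 + x.2 < N + N)%N.
  by have := ltn_ord x.1; case: x.2 => /=; lia.
have hE (x : 'I_N * bool) : (x.1.*2 + x.2 = (h x).1 + (h x).2 * N)%N.
  rewrite /h/=; have := lt2 x; set m := (_ + _)%N => mN.
  case: leqP => Nm; last by rewrite modn_small// addn0.
  by rewrite mul1n -{2}(subnK Nm) modnDr modn_small ?subnK// ltn_subLR.
have hinj : injective h.
  move=> x y hxy; have := hE x; rewrite hxy -hE => xy.
  have e2 : x.2 = y.2.
    by have := congr1 odd xy; rewrite !oddD !odd_double !oddb.
  have e1 : x.1 = y.1.
    by apply: val_inj; move: xy; rewrite e2 => /addIn /double_inj.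
  by case: x y e1 e2 {hxy xy} => [? ?] [? ?] /= -> ->.
pose Z := [pred x : 'I_N * bool | ~~ pre x.2 L x.1].
pose C2 := [pred x : 'I_N * bool | ~~ L x.1].
have cardC2 (F : bool -> pred 'I_N) :
    #|[pred x : 'I_N * bool | F x.2 x.1]| = (\sum_b #|F b|)%N.
  under eq_bigr do rewrite -sum1_card big_mkcond/=.
  rewrite exchange_big/= pair_bigA/= -sum1_card big_mkcond/=.
  by apply: eq_bigr => -[].
have : (#|Z| < #|C2|)%N.
  rewrite -(fintype.card_image hinj); apply: proper_card; apply/properP; split.
    apply/fintype.subsetP => _ /fintype.imageP[x xZ ->]; move: xZ; rewrite !inE.
    apply: contra; case: (h x) (hE x) => y c /= xE Ly.
    apply/existsP; exists y; rewrite Ly/= /succs xE; apply/existsP.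
    case: c {xE}; first by exists (inord 2); rewrite /dig inordK//= mul1n.
    by exists 1; rewrite /dig/= mul0n.
  have NE : N = (p + q)%N by [].
  have lN := ltn_ord l; have l'N := ltn_ord l'.
  (* The pair stands for [m = l + N] or [m = l], whichever gives [m - p = l']. If it came from some
     [(s, b)] in [Z], the digit [p] would lead from there to [l'] in [L], a contradiction. *)
  exists (l, (l < p)%N); first by rewrite inE.
  apply/negP => /fintype.imageP[x xZ hx]; move: xZ; rewrite inE => /negP; apply.
  apply/existsP; exists l'; rewrite l'L/=; apply/existsP; exists 0.
  have := hE x; rewrite -hx /dig/= ll' => ->; case: ltnP => lp.
    by rewrite modn_small ?mul1n; [apply/eqP; lia|lia].
  have -> : (l + q = l - p + N)%N by lia.
  by rewrite modnDr modn_small ?mul0n; [apply/eqP; lia|lia].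
rewrite (cardC2 (fun b => predC (pre b L))) (cardC2 (fun=> predC L)) => lt.
apply/not_existsP => hb; move: lt; rewrite ltnNge => /negP; apply.
by apply: leq_sum => b _; rewrite leqNgt; apply/negP/hb.
Qed.

Lemma wmx_cat_ge u v s r t :
  wmx R p q u s r * wmx R p q v r t <= wmx R p q (u ++ v) s t.
Proof.
rewrite wmx_cat mxE (bigD1 r)//= lerDl sumr_ge0// => k _.
by rewrite mulr_ge0 ?wmx_ge0.
Qed.

(** Going backwards, each letter supplied by [shrink] enlarges the set of states that lead into [L],
    until it is everything. *)
Let fill (L : pred 'I_N) : (exists l, L l) ->
  exists w, forall s, exists2 t, L t & 1 <= wmx R p q w s t.
Proof.
move: {2}#|_| (leqnn #|predC L|) => n; elim: n L => [|n IH] L Ln L1.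
  exists [::] => s; exists s; last by rewrite mxE eqxx.
  move: Ln; rewrite leqn0 => /eqP/card0_eq/(_ s).
  by rewrite inE => /negbFE.
have [L0|] := pselect (exists l, ~~ L l); last first.
  move=> /forallNP h; exists [::] => s; exists s; last by rewrite mxE eqxx.
  by apply/negPn/negP/h.
have [b Lb] := shrink L1 L0.
have [w hw] : exists w, forall s,
    exists2 t, pre b L t & 1 <= wmx R p q w s t.
  apply: IH; first by rewrite -ltnS (leq_trans Lb).
  have [l Ll] := L1; have [i hi] := dig_parity pq l b.
  exists (Ordinal (dig_half i (ltn_ord l))).
  apply/existsP; exists l; rewrite Ll; apply/existsP; exists i.
  by rewrite /= -hi addnC odd_double_half.
exists (w ++ [:: b]) => s; have [r /existsP[t /andP[Lt rt]] sr] := hw s.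
exists t => //; apply: (le_trans _ (wmx_cat_ge _ _ s r t)).
by rewrite /= mulmx1 mulr_ege1// succs_tmx.
Qed.

Lemma positive_word : exists w, forall s t, 1 <= wmx R p q w s t.
Proof.
suff [w hw] : exists w, forall t, t \in enum 'I_N ->
    forall s, 1 <= wmx R p q w s t.
  by exists w => s t; apply: hw; rewrite mem_enum.
elim: (enum 'I_N) => [|t ts [w hw]]; first by exists [::].
have [w' hw'] : exists w', forall s, exists2 r,
    1 <= wmx R p q w r t & 1 <= wmx R p q w' s r.
  (* The rows already positive in column [t]; there is one, because every column of a product has
     sum at least 1. *)
  apply: (@fill [pred r | 1 <= wmx R p q w r t]).
  apply/not_existsP => h; have := wmx_col_ge1 R pq w t.
  rewrite big1 ?ler10// => s _; move: (h s) => /=.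
  by have /natrP[[|k] ->] := wmx_nat R w s t; rewrite ?ler1n.
exists (w' ++ w) => t'; rewrite inE => /predU1P[->|t'ts] s.
  have [r wr w'r] := hw' s; apply: (le_trans _ (wmx_cat_ge _ _ s r t)).
  by rewrite mulr_ege1.
(* A column that is already positive survives the new left factor, whose rows sum to at least 1. *)
rewrite wmx_cat mxE; have := cnt_ge1 R p0 w' s => /le_trans; apply.
by apply: ler_sum => r _; rewrite ler_peMr ?wmx_ge0 ?hw.
Qed.

(** The digit is chosen to make the left end of the interval of states even. Halving then takes
    width [d + 1] to the integer part of [(d + 1) / 2]; without evenness two neighbouring states
    need not merge. *)
Lemma sync_word (d lo : nat) : exists io k0, forall l,
  (lo <= l <= lo + d)%N -> state (dig p q) io l = k0.
Proof.
elim/ltn_ind: d lo => d IH lo; case: d IH => [|d] IH.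
  by exists [::], lo => l; rewrite addn0 -eqn_leq => /eqP ->.
have [i hi] := dig_parity pq lo false.
have [|io [k0 hio]] := IH ((d.+1)./2) _ ((lo + dig p q i)./2); first by lia.
exists (io ++ [:: i]), k0; move=> l ll; rewrite state_cat/= hio//.
by move: ll hi; set D := dig p q i; lia.
Qed.

Lemma emit_word w l : exists io, output (dig p q) io l = w.
Proof.
elim: w => [|b w [io hio]]; first by exists [::].
have [i hi] := dig_parity pq (state (dig p q) io l) b.
by exists (i :: io); rewrite /= hi hio.
Qed.

(** The right part is read first and brings all states to one; from that known state the left part
    emits a positive word. *)
Lemma good_word : exists io k0,
  (forall l, (l < N)%N -> forall s t,
    1 <= wmx R p q (output (dig p q) io l) s t) /\
  (forall l, (l < N)%N -> state (dig p q) io l = k0).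
Proof.
have [w hw] := positive_word; have [io [k0 hio]] := sync_word N 0.
have [io' hio'] := emit_word w k0.
have kE l : (l < N)%N -> state (dig p q) io l = k0.
  by move=> lN; apply: hio; rewrite leq0n add0n ltnW.
exists (io' ++ io), (state (dig p q) io' k0); split=> l lN.
  by move=> s t; rewrite output_cat kE// hio'; apply: pos_cat.
by rewrite state_cat kE.
Qed.

End PositiveWord.

(** A change of measure: [wmx u s t] counts the digit words that lead from [t] to [s] while emitting
    [u]. Comparing 3^n digit words with 2^n bit words gives the density [(2 / 3) ^+ n * wmx u s t]
    against fair bits. *)
Lemma wavg_output (R : realType) (p q : nat) (n : nat) (t : 'I_(p + q))
    (phi : seq bool -> nat -> R) :
  wavg n (fun io => phi (output (dig p q) io t) (state (dig p q) io t)) =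
  wavg n (fun u => (2 / 3) ^+ n * \sum_s wmx R p q u s t * phi u s).
Proof.
elim: n phi => [|n IH] phi.
  rewrite /= mul1r (bigD1 t)//= mxE eqxx mul1r big1 ?addr0// => s st.
  by rewrite mxE (negPf st) mul0r.
rewrite /= -wavg_sum -wavgZ -wavg_sum -wavgZ.
rewrite (IH (fun u k => #|'I_3|%:R^-1 *
  \sum_x phi (odd (k + dig p q x) :: u) (k + dig p q x)./2)).
apply: eq_wavg => u _; rewrite card_ord card_bool -mulr_sumr exprSr.
set c := (2 / 3) ^+ n.
transitivity (c * (3^-1 * \sum_b \sum_s \sum_r
    tmx R p q b s r * wmx R p q u r t * phi (b :: u) s)).
  congr (_ * _).
  under [in RHS]eq_bigr do rewrite exchange_big/=.
  rewrite [in RHS]exchange_big/= mulr_sumr; apply: eq_bigr => r _.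
  rewrite mulrCA; congr (_ * _).
  rewrite -(sum_tmx (fun b s => phi (b :: u) s)) mulr_sumr.
  apply: eq_bigr => b _; rewrite mulr_sumr; apply: eq_bigr => s _.
  by rewrite mulrAC mulrC.
rewrite (_ : \sum_b _ = \sum_b \sum_s wmx R p q (b :: u) s t * phi (b :: u) s).
  by set S := \sum_b _; field.
apply: eq_bigr => b _; apply: eq_bigr => s _.
by rewrite mxE mulr_suml.
Qed.

(** * Large deviations and near-additivity *)

Section BlockSums.
Context {R : realType}.

Definition bsum {A : Type} m (phi : seq A -> R) j (s : seq A) :=
  \sum_(i < j) phi (take m (drop (i * m) s)).

Lemma bsum_cat A m (phi : seq A -> R) j s t : size s = m ->
  bsum m phi j.+1 (s ++ t) = phi s + bsum m phi j t.
Proof.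
move=> sm; rewrite /bsum big_ord_recl mul0n drop0 take_size_cat//; congr (_ + _).
apply: eq_bigr => i _; rewrite lift0 mulSn addnC -drop_drop drop_size_cat//.
Qed.

Lemma expR_le_quadratic (x : R) : x <= 1 / 2 -> expR x <= 1 + x + 2 * x ^+ 2.
Proof.
move=> x12; have x1 : 0 < 1 - x by lra.
have : 1 - x <= expR (- x) by exact: expR_ge1Dx.
rewrite expRN => h; have : expR x <= (1 - x)^-1.
  by rewrite -[expR x]invrK lef_pV2 ?posrE ?invr_gt0 ?expR_gt0.
move=> /le_trans; apply; rewrite -[leLHS]mul1r ler_pdivrMr//.
have : 0 <= x ^+ 2 * (1 - 2 * x) by rewrite mulr_ge0 ?sqr_ge0//; lra.
by nra.
Qed.

(** Chernoff's bound: the exponential moment of a sum over independent blocks is a product. *)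
Lemma wavg_large_deviation (X : finType) m (phi : seq X -> R) (eps : R) :
  (0 < #|X|)%N -> 0 < eps ->
  exists2 rho : R, 0 < rho < 1 & forall j,
    wavg (j * m) (fun s => (j%:R * (wavg m phi + eps) < bsum m phi j s)%R%:R) <=
    rho ^+ j.
Proof.
move=> X0 eps0; set mu := wavg m phi.
have [B B0 hB] := wavg_bounded (fun s => phi s - mu) m.
have den0 : 0 < 4 * B ^+ 2 + 2 * B * eps.
  by rewrite addr_gt0// !mulr_gt0// exprn_gt0.
(* This [t] serves two purposes: [t B <= 1/2] allows the quadratic bound of the exponential, and
   [2 t B^2 < eps] makes [rho < 1]. The numerator of [rho] bounds the centred exponential moment,
   its denominator bounds [expR (t * eps)] from below. *)
have [t t0 tden] : exists2 t, 0 < t & t * (4 * B ^+ 2 + 2 * B * eps) = eps.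
  exists (eps / (4 * B ^+ 2 + 2 * B * eps)); first by rewrite divr_gt0.
  by rewrite divfK// gt_eqF.
have tB : t * B <= 1 / 2.
  have : t * B * (4 * B + 2 * eps) = eps by rewrite -[RHS]tden; ring.
  by move: (mulr_gt0 t0 B0); move: (t * B) => y y0; nra.
have tB2 : 2 * (t * B ^+ 2) < eps.
  have h1 : 0 < t * B ^+ 2 by rewrite mulr_gt0// exprn_gt0.
  have h2 : 0 < t * B * eps by rewrite !mulr_gt0.
  have : eps = 4 * (t * B ^+ 2) + 2 * (t * B * eps) by rewrite -[LHS]tden; ring.
  lra.
pose rho := (1 + 2 * t ^+ 2 * B ^+ 2) / (1 + t * eps).
have te0 : 0 < t * eps by rewrite mulr_gt0.
have d0 : 0 < 1 + t * eps by rewrite addr_gt0.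
have rho01 : 0 < rho < 1.
  apply/andP; split.
    by rewrite divr_gt0// ltr_pwDl// !mulr_ge0// ?exprn_ge0// ltW.
  rewrite ltr_pdivrMr// mul1r ltrD2l.
  by rewrite (_ : 2 * t ^+ 2 * B ^+ 2 = t * (2 * (t * B ^+ 2))) ?ltr_pM2l//; ring.
exists rho => //; have step : wavg m (fun s => expR (t * (phi s - mu - eps))) <= rho.
  apply: (@le_trans _ _ (wavg m (fun s =>
      (1 + t * eps)^-1 * (1 + t * (phi s + - mu) + 2 * t ^+ 2 * B ^+ 2)))).
    apply: le_wavg => s /hB sB; rewrite mulrBr expRD mulrC.
    apply: ler_pM; rewrite ?expR_ge0//.
      rewrite expRN lef_pV2 ?posrE ?expR_gt0//; exact: expR_ge1Dx.
    have sB2 : (phi s - mu) ^+ 2 <= B ^+ 2.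
      by rewrite -real_normK ?num_real// lerXn2r ?nnegrE// ltW.
    apply: (le_trans (expR_le_quadratic _)).
      apply: le_trans tB; rewrite ler_pM2l//; exact: le_trans (ler_norm _) sB.
    by have := ler_wpM2l (sqr_ge0 t) sB2; lra.
  rewrite wavgZ mulrC /rho ler_pM2r ?invr_gt0//.
  rewrite !wavgD !wavg_cst// wavgZ wavgD wavg_cst// subrr mulr0 addr0.
  exact: lexx.
move=> j; apply: (@le_trans _ _ (wavg (j * m) (fun s =>
    expR (t * (bsum m phi j s - j%:R * (mu + eps)))))).
  apply: le_wavg => s _; case: ltP => h; last exact: expR_ge0.
  rewrite -[leLHS]expR0 ler_expR mulr_ge0//; first exact: ltW.
  by rewrite subr_ge0 ltW.
elim: j => [|j IH].
  by rewrite mul0n /= /bsum big_ord0 mul0r subrr mulr0 expR0 expr0.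
rewrite mulSn wavg_cat exprS.
apply: (@le_trans _ _ (wavg m (fun s => rho ^+ j * expR (t * (phi s - mu - eps))))).
  apply: le_wavg => s sm.
  apply: (@le_trans _ _ (wavg (j * m) (fun u => expR (t * (phi s - mu - eps)) *
     expR (t * (bsum m phi j u - j%:R * (mu + eps)))))).
    apply: le_wavg => u _; rewrite bsum_cat// -expRD ler_expR.
    by rewrite -natr1 le_eqVlt; apply/orP; left; apply/eqP; ring.
  by rewrite wavgZ mulrC ler_wpM2r ?expR_ge0.
by rewrite wavgZ mulrC ler_wpM2r// exprn_ge0// ltW; case/andP: rho01.
Qed.

End BlockSums.

(** * Near-additivity of the logarithmic counts along the transducer *)

Section NearAdditivity.
Context (R : realType) (p q : nat) {X : finType} (e : X -> nat) (K : nat).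
Hypotheses (p0 : (0 < p)%N) (q0 : (0 < q)%N) (pq : coprime p q).
Hypotheses (X0 : (0 < #|X|)%N) (K0 : (0 < K)%N).
Hypothesis eK : forall k x, (k < K -> (k + e x)./2 < K)%N.
Variables (gw : seq X) (k0 : nat).
Hypothesis gwP : forall l, (l < K)%N ->
  forall s t, 1 <= wmx R p q (output e gw l) s t.
Hypothesis gwS : forall l, (l < K)%N -> state e gw l = k0.

Let s0 := size gw.
Let f u : R := ln (tot R p q u).
Let h u : R := ln (mincnt R p q u).
Let lN : R := ln (p + q)%:R.
Let c1 : R := lN + s0%:R * ln 2.

(** The empty product is the identity, which is not positive because [p + q >= 2]. *)
Lemma good_word_size : (0 < s0)%N.
Proof.
rewrite lt0n; apply/eqP => s00.
have N1 : (1 < p + q)%N by lia.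
have N2 : (0 < p + q)%N by lia.
have := gwP K0 (Ordinal N1) (Ordinal N2).
by rewrite (size0nil s00) /= mxE /= mulr0n ler10.
Qed.

Let lN0 : 0 <= lN. Proof. by rewrite ln_ge0// ler1n; lia. Qed.

Let c10 : 0 <= c1.
Proof. by rewrite addr_ge0// mulr_ge0// ln_ge0// ler1n. Qed.

Let f_le u : f u <= lN + (size u)%:R * ln 2.
Proof.
rewrite /f /lN mulr_natl -lnXn// -lnM ?posrE ?exprn_gt0 ?ltr0n//; last lia.
rewrite ler_ln ?posrE ?tot_gt0//; first exact: tot_le.
by rewrite mulr_gt0 ?exprn_gt0// ltr0n; lia.
Qed.

Lemma ln_tot_cat u v : f (u ++ v) <= f u + f v.
Proof.
rewrite /f -lnM ?posrE ?tot_gt0// ler_ln ?posrE ?mulr_gt0 ?tot_gt0//.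
exact: tot_cat.
Qed.

Lemma ln_mincnt_cat u v : h u + h v <= h (u ++ v).
Proof.
rewrite /h -lnM ?posrE ?mincnt_gt0// ler_ln ?posrE ?mulr_gt0 ?mincnt_gt0//.
exact: mincnt_cat.
Qed.

Let h_ge0 u : 0 <= h u. Proof. by rewrite ln_ge0// mincnt_ge1. Qed.

(* [ln tot - ln mincnt] and the dependence of [ln tot] on the incoming state are
   paid for only up to the first occurrence of the good word [gw], read from the
   left in [defl] and from the right in [defr]; the expected cost is bounded. *)
Fixpoint defl j (io : seq X) : R :=
  if j is i.+1 then
    c1 + (if take s0 io == gw then 0 else defl i (drop s0 io))
  else lN.

Fixpoint defr j (io : seq X) : R :=
  if j is i.+1 then
    c1 + (if drop (i * s0) io == gw then 0 else defr i (take (i * s0) io))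
  else lN.

Lemma deflP j io l : size io = (j * s0)%N -> (l < K)%N ->
  f (output e io l) <= h (output e io l) + defl j io.
Proof.
move=> + lK; elim: j io => [|j IH] io.
  move=> /size0nil -> /=; apply: (le_trans (f_le _)) => /=.
  by rewrite mul0r addr0 lerDr.
rewrite mulSn => sio; rewrite -{1 2}(cat_take_drop s0 io) output_cat.
set a := take _ _; set b := drop _ _ => /=.
have sa : size a = s0 by rewrite size_takel// sio leq_addr.
have sb : size b = (j * s0)%N by rewrite size_drop sio addKn.
have kK : (state e b l < K)%N by apply: state_lt lK.
have fa : f (output e a (state e b l)) <= c1.
  by apply: (le_trans (f_le _)); rewrite size_output sa.
apply: (le_trans (ln_tot_cat _ _)); rewrite addrCA lerD// ?fa//.
case: eqP => [ag|_]; last first.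
  apply: (le_trans (IH _ sb)); rewrite lerD2r.
  by apply: le_trans (ln_mincnt_cat _ _); rewrite lerDr.
rewrite addr0 /f /h ler_ln ?posrE ?tot_gt0 ?mincnt_gt0//.
by apply: mincnt_pos_cat => // s t; rewrite [a]ag gwP.
Qed.

Lemma defrP j io l l' : size io = (j * s0)%N -> (l < K)%N -> (l' < K)%N ->
  f (output e io l) <= f (output e io l') + defr j io.
Proof.
elim: j io l l' => [|j IH] io l l'.
  by move=> /size0nil -> /= _ _; rewrite lerDl.
rewrite mulSn addnC => sio lK lK'.
rewrite -{1 2}(cat_take_drop (j * s0) io) !output_cat.
set a := take _ _; set b := drop _ _ => /=.
have sa : size a = (j * s0)%N by rewrite size_takel// sio leq_addr.
have sb : size b = s0 by rewrite size_drop sio addKn.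
have fb : f (output e b l) <= c1.
  by apply: (le_trans (f_le _)); rewrite size_output sb.
apply: (le_trans (ln_tot_cat _ _)); rewrite addrA addrAC lerD//.
rewrite -/b -/a; apply: (@le_trans _ _ (f (output e a (state e b l')) +
    (if b == gw then 0 else defr j a))).
  (* If the right block is the good word, both runs continue from the same state [k0] and their
     remaining outputs coincide. *)
  case: eqP => [->|_]; last by apply: IH => //; apply: state_lt.
  by rewrite !gwS// addr0.
rewrite lerD2r /f ler_ln ?posrE ?tot_gt0//; exact: tot_cat_ge.
Qed.

Let theta : R := wavg s0 (fun s => (s == gw)%:R).

Let theta0 : 0 < theta. Proof. exact: wavg_eq_pos. Qed.

(** [c1 / theta] is the fixed point of [E |-> c1 + (1 - theta) E], the mean cost of waiting for the
    good word; [lN] accounts for words in which it never occurs. *)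
Let defect_bound : R := lN + c1 / theta.

Let defect_step E : E <= defect_bound -> 
  wavg s0 (fun s => c1 + (1 - (s == gw)%:R) * E) <= defect_bound.
Proof.
move=> hE; rewrite wavgD wavg_cst//.
under eq_wavg => s _ do rewrite mulrC.
rewrite wavgZ wavgD wavg_cst// wavgN -/theta mulrC.
have t1 : theta <= 1.
  rewrite -(wavg_cst X0 s0 1); apply: le_wavg => s _.
  by case: (_ == _) => //; rewrite ler01.
apply: (@le_trans _ _ (c1 + (1 - theta) * defect_bound)).
  by rewrite lerD2l ler_wpM2l// subr_ge0.
rewrite /defect_bound.
have -> : c1 + (1 - theta) * (lN + c1 / theta) = lN + c1 / theta - theta * lN.
  by field; exact: lt0r_neq0.
by rewrite gerBl mulr_ge0// ltW.
Qed.

Let base_le : lN <= defect_bound.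
Proof. by rewrite lerDl divr_ge0// ltW. Qed.

Lemma wavg_defl j : wavg (j * s0) (defl j) <= defect_bound.
Proof.
elim: j => [//|j IH]; rewrite mulSn wavg_cat; apply: le_trans (defect_step IH).
apply: le_wavg => s ss.
under eq_wavg => t _ do rewrite /= take_size_cat// drop_size_cat//.
rewrite wavgD wavg_cst//; case: (s == gw).
  by rewrite wavg_cst// subrr mul0r.
by rewrite subr0 mul1r.
Qed.

Lemma wavg_defr j : wavg (j * s0) (defr j) <= defect_bound.
Proof.
elim: j => [//|j IH]; rewrite mulSn addnC wavg_cat.
apply: le_trans (defect_step IH).
rewrite (_ : wavg s0 _ = wavg (j * s0) (fun s : seq X =>
    wavg s0 (fun t => c1 + (1 - (t == gw)%:R) * defr j s))).
  apply: le_wavg => s ss; apply: le_wavg => t st.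
  rewrite /= drop_size_cat// take_size_cat//; case: (t == gw).
    by rewrite subrr mul0r.
  by rewrite subr0 mul1r.
rewrite wavgD wavg_cst//.
under eq_wavg => s _ do rewrite mulrC.
rewrite wavgZ wavgD wavg_cst// wavgN -/theta.
under [RHS]eq_wavg => s ss.
  rewrite wavgD wavg_cst//; under eq_wavg => t _ do rewrite mulrC.
  rewrite wavgZ wavgD wavg_cst// wavgN -/theta mulrC.
  over.
by rewrite wavgD wavg_cst// wavgZ mulrC.
Qed.

Let a j : R := wavg (j * s0) (fun io => f (output e io 0)).

(** [F] and [H] depend on the input word alone, so their values on successive blocks are independent
    although the outputs are coupled through the state. The distance of their means stays bounded in
    [j], hence is negligible per letter. *)
Lemma block_bounds : exists2 C, 0 <= C & forall j, exists F H : seq X -> R,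
  [/\ forall io l, size io = (j * s0)%N -> (l < K)%N ->
        f (output e io l) <= F io /\ H io <= h (output e io l),
      wavg (j * s0) F <= a j + C & a j - C <= wavg (j * s0) H].
Proof.
have b0 : 0 <= defect_bound by exact: le_trans lN0 base_le.
exists (defect_bound + defect_bound); first by rewrite addr_ge0.
move=> j; exists (fun io => f (output e io 0) + defr j io).
exists (fun io => f (output e io 0) + - (defr j io + defl j io)); split.
- move=> io l sio lK; split; first exact: defrP.
  have := deflP sio lK; have := defrP sio K0 lK; lra.
- by rewrite wavgD lerD2l -[leLHS]addr0 lerD// wavg_defr.
- by rewrite wavgD wavgN wavgD lerD2l lerN2 lerD// ?wavg_defr ?wavg_defl.
Qed.

End NearAdditivity.

(** * A strict gap from an integral Perron vector *)

Section PerronGap.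
Context (R : realType) (p q : nat).
Let N := (p + q)%N.
Hypotheses (p0 : (0 < p)%N) (q0 : (0 < q)%N) (pq : coprime p q).

(* The columns of the matrix sum to 3, so an integral eigenvector exists, and
   summing the triangle inequality over the rows shows that its absolute values
   form an eigenvector too. *)
Lemma nat_perron_vector : exists v : 'I_(p + q) -> nat,
  (exists t, (0 < v t)%N) /\
  forall s, \sum_t (\sum_b tmx R p q b s t) * (v t)%:R = 3 * (v s)%:R.
Proof.
pose S (s t : 'I_N) := (\sum_(b : bool) \sum_(i < 3)
  (s.*2 + b == t + dig p q i))%N.
have SE s t : \sum_b tmx R p q b s t = (S s t)%:R.
  rewrite natr_sum; apply: eq_bigr => b _; rewrite mxE natr_sum.
  by apply: eq_bigr.
have S3 t : (\sum_s S s t = 3)%N.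
  apply/eqP; rewrite -(eqr_nat R) natr_sum; apply/eqP.
  rewrite -[RHS](tmx_col_sumD R t) exchange_big/=.
  by apply: eq_bigr => s _; rewrite SE.
pose A : 'M[int]_N := \matrix_(s, t) (S s t)%:Z.
have [z z0 zA] : exists2 z : 'rV[int]_N, z != 0 & z *m (A - 3%:M)^T = 0.
  apply/det0P; rewrite det_tr; apply/det0P; exists (const_mx 1).
    have N0 : (0 < N)%N by rewrite addn_gt0 p0.
    apply/eqP => /matrixP/(_ ord0 (Ordinal N0)).
    by rewrite !mxE.
  apply/matrixP => i t; rewrite mulmxBr mul_mx_scalar !mxE mulr1.
  under eq_bigr do rewrite !mxE mul1r -natz.
  by rewrite -natr_sum S3 subrr.
have zE s : \sum_t (S s t)%:Z * z ord0 t = 3 * z ord0 s.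
  move/matrixP/(_ ord0 s): zA; rewrite linearB/= mulmxBr tr_scalar_mx mul_mx_scalar.
  rewrite !mxE => /eqP; rewrite subr_eq0 => /eqP <-.
  by apply: eq_bigr => t _; rewrite !mxE mulrC.
pose v t := `|z ord0 t|%N.
have vle s : (3 * v s <= \sum_t S s t * v t)%N.
  rewrite -lez_nat PoszM (_ : (v s)%:Z = `|z ord0 s|)//.
  rewrite -[X in X * _]ger0_norm// -normrM -zE.
  apply: (le_trans (ler_norm_sum _ _ _)).
  rewrite -natz natr_sum; apply: ler_sum => t _.
  by rewrite normrM natrM !natz /v abszE.
have vsum : (\sum_s \sum_t S s t * v t = \sum_s 3 * v s)%N.
  rewrite exchange_big/=; apply: eq_bigr => t _.
  by rewrite -big_distrl/= S3.
have vE s : (\sum_t S s t * v t = 3 * v s)%N.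
  apply/eqP; rewrite eqn_leq vle andbT leqNgt; apply/negP => lt.
  suff : (\sum_s 3 * v s < \sum_s \sum_t S s t * v t)%N by rewrite vsum ltnn.
  rewrite (bigD1 s)//= [ltnRHS](bigD1 s)//= -addSn leq_add//.
  exact: leq_sum.
exists v; split.
  apply/not_existsP => h; move/eqP: z0; apply; apply/matrixP => i t.
  rewrite ord1 mxE; apply/eqP; rewrite -absz_eq0 -leqn0 leqNgt.
  by apply/negP/h.
move=> s; rewrite -natrM -vE natr_sum; apply: eq_bigr => t _.
by rewrite SE natrM.
Qed.

Definition rowmul (x : 'I_(p + q) -> R) u t := \sum_s x s * wmx R p q u s t.

Lemma rowmul_cat x u w t : rowmul x (u ++ w) t = rowmul (rowmul x u) w t.
Proof.
rewrite /rowmul wmx_cat; under eq_bigr do rewrite mxE mulr_sumr.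
rewrite exchange_big/=; apply: eq_bigr => r _; rewrite mulr_suml.
by apply: eq_bigr => s _; rewrite mulrA.
Qed.

Lemma rowmul_gt0 (x : 'I_(p + q) -> R) u : (forall s, 0 < x s) -> forall t, 0 < rowmul x u t.
Proof.
move=> x0 t; rewrite lt0r sumr_ge0 ?andbT => [|s _]; last first.
  by rewrite mulr_ge0 ?wmx_ge0// ltW.
apply/eqP => h; have := wmx_col_ge1 R pq u t.
rewrite big1 ?ler10// => s _; apply/eqP.
have /eqP := h; rewrite psumr_eq0 => [/allP/(_ s)|r _]; last first.
  by rewrite mulr_ge0 ?wmx_ge0// ltW.
by rewrite mem_index_enum mulf_eq0 gt_eqF//=; apply.
Qed.

Variable v : 'I_(p + q) -> nat.
Hypothesis vE : forall s,
  \sum_t (\sum_b tmx R p q b s t) * (v t)%:R = 3 * (v s)%:R.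
Hypothesis vne : exists t, (0 < v t)%N.

Definition pair_v (x : 'I_(p + q) -> R) := \sum_t x t * (v t)%:R.

Lemma wavg_wmx_v n s :
  wavg n (fun u => (2 / 3) ^+ n * \sum_t wmx R p q u s t * (v t)%:R) = (v s)%:R.
Proof.
elim: n s => [|n IH] s.
  rewrite /= mul1r (bigD1 s)//= mxE eqxx mul1r big1 ?addr0// => t ts.
  by rewrite mxE eq_sym (negPf ts) mul0r.
rewrite /= -wavg_sum -wavgZ card_bool.
transitivity (wavg n (fun u => 3^-1 * \sum_r (\sum_b tmx R p q b s r) *
    ((2 / 3) ^+ n * \sum_t wmx R p q u r t * (v t)%:R))).
  apply: eq_wavg => u _; rewrite -mulr_sumr exprSr.
  set c := (2 / 3) ^+ n.
  under [in RHS]eq_bigr do rewrite mulrCA.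
  rewrite -mulr_sumr.
  rewrite (_ : \sum_b _ = \sum_r (\sum_b tmx R p q b s r) *
    (\sum_t wmx R p q u r t * (v t)%:R)); first by set S := \sum_r _; field.
  under [RHS]eq_bigr do rewrite mulr_suml.
  rewrite [RHS]exchange_big/=; apply: eq_bigr => b _.
  under [RHS]eq_bigr do rewrite mulr_sumr.
  rewrite [RHS]exchange_big/=; apply: eq_bigr => t _.
  by rewrite mxE mulr_suml; apply: eq_bigr => r _; rewrite mulrA.
rewrite wavgZ wavg_sum.
under eq_bigr do rewrite wavgZ IH.
by rewrite vE mulKf ?pnatr_eq0.
Qed.

Let B0 : (0 < #|{: bool}|)%N. Proof. by rewrite card_bool. Qed.

Lemma perron_gt0 s : (0 < v s)%N.
Proof.
have [w hw] := positive_word R p0 q0 pq.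
rewrite -(ltr0n R) -(wavg_wmx_v (size w) s).
apply: (@lt_le_trans _ _ (wavg (size w) (fun u =>
    (2 / 3) ^+ size w * (u == w)%:R))).
  by rewrite wavgZ mulr_gt0 ?exprn_gt0 ?divr_gt0 ?wavg_eq_pos.
apply: le_wavg => u _; rewrite ler_pM2l ?exprn_gt0 ?divr_gt0//.
case: eqP => [->|_]; last first.
  by apply: sumr_ge0 => t _; rewrite mulr_ge0 ?wmx_ge0.
have [t vt] := vne; rewrite (bigD1 t)//= -[leLHS]addr0 lerD//.
  by rewrite -[leLHS]mulr1 ler_pM// ler1n.
by apply: sumr_ge0 => r _; rewrite mulr_ge0 ?wmx_ge0.
Qed.

Let pair_rowmulE x w :
  pair_v (rowmul x w) = \sum_s x s * \sum_t wmx R p q w s t * (v t)%:R.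
Proof.
rewrite /pair_v /rowmul; under eq_bigr do rewrite mulr_suml.
rewrite exchange_big/=; apply: eq_bigr => s _; rewrite mulr_sumr.
by apply: eq_bigr => t _; rewrite mulrA.
Qed.

Lemma wavg_pair_v n x :
  wavg n (fun u => (2 / 3) ^+ n * pair_v (rowmul x u)) = pair_v x.
Proof.
rewrite [RHS]/pair_v; under [RHS]eq_bigr do rewrite -(wavg_wmx_v n) -wavgZ.
rewrite -wavg_sum; apply: eq_wavg => u _.
under [RHS]eq_bigr do rewrite mulrCA.
by rewrite -mulr_sumr pair_rowmulE.
Qed.

(* [avgrow n x] averages the normalised row vectors over the words of length n;
   it fixes the constant vector 1 and contracts oscillations. *)
Let avgrow n (x : 'I_(p + q) -> R) t := wavg n (fun u => (2 / 3) ^+ n * rowmul x u t).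

Let avgrowE n x t : avgrow n x t =
  \sum_s x s * wavg n (fun u => (2 / 3) ^+ n * wmx R p q u s t).
Proof.
rewrite /avgrow; under [RHS]eq_bigr do rewrite -wavgZ.
rewrite -wavg_sum; apply: eq_wavg => u _; rewrite mulr_sumr.
by apply: eq_bigr => s _; rewrite mulrCA.
Qed.

Let avgrow_add m n x t : avgrow (m + n) x t = avgrow n (avgrow m x) t.
Proof.
rewrite {1}/avgrow wavg_cat [RHS]avgrowE; under [RHS]eq_bigr do rewrite mulrC -wavgZ.
rewrite -wavg_sum; apply: eq_wavg => u _; rewrite -/(avgrow n _ _).
transitivity ((2 / 3) ^+ m * avgrow n (rowmul x u) t).
  rewrite -wavgZ; apply: eq_wavg => w _.
  by rewrite rowmul_cat exprD mulrA.
rewrite avgrowE mulr_sumr; apply: eq_bigr => s _.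
by rewrite mulrA mulrC.
Qed.

Let avgrow1 n t : avgrow n (fun=> 1) t = 1.
Proof.
elim: n t => [|n IH] t.
  rewrite /avgrow/= mul1r /rowmul (bigD1 t)//= mxE eqxx mulr1 big1 ?addr0//.
  by move=> s st; rewrite mxE (negPf st) mulr0.
rewrite -add1n avgrow_add (_ : avgrow 1 _ = fun=> 1) ?IH//.
apply/funext => s; rewrite /avgrow/= card_bool expr1.
rewrite -mulr_sumr /rowmul.
under eq_bigr do under eq_bigr do rewrite /= mulmx1 mul1r.
by rewrite tmx_col_sumD; field.
Qed.

(** Doeblin's argument: the averaged matrix has columns of sum 1 and entries at least [theta], so
    all coordinates of the image share the weight [theta] on the same [x r] and can differ only
    through the remaining mass. *)
Let avgrow_contract n (x : 'I_(p + q) -> R) lo c theta :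
  (forall s t, theta <= wavg n (fun u => (2 / 3) ^+ n * wmx R p q u s t)) ->
  (forall s, lo <= x s <= lo + c) ->
  exists lo', forall t, lo' <= avgrow n x t <= lo' + (1 - theta) * c.
Proof.
move=> hth hx; have N0 : (0 < N)%N by rewrite addn_gt0 p0.
pose r := Ordinal N0; exists (lo + theta * (x r - lo)) => t.
pose Q s := wavg n (fun u => (2 / 3) ^+ n * wmx R p q u s t).
have Q0 s : 0 <= Q s.
  by apply: wavg_ge0 => u _; rewrite mulr_ge0 ?wmx_ge0 ?exprn_ge0.
have Q1 : \sum_s Q s = 1.
  by rewrite -[RHS](avgrow1 n t) avgrowE; apply: eq_bigr => s _; rewrite mul1r.
have E : avgrow n x t - lo = \sum_s (x s - lo) * Q s.
  rewrite avgrowE -/Q; under [RHS]eq_bigr do rewrite mulrBl.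
  by rewrite sumrB -mulr_sumr Q1 mulr1.
have Qr : theta <= Q r by exact: hth.
have /andP[r1 r2] := hx r.
suff : theta * (x r - lo) <= avgrow n x t - lo <= theta * (x r - lo) + (1 - theta) * c.
  by move=> /andP[h1 h2]; apply/andP; split; lra.
rewrite E (bigD1 r)//=; apply/andP; split.
  rewrite -[leLHS]addr0 lerD//.
    by rewrite mulrC ler_wpM2l// subr_ge0.
  by apply: sumr_ge0 => s _; rewrite mulr_ge0// subr_ge0; have /andP[] := hx s.
apply: (@le_trans _ _ ((x r - lo) * Q r + c * (1 - Q r))).
  rewrite lerD2l -Q1 [X in _ <= _ * (X - _)](bigD1 r)//= addrC addrK mulr_sumr.
  apply: ler_sum => s _; rewrite ler_wpM2r// lerBlDl.
  by have /andP[] := hx s.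
have : 0 <= (Q r - theta) * (c - (x r - lo)) by rewrite mulr_ge0 ?subr_ge0//; lra.
by nra.
Qed.

Let avgrow_mix : exists L theta, [/\ (0 < theta :> R), theta <= 1 &
  forall j (x : 'I_(p + q) -> R) lo c, (forall s, lo <= x s <= lo + c) ->
  exists lo', forall t, lo' <= avgrow (j * L) x t <= lo' + (1 - theta) ^+ j * c].
Proof.
have [w hw] := positive_word R p0 q0 pq.
pose th := (2 / 3) ^+ size w * wavg (size w) (fun u => (u == w)%:R) : R.
have th0 : 0 < th by rewrite mulr_gt0 ?exprn_gt0 ?divr_gt0 ?wavg_eq_pos.
have thle s t : th <= wavg (size w) (fun u => (2 / 3) ^+ size w * wmx R p q u s t).
  rewrite wavgZ ler_pM2l ?exprn_gt0 ?divr_gt0//; apply: le_wavg => u _.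
  by case: eqP => [->|_]; rewrite ?hw ?wmx_ge0.
exists (size w), th; split => //.
  have N0 : (0 < N)%N by rewrite addn_gt0 p0.
  rewrite -(avgrow1 (size w) (Ordinal N0)) avgrowE (bigD1 (Ordinal N0))//=.
  rewrite mul1r -[leLHS]addr0 lerD// sumr_ge0// => s _.
  by rewrite mul1r wavg_ge0// => u _; rewrite mulr_ge0 ?wmx_ge0 ?exprn_ge0.
elim=> [|j IH] x lo c hx.
  exists lo => t; rewrite expr0 mul1r /avgrow/= mul1r.
  rewrite (_ : rowmul x [::] t = x t)//.
  rewrite /rowmul (bigD1 t)//= mxE eqxx mulr1 big1 ?addr0// => s st.
  by rewrite mxE (negPf st) mulr0.
have [lo1 h1] := avgrow_contract thle hx; have [lo2 h2] := IH _ _ _ h1.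
exists lo2 => t; rewrite mulSn avgrow_add exprSr -mulrA; exact: h2.
Qed.

Let V : R := \sum_t (v t)%:R.

Let V0 : 0 < V.
Proof.
have [t vt] := vne; rewrite /V (bigD1 t)//= ltr_pwDl ?ltr0n//.
by rewrite sumr_ge0.
Qed.

(* [V (3/2)^n] is not an integer once [2 ^ n > V]. *)
Let not_uniform : exists w, w != [::] /\
  (2 / 3) ^+ size w * pair_v (rowmul (fun=> 1) w) != V.
Proof.
pose n := (\sum_t v t)%N; have VE : V = n%:R by rewrite natr_sum.
have n0 : (0 < n)%N by rewrite -(ltr0n R) -VE.
exists (nseq n false); split; first by rewrite -size_eq0 size_nseq -lt0n.
rewrite size_nseq; apply/eqP => h.
have /natrP[k hk] : pair_v (rowmul (fun=> 1) (nseq n false)) \is a Num.nat.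
  rewrite rpred_sum// => t _; rewrite rpredM ?natr_nat// rpred_sum// => s _.
  by rewrite mul1r wmx_nat.
have e : (2 ^ n * k = 3 ^ n * n)%N.
  apply/eqP; rewrite -(eqr_nat R) !natrM !natrX -hk -VE -h.
  by rewrite expr_div_n mulrA mulrCA divff ?mulr1 ?expf_neq0.
have : (2 ^ n %| n)%N.
  rewrite -(@Gauss_dvdr _ (3 ^ n)) ?coprimeXl ?coprimeXr//.
  by rewrite -e dvdn_mulr.
by move/(dvdn_leq n0); rewrite leqNgt ltn_expl.
Qed.

Let ratio M (x : 'I_(p + q) -> R) u := (2 / 3) ^+ M * pair_v (rowmul x u) / pair_v x.

Let pair_gt0 (x : 'I_(p + q) -> R) : (forall s, 0 < x s) -> 0 < pair_v x.
Proof.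
move=> x0; have [t vt] := vne; rewrite /pair_v (bigD1 t)//= ltr_pwDl//.
  by rewrite mulr_gt0 ?ltr0n.
by rewrite sumr_ge0// => s _; rewrite mulr_ge0// ltW.
Qed.

Let ratio_gt0 M (x : 'I_(p + q) -> R) u : (forall s, 0 < x s) -> 0 < ratio M x u.
Proof.
move=> x0; rewrite divr_gt0 ?pair_gt0// mulr_gt0 ?exprn_gt0 ?divr_gt0//.
by apply: pair_gt0; exact: rowmul_gt0.
Qed.

Let wavg_ratio M (x : 'I_(p + q) -> R) : (forall s, 0 < x s) -> wavg M (ratio M x) = 1.
Proof.
move=> x0; rewrite /ratio.
under eq_wavg => u _ do rewrite mulrC.
by rewrite wavgZ wavg_pair_v mulVf// gt_eqF// pair_gt0.
Qed.

(* If all ratios were near 1, appending the word of [not_uniform] after mixing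
   would give a ratio bounded away from 1. *)
Let gap_abs : exists M eta, [/\ (0 < M)%N, 0 < eta :> R &
  forall x : 'I_(p + q) -> R, (forall s, 0 < x s) -> eta <= wavg M (fun u => `|ratio M x u - 1|)].
Proof.
have [w [w0 hw]] := not_uniform; set m := size w in hw.
pose P := (2 / 3) ^+ m * pair_v (rowmul (fun=> 1) w).
have P0 : 0 < P.
  rewrite mulr_gt0 ?exprn_gt0 ?divr_gt0//; apply: pair_gt0; apply: rowmul_gt0.
  by move=> s; exact: ltr01.
pose eta := `|P - V| / 2.
have eta0 : 0 < eta by rewrite divr_gt0// normr_gt0 subr_eq0.
have [L [th [th0 th1 mix]]] := avgrow_mix.
have [j hj] : exists j, (1 - th) ^+ j * (V * P) <= eta.
  have /cvgrPdist_le/(_ (eta / (V * P))) : (fun j => (1 - th) ^+ j) @ \oo --> (0 : R).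
    by apply: cvg_expr; rewrite ger0_norm; lra.
  move=> /(_ (divr_gt0 eta0 (mulr_gt0 V0 P0)))[j _ /(_ j (leqnn j))]/=.
  rewrite sub0r normrN ger0_norm ?exprn_ge0 ?subr_ge0//.
  by rewrite ler_pdivlMr; [move=> h; exists j|exact: mulr_gt0].
pose kap : R := wavg m (fun u => (u == w)%:R).
have kap0 : 0 < kap by exact: wavg_eq_pos.
exists (j * L + m)%N, (kap * eta / V); split.
- by rewrite addn_gt0 orbC lt0n size_eq0 w0.
- by rewrite divr_gt0// mulr_gt0.
pose M := (j * L + m)%N.
(* [ratio] does not change when [x] is scaled, so [x] is normalised to pair with [v] as the constant
   vector 1 does. Since [v >= 1], the entries of [y] then lie in [0, V]. *)
move=> x x0; set c := V / pair_v x.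
have c0 : 0 < c by rewrite divr_gt0 ?pair_gt0.
pose y s := c * x s.
have y0 s : 0 < y s by rewrite mulr_gt0.
have yV : pair_v y = V.
  rewrite /pair_v /y; under eq_bigr do rewrite -mulrA.
  by rewrite -mulr_sumr -/(pair_v x) divfK// gt_eqF// pair_gt0.
have rE u : ratio M x u = ratio M y u.
  rewrite /ratio yV.
  have -> : pair_v (rowmul y u) = c * pair_v (rowmul x u).
    rewrite /pair_v mulr_sumr; apply: eq_bigr => t _.
    rewrite mulrA /rowmul mulr_sumr; congr (_ * _); apply: eq_bigr => s _.
    by rewrite mulrA.
  by rewrite /c; field; rewrite ?gt_eqF ?pair_gt0.
have [|lo hlo] := mix j y 0 V.
  move=> s; rewrite ltW//= add0r -yV /pair_v (bigD1 s)//=.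
  rewrite -[leLHS]addr0 lerD//.
    by rewrite ler_peMr ?ler1n ?perron_gt0// ltW.
  by rewrite sumr_ge0// => t _; rewrite mulr_ge0// ltW.
set z := avgrow (j * L) y in hlo; set ep := _ * V in hlo.
have zV : pair_v z = V.
  rewrite -[RHS]yV -(wavg_pair_v (j * L) y) /pair_v /z.
  under eq_bigr do rewrite mulrC -wavgZ.
  rewrite -wavg_sum; apply: eq_wavg => u _; rewrite mulr_sumr.
  by apply: eq_bigr => t _; rewrite mulrC mulrA.
(* [z] and the constant vector 1 have the same pairing with [v], so 1 lies in the short interval
   that contains the entries of [z]. *)
have lo1 : lo <= 1.
  rewrite -(ler_pM2r V0) mul1r -{2}zV /pair_v /V mulr_sumr.
  by apply: ler_sum => t _; rewrite ler_wpM2r//; have /andP[] := hlo t.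
have lo2 : 1 <= lo + ep.
  rewrite -(ler_pM2r V0) mul1r -{1}zV /pair_v /V mulr_sumr.
  by apply: ler_sum => t _; rewrite ler_wpM2r//; have /andP[] := hlo t.
have z1 t : `|z t - 1| <= ep.
  by have /andP[? ?] := hlo t; rewrite ler_norml; apply/andP; split; lra.
have zP : `|(2 / 3) ^+ m * pair_v (rowmul z w) - P| <= eta.
  have -> : (2 / 3) ^+ m * pair_v (rowmul z w) - P =
      (2 / 3) ^+ m * pair_v (rowmul (fun s => z s - 1) w).
    rewrite /P -mulrBr /pair_v -sumrB; congr (_ * _); apply: eq_bigr => t _.
    rewrite -mulrBl /rowmul -sumrB; congr (_ * _); apply: eq_bigr => s _.
    by rewrite mulrBl.
  apply: le_trans hj; rewrite mulrA -/ep /P mulrCA normrM ger0_norm ?exprn_ge0//.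
  rewrite ler_pM2l ?exprn_gt0 ?divr_gt0// /pair_v mulr_sumr.
  apply: (le_trans (ler_norm_sum _ _ _)); apply: ler_sum => t _.
  rewrite normrM (ger0_norm (ler0n _ _)) mulrA ler_wpM2r// /rowmul mulr_sumr.
  apply: (le_trans (ler_norm_sum _ _ _)); apply: ler_sum => s _.
  by rewrite normrM (ger0_norm (wmx_ge0 _ _ _ _)) mul1r ler_wpM2r ?wmx_ge0.
have etaw : eta <= `|(2 / 3) ^+ m * pair_v (rowmul z w) - V|.
  have : `|P - V| <= `|(2 / 3) ^+ m * pair_v (rowmul z w) - P| +
      `|(2 / 3) ^+ m * pair_v (rowmul z w) - V|.
    by rewrite (distrC _ P); exact: ler_distD.
  have -> : `|P - V| = eta + eta by rewrite /eta; field.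
  lra.
have zw : (2 / 3) ^+ m * pair_v (rowmul z w) - V =
    wavg (j * L) (fun u => V * (ratio M y (u ++ w) - 1)).
  rewrite wavgZ wavgD wavg_cst// mulrBr mulr1; congr (_ - _).
  rewrite -wavgZ /ratio yV.
  under [RHS]eq_wavg => u _ do rewrite mulrC divfK ?gt_eqF//.
  rewrite pair_rowmulE /z /avgrow mulr_sumr.
  under eq_bigr do rewrite mulrCA -mulrC -wavgZ.
  rewrite -wavg_sum; apply: eq_wavg => u _.
  transitivity ((2 / 3) ^+ M * pair_v (rowmul (rowmul y u) w)).
    rewrite pair_rowmulE mulr_sumr; apply: eq_bigr => s _.
    by rewrite /M exprD; ring.
  by congr (_ * _); apply: eq_bigr => t _; rewrite rowmul_cat.
have : eta <= V * wavg (j * L) (fun u => `|ratio M y (u ++ w) - 1|).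
  rewrite -wavgZ; apply: (le_trans etaw); rewrite zw.
  apply: (le_trans (wavg_norm _ _)); apply: le_wavg => u _.
  by rewrite normrM gtr0_norm.
rewrite -ler_pdivrMl// => h; under eq_wavg => u _ do rewrite rE.
rewrite wavg_cat (_ : kap * eta / V = kap * (V^-1 * eta)); last first.
  by rewrite -[LHS]mulrA; congr (_ * _); exact: mulrC.
apply: (@le_trans _ _ (kap * wavg (j * L) (fun u => `|ratio M y (u ++ w) - 1|))).
  by rewrite ler_pM2l.
rewrite -wavgZ; apply: le_wavg => u _; rewrite mulrC -wavgZ.
apply: le_wavg => w' _; case: eqP => [->|_]; first by rewrite mulr1.
by rewrite mulr0.
Qed.

(** With [r] the root of the ratio, [|r^2 - 1| = |r - 1| (r + 1)]. Young's inequality bounds this by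
    [(2 / eta) (r - 1)^2 + (eta / 4) (r^2 + 1)], whose last term has mean [eta / 2] because ratios
    have mean 1. *)
Let gap : exists M delta, [/\ (0 < M)%N, 0 < delta :> R &
  forall x : 'I_(p + q) -> R, (forall s, 0 < x s) ->
    delta <= wavg M (fun u => (Num.sqrt (ratio M x u) - 1) ^+ 2)].
Proof.
have [M [eta [M0 eta0 h]]] := gap_abs.
exists M, (eta ^+ 2 / 4); split=> //; first by rewrite divr_gt0// exprn_gt0.
move=> x x0; set G := wavg _ _; have t0 : 0 < 2 * eta^-1 by rewrite mulr_gt0 ?invr_gt0.
have : eta <= 2 * eta^-1 * G + eta / 2.
  apply: (le_trans (h x x0)).
  have -> : eta / 2 = wavg M (fun u => eta / 4 * (ratio M x u + 1)).
    by rewrite wavgZ wavgD wavg_cst// wavg_ratio//; field.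
  rewrite /G -wavgZ -wavgD; apply: le_wavg => u _.
  have := sqr_sqrtr (ltW (ratio_gt0 M u x0)).
  have := sqrtr_ge0 (ratio M x u); set r := Num.sqrt _ => r0 <-.
  have -> : r ^+ 2 - 1 = (r - 1) * (r + 1) by ring.
  rewrite normrM (ger0_norm (_ : 0 <= r + 1)); last lra.
  rewrite -[(r - 1) ^+ 2]real_normK ?num_real//.
  have : 0 <= (2 * eta^-1) * (`|r - 1| - eta / 4 * (r + 1)) ^+ 2.
    by rewrite mulr_ge0 ?sqr_ge0// ltW.
  have : 0 <= eta / 8 * (r - 1) ^+ 2 by rewrite mulr_ge0 ?sqr_ge0//; lra.
  have : eta^-1 * eta = 1 by rewrite mulVf// gt_eqF.
  set i := eta^-1; set d := `|r - 1| => ei.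
  have -> : 2 * i * (d - eta / 4 * (r + 1)) ^+ 2 = 2 * i * d ^+ 2 -
     (i * eta) * d * (r + 1) + eta * (i * eta) / 8 * (r + 1) ^+ 2 by field.
  rewrite ei; nra.
move=> hG; have : eta * eta <= eta * (2 * eta^-1 * G + eta / 2) by rewrite ler_pM2l.
have -> : eta * (2 * eta^-1 * G + eta / 2) = 2 * G + eta ^+ 2 / 2.
  by field; rewrite gt_eqF.
by lra.
Qed.

(* Quantitative Jensen: the defect of [ln y <= y - 1] is a square of
   [sqrt y - 1]; both variants are averaged over ratios of mean 1. *)
Let ln_le_sqrt (y : R) : 0 < y -> ln y <= y - 1 - (Num.sqrt y - 1) ^+ 2.
Proof.
move=> y0; have s0 : 0 < Num.sqrt y by rewrite sqrtr_gt0.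
rewrite -{1 2}(sqr_sqrtr (ltW y0)) lnXn// mulr2n.
have := @le_ln1Dx _ (Num.sqrt y - 1); rewrite [1 + _]addrC subrK => h.
have := h ltac:(lra); nra.
Qed.

Let xlnx_ge_sqrt (y : R) : 0 < y ->
  y - 1 + (Num.sqrt y - 1) ^+ 2 <= y * ln y.
Proof.
move=> y0; have s0 : 0 < Num.sqrt y by rewrite sqrtr_gt0.
have i0 : 0 < (Num.sqrt y)^-1 by rewrite invr_gt0.
have h : - ln (Num.sqrt y) <= (Num.sqrt y)^-1 - 1.
  rewrite -lnV//; have := @le_ln1Dx _ ((Num.sqrt y)^-1 - 1).
  by rewrite [1 + _]addrC subrK => h; apply: h; lra.
rewrite -{1 3 4}(sqr_sqrtr (ltW y0)) lnXn// mulr2n.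
move: h; set r := Num.sqrt y in s0 i0 *; set l := ln r => h.
have : r ^+ 2 * (1 - r^-1) <= r ^+ 2 * l by rewrite ler_pM2l ?exprn_gt0//; lra.
have -> : r ^+ 2 * (1 - r^-1) = r ^+ 2 - r by field; rewrite gt_eqF.
nra.
Qed.

Let pairE M (x : 'I_(p + q) -> R) u : (forall s, 0 < x s) ->
  pair_v (rowmul x u) = pair_v x * (3 / 2) ^+ M * ratio M x u.
Proof.
move=> x0; have px0 := pair_gt0 x0.
have e : (3 / 2) ^+ M * (2 / 3) ^+ M = 1 :> R.
  by rewrite -exprMn (_ : 3 / 2 * (2 / 3) = 1) ?expr1n//; field.
rewrite -[LHS]mul1r -{1}e /ratio.
by move: (_ ^+ M) (_ ^+ M) => a b; field; rewrite gt_eqF.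
Qed.

(** The defect is uniform over positive rows, so after [M] letters the argument restarts from the
    row [rowmul x u] and the defects add up. The second estimate weights words by the martingale
    itself, that is, it concerns the size-biased law. *)
Lemma lyapunov_gap : exists M delta, [/\ (0 < M)%N, 0 < delta :> R,
  forall j (x : 'I_(p + q) -> R), (forall s, 0 < x s) ->
    wavg (j * M) (fun u => ln (pair_v (rowmul x u))) <=
    ln (pair_v x) + j%:R * (M%:R * ln (3 / 2) - delta) &
  forall j (x : 'I_(p + q) -> R), (forall s, 0 < x s) ->
    pair_v x * (ln (pair_v x) + j%:R * (M%:R * ln (3 / 2) + delta)) <=
    wavg (j * M) (fun u => (2 / 3) ^+ (j * M) *
      (pair_v (rowmul x u) * ln (pair_v (rowmul x u))))].
Proof.
have [M [de [M0 de0 hde]]] := gap; exists M, de.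
have nil x : rowmul x [::] = x.
  apply/funext => t; rewrite /rowmul (bigD1 t)//= mxE eqxx mulr1 big1 ?addr0//.
  by move=> s st; rewrite mxE (negPf st) mulr0.
have catE x u u' : rowmul x (u ++ u') = rowmul (rowmul x u) u'.
  by apply/funext => t; rewrite rowmul_cat.
have lnE x u : (forall s, 0 < x s) -> ln (pair_v (rowmul x u)) =
    ln (pair_v x) + M%:R * ln (3 / 2) + ln (ratio M x u).
  move=> x0; have r0 := ratio_gt0 M u x0; have px0 := pair_gt0 x0.
  have e0 : 0 < (3 / 2 : R) ^+ M by rewrite exprn_gt0.
  rewrite (pairE M)//; move: (ratio M x u) (pair_v x) r0 px0 => r px r0 px0.
  rewrite lnM ?posrE//; last exact: mulr_gt0.
  rewrite [ln (px * _)]lnM ?posrE//.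
  by rewrite lnXn ?divr_gt0// [_ * ln _]mulr_natl.
split=> // j; elim: j => [|j IH] x x0.
- by rewrite /= nil mul0r addr0.
- rewrite mulSn wavg_cat.
  apply: (@le_trans _ _ (wavg M (fun u => ln (pair_v (rowmul x u)) +
      j%:R * (M%:R * ln (3 / 2) - de)))).
    apply: le_wavg => u _; have := IH (rowmul x u) (rowmul_gt0 u x0).
    by under eq_wavg => u' _ do rewrite -catE.
  rewrite wavgD wavg_cst//.
  have -> : ln (pair_v x) + j.+1%:R * (M%:R * ln (3 / 2) - de) =
      ln (pair_v x) + (M%:R * ln (3 / 2) - de) +
      j%:R * (M%:R * ln (3 / 2) - de).
    by rewrite -[j.+1%:R]natr1; ring.
  rewrite lerD2r.
  apply: (@le_trans _ _ (wavg M (fun u => ln (pair_v x) + M%:R * ln (3 / 2) +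
     (ratio M x u + - 1 + - (Num.sqrt (ratio M x u) - 1) ^+ 2)))).
    apply: le_wavg => u _; rewrite lnE// lerD2l; exact/ln_le_sqrt/ratio_gt0.
  rewrite !wavgD !wavg_cst// wavgN wavg_ratio//.
  by have := hde x x0; lra.
- by rewrite /= nil mul0r addr0 mul1r.
- rewrite mulSn wavg_cat.
  apply: (@le_trans _ _ (wavg M (fun u => (2 / 3) ^+ M * (pair_v (rowmul x u) *
      (ln (pair_v (rowmul x u)) + j%:R * (M%:R * ln (3 / 2) + de)))))); last first.
    apply: le_wavg => u _; have := IH (rowmul x u) (rowmul_gt0 u x0).
    rewrite -(ler_pM2l (_ : 0 < (2 / 3) ^+ M)) ?exprn_gt0 ?divr_gt0//.
    move=> /le_trans; apply; rewrite -wavgZ; apply: le_wavg => u' _.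
    by rewrite catE exprD mulrA.
  set c := j%:R * _; set px := pair_v x.
  have px0 : 0 < px by exact: pair_gt0.
  apply: (@le_trans _ _ (wavg M (fun u => px * ((ln px + M%:R * ln (3 / 2) + c) *
     ratio M x u + (ratio M x u + - 1 + (Num.sqrt (ratio M x u) - 1) ^+ 2))))).
    rewrite wavgZ ler_pM2l// !wavgD wavgZ !wavg_cst// wavg_ratio// mulr1 subrr add0r.
    have -> : j.+1%:R * (M%:R * ln (3 / 2) + de) = M%:R * ln (3 / 2) + de + c.
      by rewrite -[j.+1%:R]natr1 /c; ring.
    by have := hde x x0; lra.
  apply: le_wavg => u _; rewrite lnE// (pairE M)// -/px.
  have -> : (2 / 3) ^+ M * (px * (3 / 2) ^+ M * ratio M x u *
      (ln px + M%:R * ln (3 / 2) + ln (ratio M x u) + c)) =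
      px * ((ln px + M%:R * ln (3 / 2) + c) * ratio M x u +
        ratio M x u * ln (ratio M x u)).
    have e : (2 / 3) ^+ M * (3 / 2) ^+ M = 1 :> R.
      by rewrite -exprMn (_ : 2 / 3 * (3 / 2) = 1) ?expr1n//; field.
    rewrite -[RHS]mul1r -[X in _ = X * _]e; move: (ln (3 / 2)) (ln (ratio M x u)).
    by move: ((2 / 3) ^+ M) ((3 / 2) ^+ M) => a b l l'; ring.
  by rewrite ler_pM2l// lerD2l; exact/xlnx_ge_sqrt/ratio_gt0.
Qed.

End PerronGap.

(** * Binary digits and the tree of a slice *)

Section BinaryDigits.
Context {R : realType}.

Lemma truncn_addn (y : R) k : 0 <= y ->
  Num.truncn (y + k%:R) = (Num.truncn y + k)%N.
Proof.
move=> y0; apply: truncn_def; rewrite natrD lerD2r -addSn natrD ltrD2r.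
exact: truncn_itv.
Qed.

Lemma truncn_half (y : R) : 0 <= y -> Num.truncn (y / 2) = (Num.truncn y)./2.
Proof.
move=> y0; apply: truncn_def; have /andP[h1 h2] := truncn_itv y0.
rewrite ler_pdivlMr// ltr_pdivrMr// -!natrM; apply/andP; split.
  by apply: le_trans h1; rewrite ler_nat; lia.
by apply: (lt_le_trans h2); rewrite ler_nat; lia.
Qed.

(* The first [n] binary digits of the fractional part of [x >= 0]. *)
Definition bits n (x : R) : seq bool :=
  mkseq (fun j => odd (Num.truncn (2 ^+ j.+1 * x))) n.

Lemma size_bits n x : size (bits n x) = n. Proof. exact: size_mkseq. Qed.

Lemma bitsS n x : bits n.+1 x = odd (Num.truncn (2 * x)) :: bits n (2 * x).
Proof.
rewrite /bits /mkseq /= expr1; congr (_ :: _).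
rewrite -[1%N]addn0 iotaDl -map_comp; apply: eq_map => j /=.
by rewrite mulrA -exprSr add1n.
Qed.

Lemma bits_add m n x : bits (m + n) x = bits m x ++ bits n (2 ^+ m * x).
Proof.
elim: m x => [|m IH] x; first by rewrite expr0 mul1r.
by rewrite addSn !bitsS IH mulrA -exprSr.
Qed.

Lemma bits_addn n x k : 0 <= x -> bits n (x + k%:R) = bits n x.
Proof.
elim: n x k => [//|n IH] x k x0; rewrite !bitsS mulrDr -natrM.
have x20 : 0 <= 2 * x by rewrite mulr_ge0.
by rewrite IH// truncn_addn// oddD oddM addbF.
Qed.

Lemma bits_block m i j x : (i < j)%N ->
  take m (drop (i * m) (bits (j * m) x)) = bits m (2 ^+ (i * m) * x).
Proof.
move=> ij; rewrite -(subnKC ij) mulnDl mulSn [(m + _)%N]addnC -addnA bits_add.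
rewrite drop_size_cat ?size_bits// bits_add take_size_cat// size_bits//.
Qed.

End BinaryDigits.

Section Words.
Context (X : finType).

Fixpoint words n : seq (seq X) :=
  if n is m.+1 then [seq x :: s | x <- enum X, s <- words m] else [:: [::]].

Lemma mem_words n s : (s \in words n) = (size s == n).
Proof.
elim: n s => [|n IH] s /=; first by rewrite inE; case: s.
apply/allpairsP/eqP => [[[x t] [_ /= + ->]]|].
  by rewrite IH /= => /eqP ->.
case: s => // x t [tn]; exists (x, t); split => //=; first by rewrite mem_enum.
by rewrite IH tn.
Qed.

Lemma uniq_words n : uniq (words n).
Proof.
elim: n => [//|n IH] /=; apply: allpairs_uniq => //; first exact: enum_uniq.
by move=> [x s] [y t] _ _ /= [-> ->].
Qed.

Lemma big_wordsS (R : realType) n (F : seq X -> R) :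
  \sum_(s <- words n.+1) F s = \sum_x \sum_(s <- words n) F (x :: s).
Proof. by rewrite /= big_allpairs_dep/= big_enum. Qed.

Lemma big_words_add (R : realType) m n (F : seq X -> R) :
  \sum_(s <- words (m + n)) F s =
  \sum_(s <- words m) \sum_(t <- words n) F (s ++ t).
Proof.
elim: m F => [|m IH] F; first by rewrite big_seq1.
rewrite addSn !big_wordsS; apply: eq_bigr => x _; exact: IH.
Qed.

End Words.

Section DigitMaps.
Context {R : realType} {X : finType} (e : X -> nat).

Fixpoint gword (io : seq X) (y : R) : R :=
  if io is x :: io' then (gword io' y + (e x)%:R) / 2 else y.

Fixpoint ginv (io : seq X) (x : R) : R :=
  if io is i :: io' then ginv io' (2 * x - (e i)%:R) else x.

Lemma gwordK io : cancel (gword io) (ginv io).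
Proof.
elim: io => [//|i io IH] y /=.
by rewrite (_ : 2 * _ - _ = gword io y) ?IH//; field.
Qed.

Lemma ginvK io : cancel (ginv io) (gword io).
Proof. by elim: io => [//|i io IH] y /=; rewrite IH; field. Qed.

Lemma ginv_cat a b x : ginv (a ++ b) x = ginv b (ginv a x).
Proof. by elim: a x => //= i a IH x; rewrite IH. Qed.

Lemma gword_ge0 io y : 0 <= y -> 0 <= gword io y.
Proof.
by move=> y0; elim: io => //= i io IH; rewrite divr_ge0// addr_ge0.
Qed.

Lemma truncn_gword io y : 0 <= y ->
  Num.truncn (gword io y) = state e io (Num.truncn y).
Proof.
move=> y0; elim: io => //= i io <-.
by rewrite truncn_half ?truncn_addn ?addr_ge0 ?gword_ge0.
Qed.

Lemma bits_gword io y : 0 <= y ->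
  bits (size io) (gword io y) = output e io (Num.truncn y).
Proof.
move=> y0; elim: io => //= i io <-; have g0 := gword_ge0 io y0.
rewrite bitsS mulrC divfK// bits_addn// truncn_addn// truncn_gword//.
Qed.

(** Up to an integer, undoing [n] digits multiplies by 2^n; on fractional parts it is the shift of
    binary digits, whichever digits are undone. *)
Lemma ginv_shift io x : exists k : nat, ginv io x = 2 ^+ size io * x - k%:R.
Proof.
elim: io x => [|i io IH] x; first by exists 0%N; rewrite /= mul1r subr0.
have [k hk] := IH (2 * x - (e i)%:R).
exists (2 ^ size io * e i + k)%N; rewrite /= hk natrD natrM natrX exprS; ring.
Qed.

End DigitMaps.

(** * The tree of cylinders over a point and its Kraft inequality *)

Section SliceTree.
Context (R : realType) (p q : nat).
Let N := (p + q)%N.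
Hypotheses (p0 : (0 < p)%N) (q0 : (0 < q)%N).
Let e := dig p q.

(** The interval is half-open so that integer parts are exactly the indices of the matrices and the
    count below is an equality. The lost endpoint only matters for dyadic [x]. *)
Definition valid (x : R) (io : seq 'I_3) := (0 <= ginv e io x) && (ginv e io x < N%:R).

Let gword_lt io (y : R) : y < N%:R -> gword e io y < N%:R.
Proof.
move=> yN; elim: io => //= i io IH; rewrite ltr_pdivrMr// mulr_natr mulr2n.
rewrite ltr_leD// ler_nat /e /N; case: i => -[|[|[]]]//= i; rewrite /dig/=; lia.
Qed.

Lemma valid_itv x io : valid x io -> 0 <= x < N%:R.
Proof.
move=> /andP[h1 h2]; rewrite -(ginvK e io x).
by rewrite gword_ge0// gword_lt.
Qed.

Lemma valid_cat x a b : valid x (a ++ b) = valid (ginv e a x) b.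
Proof. by rewrite /valid ginv_cat. Qed.

Lemma bits_ginv m k x a : valid x a ->
  bits m (2 ^+ k * ginv e a x) = bits m (2 ^+ (k + size a) * x).
Proof.
move=> /andP[h _]; have [j hj] := ginv_shift e a x.
rewrite hj mulrBr -natrX -natrM mulrA natrX -exprD.
rewrite -(@bits_addn _ _ (_ - _) (2 ^ k * j)) ?subrK//.
by rewrite exprD -mulrA natrM natrX -mulrBr mulr_ge0 ?exprn_ge0// -hj.
Qed.

(** A digit [d] keeps [2 x - d] in [0, N) exactly if the integer part [m] of [2 x] is [t + d] for
    some [t < N], and [t] is then the integer part of [2 x - d]. *)
Lemma sum_valid n x (s : 'I_N) : s = Num.truncn x :> nat -> 0 <= x < N%:R ->
  \sum_(io <- words _ n) (valid x io)%:R = cnt R (bits n x) s.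
Proof.
elim: n x s => [|n IH] x s sx /andP[x0 xN].
  by rewrite big_seq1 cnt_nil /valid /= x0 xN.
rewrite big_wordsS bitsS -cat1s cnt_cat.
have x20 : 0 <= 2 * x by rewrite mulr_ge0.
set m := Num.truncn (2 * x).
have mE : m = (s.*2 + odd m)%N.
  have : s = m./2 :> nat by rewrite sx /m -truncn_half// mulrC mulKf.
  by move=> ->; rewrite addnC odd_double_half.
have /andP[m1 m2] := truncn_itv x20; rewrite -/m in m1 m2.
transitivity (\sum_i \sum_(t < N) (m == t + e i)%N%:R * cnt R (bits n (2 * x)) t).
  apply: eq_bigr => i _.
  have [/andP[y0 yN]|yN] := boolP (0 <= 2 * x - (e i)%:R < N%:R); last first.
    rewrite big_seq big1 => [|io _].
      rewrite big1// => t _; case: eqP => [mt|]; last by rewrite mul0r.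
      move: yN; rewrite subr_ge0 ltrBlDr -natrD; case/negP.
      apply/andP; split.
        by apply: le_trans m1; rewrite ler_nat mt leq_addl.
      apply: (lt_le_trans m2); by rewrite ler_nat mt -addSn leq_add2r ltn_ord.
    rewrite (_ : valid x _ = false)//; apply: contraNF yN => h.
    exact: (@valid_itv (2 * x - (e i)%:R) io).
  have tE : Num.truncn (2 * x - (e i)%:R) = (m - e i)%N.
    rewrite /m -{2}(subrK (e i)%:R (2 * x)) truncn_addn// addnK//.
  have em : (e i <= m)%N.
    by rewrite truncn_ge_nat// -subr_ge0.
  have tN : (m - e i < N)%N.
    by rewrite -tE truncn_lt_nat.
  rewrite (bigD1 (Ordinal tN))//= subnK// eqxx mul1r [X in _ = _ + X]big1 ?addr0.
    rewrite -[in RHS](subrK (e i)%:R (2 * x)) bits_addn//.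
    by rewrite -(IH _ (Ordinal tN)) ?tE ?y0.
  move=> t; rewrite -val_eqE/= => tm; case: eqP => [mt|]; last by rewrite mul0r.
  by move: tm; rewrite mt addnK eqxx.
rewrite exchange_big/=; apply: eq_bigr => t _; rewrite mulmx1 mxE mulr_suml.
by apply: eq_bigr => i _; rewrite -mE.
Qed.

(* The mass given to a word of j blocks of length m if at every block the mass
   is split over at least [mincnt] children. *)
Definition split_mass m j (x : R) : R :=
  \prod_(i < j) (mincnt R p q (bits m (2 ^+ (i * m) * x)))^-1.

Lemma split_mass_ge0 m j x : 0 <= split_mass m j x.
Proof. by apply: prodr_ge0 => i _; rewrite invr_ge0 ltW// mincnt_gt0. Qed.

Let N0 : (0 < N)%N. Proof. by rewrite addn_gt0 p0. Qed.

(* Kraft's inequality: a weight [W] on words that charges every branch of the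
   tree by at least [y] has total [split_mass]-weight at least [y]. *)
Lemma kraft m J x (W : seq 'I_3 -> R) y : 0 <= x < N%:R -> (forall s, 0 <= W s) ->
  (forall s, size s = (J * m)%N -> valid x s ->
     y <= \sum_(j < J.+1) W (take (j * m) s)) ->
  y <= \sum_(j < J.+1) split_mass m j x *
         \sum_(s <- words _ (j * m)) (valid x s)%:R * W s.
Proof.
elim: J x W y => [|J IH] x W y xN W0 h.
  rewrite big_ord1 /split_mass big_ord0 mul1r big_seq1.
  rewrite (_ : valid x [::] = true) ?mul1r//.
  by have := h [::]; rewrite big_ord1; apply.
rewrite big_ord_recl /split_mass big_ord0 mul1r big_seq1.
rewrite (_ : valid x [::] = true) ?mul1r//.
set S := \sum_(i < _) _.
have S0 : 0 <= S.
  apply: sumr_ge0 => i _; rewrite mulr_ge0 ?split_mass_ge0//.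
  by rewrite sumr_ge0// => s _; rewrite mulr_ge0.
(* Either the root alone pays [y], or the rest [z] has to be paid inside every valid subtree, of
   which there are at least [c]. *)
have [yW|/ltW yW] := leP y (W [::]); first by rewrite ler_wpDr.
rewrite -lerBlDl; set z := y - W [::].
have z0 : 0 <= z by rewrite subr_ge0.
set c := mincnt R p q (bits m x); have c0 : 0 < c by exact: mincnt_gt0.
pose T a := \sum_(j < J.+1) split_mass m j (ginv e a x) *
   \sum_(s <- words _ (j * m)) (valid (ginv e a x) s)%:R * W (a ++ s).
have hT a : size a = m -> valid x a -> z <= T a.
  move=> am va; apply: (IH _ (fun s => W (a ++ s))) => //.
  move=> s sJ vs; rewrite lerBlDl.
  have := h (a ++ s); rewrite size_cat am sJ mulSn valid_cat => /(_ erefl vs).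
  rewrite big_ord_recl take0; congr (_ <= _ + _); apply: eq_bigr => j _.
  by rewrite lift0 mulSn take_cat am ltnNge leq_addr/= addKn.
have SE : S = c^-1 * \sum_(a <- words _ m) (valid x a)%:R * T a.
  rewrite mulr_sumr.
  transitivity (\sum_(j < J.+1) \sum_(a <- words _ m) c^-1 * ((valid x a)%:R *
    (split_mass m j (ginv e a x) * \sum_(s <- words _ (j * m))
     (valid (ginv e a x) s)%:R * W (a ++ s)))).
    apply: eq_bigr => j _; rewrite lift0 mulSn big_words_add mulr_sumr.
    rewrite big_seq [RHS]big_seq; apply: eq_bigr => a; rewrite mem_words => /eqP am.
    have [va|nva] := boolP (valid x a); last first.
      rewrite mul0r mulr0 [X in _ * X]big1 ?mulr0// => s _.
      rewrite (_ : valid x _ = false) ?mul0r//; apply: contraNF nva.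
      by rewrite valid_cat => /valid_itv.
    rewrite mul1r mulrA; congr (_ * _); last first.
      by apply: eq_bigr => s _; rewrite valid_cat.
    rewrite /split_mass big_ord_recl mul0n mul1r; congr (_ * _).
    apply: eq_bigr => i _; rewrite bits_ginv// am lift0 mulSn addnC//.
  rewrite exchange_big/=; apply: eq_bigr => a _.
  by rewrite /T -!mulr_sumr.
rewrite SE ler_pdivlMl//.
apply: (@le_trans _ _ (\sum_(a <- words 'I_3 m) (valid x a)%:R * z)).
  rewrite -mulr_suml ler_wpM2r//.
  have tN : (Num.truncn x < N)%N.
    by rewrite truncn_lt_nat; case/andP: xN.
  by rewrite (@sum_valid m x (Ordinal tN)) ?mincnt_le.
rewrite big_seq [leRHS]big_seq; apply: ler_sum => a; rewrite mem_words => /eqP am.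
by case: (boolP (valid x a)) => [va|_]; rewrite ?mul0r// !mul1r hT.
Qed.

End SliceTree.

(** * Geometry of the gasket *)

Section GasketGeometry.
Context {R : realType} (p q : nat) (D : set (R * R)).
Let N := (p + q)%N.
Hypotheses (p0 : (0 < p)%N) (q0 : (0 < q)%N) (pq : coprime p q).
Hypothesis hD : is_sierpinski_gasket D.
Let e := dig p q.
Let r3 : R := Num.sqrt 3.

Let r3_gt0 : 0 < r3. Proof. by rewrite sqrtr_gt0. Qed.
Let r3_sq : r3 ^+ 2 = 3. Proof. by rewrite sqr_sqrtr. Qed.
Let r3_ge1 : 1 <= r3.
Proof. by rewrite -sqrtr1 ler_wsqrtr// ler1n. Qed.
Let r3_le2 : r3 <= 2.
Proof. by have := r3_sq; have := r3_gt0; rewrite expr2 => ? ?; nra. Qed.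

(* Coordinates in the basis given by two sides of the triangle; the gasket is
   contained in the simplex w1, w2 >= 0, w1 + w2 <= 1. *)
Definition w1 (z : R * R) : R := z.1 - z.2 / Num.sqrt 3.
Definition w2 (z : R * R) : R := 2 * z.2 / Num.sqrt 3.
(** The affine function with values [p], 0 and [p + q] at the vertices of the triangle. *)
Definition xproj (z : R * R) : R := p%:R + q%:R * w2 z - p%:R * w1 z.

Lemma w1_map i z : w1 (gasket_map i z) = (w1 z + (i == 1)%:R) / 2.
Proof.
rewrite /w1 /gasket_map /gasket_shift/=; have := r3_gt0; rewrite lt0r /r3 => /andP[? _].
by case: i => -[|[|[]]]//= i; field.
Qed.

Lemma w2_map i z : w2 (gasket_map i z) = (w2 z + (i == inord 2)%:R) / 2.
Proof.
rewrite /w2 /gasket_map /gasket_shift/= -val_eqE/= inordK//.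
have := r3_gt0; rewrite lt0r /r3 => /andP[? _].
by case: i => -[|[|[]]]//= i; field.
Qed.

Lemma xproj_map i z : xproj (gasket_map i z) = (xproj z + (e i)%:R) / 2.
Proof.
rewrite /xproj w1_map w2_map /e /dig -val_eqE/= -[X in X == _]/(val i) -val_eqE/= inordK//.
by case: i => -[|[|[]]]//= i; rewrite ?natrD; field.
Qed.

Lemma proj_thetaE theta z :
  tan theta = Num.sqrt 3 * p%:R / (2 * q%:R + p%:R) ->
  proj_theta theta z =
    Num.sqrt 3 / (2 * q%:R + p%:R) * (xproj z - p%:R).
Proof.
move=> ht; rewrite /proj_theta ht /xproj /w1 /w2.
have := r3_gt0; rewrite lt0r /r3 => /andP[? _].
field; apply/andP; split => //.
by rewrite -natrM -natrD pnatr_eq0; lia.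
Qed.

Fixpoint gasket_word (io : seq 'I_3) (z : R * R) : R * R :=
  if io is i :: io' then gasket_map i (gasket_word io' z) else z.

Lemma gasket_word_cat a b z :
  gasket_word (a ++ b) z = gasket_word a (gasket_word b z).
Proof. by elim: a => //= i a ->. Qed.

Lemma xproj_word io z : xproj (gasket_word io z) = gword e io (xproj z).
Proof. by elim: io => //= i io <-; rewrite xproj_map. Qed.

Lemma gasket_map_in i z : D z -> D (gasket_map i z).
Proof. by case: hD => _ _ DE Dz; rewrite DE; exists i => //; exists z. Qed.

Lemma gasket_word_in io z : D z -> D (gasket_word io z).
Proof. by move=> Dz; elim: io => //= i io; exact: gasket_map_in. Qed.

Lemma gasket_word_onto n z : D z ->
  exists io z', [/\ size io = n, D z' & z = gasket_word io z'].
Proof.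
elim: n z => [|n IH] z Dz; first by exists [::], z.
have : (\bigcup_(i : 'I_3) (gasket_map i @` D)) z by case: hD => _ _ <-.
move=> [i _ [z1 Dz1 <-]]; have [io [z' [sio Dz' ->]]] := IH _ Dz1.
by exists (i :: io), z'; rewrite /= sio.
Qed.

Let D_bounded : exists2 M : R, 0 < M & forall z, D z -> `|z.1| <= M /\ `|z.2| <= M.
Proof.
case: hD => _ cD _; have [M [Mr hM]] := compact_bounded cD.
exists (`|M| + 1); first by rewrite ltr_wpDl.
move=> z Dz; have := hM (`|M| + 1) _ z Dz.
rewrite (le_lt_trans (ler_norm M)) ?ltrDl// => /(_ isT) zM.
by split; apply: le_trans zM; rewrite prod_normE le_max lexx ?orbT.
Qed.

(** Being affine, [phi] is bounded on [D] by some [B]; unfolding [n] levels of the gasket improves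
    this to [B / 2^n]. *)
Let contract_le0 (phi : R * R -> R) a b c : (forall z, phi z = a * z.1 + b * z.2 + c) ->
  (forall i z, phi (gasket_map i z) <= phi z / 2) -> forall z, D z -> phi z <= 0.
Proof.
move=> phiE hphi; have [M M0 hM] := D_bounded.
pose B := `|a| * M + `|b| * M + `|c| + 1.
have B0 : 0 < B by rewrite ltr_wpDl// !addr_ge0// mulr_ge0// ltW.
have phiB z : D z -> phi z <= B.
  move=> /hM[h1 h2]; rewrite phiE /B; apply: ler_wpDr => //; apply: lerD.
    by apply: lerD; apply: le_trans (ler_norm _) _; rewrite normrM ler_wpM2l.
  exact: ler_norm.
have phin n z : D z -> phi z <= B / 2 ^+ n.
  elim: n z => [|n IH] z Dz; first by rewrite divr1; exact: phiB.
  have [io [z' [sio Dz' ->]]] := gasket_word_onto 1 Dz.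
  case: io sio => [//|i [|//]] _ /=; apply: (le_trans (hphi _ _)).
  by rewrite exprSr invfM mulrA ler_pM2r ?invr_gt0// IH.
move=> z Dz; rewrite leNgt; apply/negP => z0.
pose n := Num.bound (B / phi z).
have : B / phi z < 2 ^+ n.
  apply: (lt_trans (archi_boundP _)); first by rewrite ltW// divr_gt0.
  by rewrite -natrX ltr_nat ltn_expl.
rewrite ltr_pdivrMr// mulrC -ltr_pdivrMr ?exprn_gt0// ltNge.
by rewrite phin.
Qed.

Lemma w1_ge0 z : D z -> 0 <= w1 z.
Proof.
move=> Dz; rewrite -oppr_le0.
apply: (@contract_le0 (fun z => - w1 z) (- 1) (Num.sqrt 3)^-1 0) => // [y|i y].
  by rewrite /w1; ring.
by rewrite w1_map; have : 0 <= (i == 1)%:R :> R by []; lra.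
Qed.

Lemma w2_ge0 z : D z -> 0 <= w2 z.
Proof.
move=> Dz; rewrite -oppr_le0.
apply: (@contract_le0 (fun z => - w2 z) 0 (- 2 * (Num.sqrt 3)^-1) 0) => // [y|i y].
  by rewrite /w2; ring.
by rewrite w2_map; have : 0 <= (i == inord 2)%:R :> R by []; lra.
Qed.

Lemma w12_le1 z : D z -> w1 z + w2 z <= 1.
Proof.
move=> Dz; rewrite -subr_le0.
apply: (@contract_le0 (fun z => w1 z + w2 z - 1) 1 (Num.sqrt 3)^-1 (- 1)) => // [y|i y].
  by rewrite /w1 /w2; ring.
rewrite w1_map w2_map.
have : (i == 1)%:R + (i == inord 2)%:R <= 1 :> R.
  case: eqP => [->|_]; last by rewrite add0r; case: (_ == _); rewrite ?ler01.
  by rewrite -val_eqE/= inordK// addr0.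
by lra.
Qed.

Lemma xproj_itv z : D z -> 0 <= xproj z <= N%:R.
Proof.
move=> Dz; have h1 := w1_ge0 Dz; have h2 := w2_ge0 Dz; have h3 := w12_le1 Dz.
have p1 : 0 <= p%:R :> R by []; have q1 : 0 <= q%:R :> R by [].
by rewrite /xproj /N natrD; apply/andP; split; nra.
Qed.

Lemma gword_dist io (x y : R) :
  gword e io x - gword e io y = (x - y) / 2 ^+ size io.
Proof.
elim: io => [|i io IH] /=; first by rewrite divr1.
rewrite -mulrBl opprD addrACA subrr addr0 IH exprSr invfM; ring.
Qed.

Lemma xproj_continuous : continuous xproj.
Proof.
pose a := (q%:R * 2 / Num.sqrt 3 + p%:R / Num.sqrt 3 : R).
have -> : xproj = fun z => p%:R + a * z.2 - p%:R * z.1.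
  by apply/funext => z; rewrite /xproj /a /w1 /w2; ring.
move=> z; apply: cvgB; first apply: cvgD; first exact: cvg_cst.
- by apply: cvgMr; exact: cvg_snd.
- by apply: cvgMr; exact: cvg_fst.
Qed.

(** The projection has no gaps: row counts are at least 1, so [y] has valid words of every length
    [n], whose cylinders project to within [N / 2^n] of [y], and the image of [D] is closed. *)
Lemma xproj_surj y : 0 <= y < N%:R -> exists2 z, D z & xproj z = y.
Proof.
move=> yN; have [[z0 Dz0] cD _] := hD.
have : closed (xproj @` D).
  apply: compact_closed; first exact: norm_hausdorff.
  apply: continuous_compact => //; apply: continuous_subspaceT.
  exact: xproj_continuous.
move=> /(_ y)[|z Dz zy]; last by exists z.
move=> B /nbhs_ballP[r /= r0 rB].
pose n := Num.bound (N%:R / r).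
have hn : N%:R / 2 ^+ n < r.
  rewrite ltr_pdivrMr ?exprn_gt0// mulrC -ltr_pdivrMr//.
  apply: (lt_trans (archi_boundP _)); first by rewrite divr_ge0// ltW.
  by rewrite -natrX ltr_nat ltn_expl.
have [io sio vio] : exists2 io, size io = n & valid p q y io.
  have tN : (Num.truncn y < N)%N by rewrite truncn_lt_nat; case/andP: yN.
  have h1 := @sum_valid R p q p0 q0 n y (Ordinal tN) erefl yN.
  apply/not_exists2P => h; have := cnt_ge1 R p0 (bits n y) (Ordinal tN).
  rewrite -h1 big_seq big1 ?ler10// => io; rewrite mem_words => /eqP sio.
  by case: (h io) => // /negP/negPf ->.
exists (xproj (gasket_word io z0)); split.
  by exists (gasket_word io z0) => //; exact: gasket_word_in.
apply: rB; rewrite /ball/= xproj_word -{1}(ginvK e io y) gword_dist sio.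
apply: le_lt_trans hn; rewrite normrM [X in _ * X]ger0_norm ?invr_ge0 ?exprn_ge0//.
rewrite ler_pM2r ?invr_gt0 ?exprn_gt0//.
have /andP[a1 a2] := xproj_itv Dz0; have /andP[b1 b2] : 0 <= ginv e io y < N%:R := vio.
by rewrite ler_norml; apply/andP; split; lra.
Qed.

Lemma dist_coord (z w : R * R) :
  `|z.1 - w.1| <= euclid_dist z w /\ `|z.2 - w.2| <= euclid_dist z w.
Proof.
have h (a b : R) : `|a| <= Num.sqrt (a ^+ 2 + b ^+ 2).
  by rewrite -sqrtr_sqr ler_wsqrtr// lerDl sqr_ge0.
by split; rewrite /euclid_dist; [|rewrite [_ ^+ 2 + _]addrC]; exact: h.
Qed.

Lemma euclid_dist_le (z w : R * R) :
  euclid_dist z w <= `|z.1 - w.1| + `|z.2 - w.2|.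
Proof.
rewrite /euclid_dist -[leRHS]ger0_norm ?addr_ge0// -[leRHS]sqrtr_sqr ler_wsqrtr//.
rewrite [leRHS]sqrrD !real_normK ?num_real// [leRHS]addrAC lerDl.
by rewrite mulrn_wge0// mulr_ge0.
Qed.

Lemma gasket_word_sub io z w :
  (gasket_word io z).1 - (gasket_word io w).1 = (z.1 - w.1) / 2 ^+ size io /\
  (gasket_word io z).2 - (gasket_word io w).2 = (z.2 - w.2) / 2 ^+ size io.
Proof.
elim: io => [|i io [IH1 IH2]] /=; first by rewrite !divr1.
by split; rewrite opprD addrACA subrr addr0 -mulrBl ?IH1 ?IH2 exprSr invfM; ring.
Qed.

Lemma cylinder_diam io z w : D z -> D w ->
  euclid_dist (gasket_word io z) (gasket_word io w) <= 2 / 2 ^+ size io.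
Proof.
move=> Dz Dw; apply: (le_trans (euclid_dist_le _ _)).
have [-> ->] := gasket_word_sub io z w; rewrite !normrM.
rewrite (ger0_norm (_ : 0 <= (2 ^+ size io)^-1)) ?invr_ge0 ?exprn_ge0//.
rewrite -mulrDl ler_pM2r ?invr_gt0 ?exprn_gt0//.
have coord y : D y -> 0 <= y.1 <= 1 /\ 0 <= y.2 <= 1.
  move=> Dy; have := w1_ge0 Dy; have := w2_ge0 Dy; have := w12_le1 Dy.
  have i0 : 0 < (Num.sqrt 3 : R)^-1 by rewrite invr_gt0.
  have i1 : (Num.sqrt 3 : R)^-1 * Num.sqrt 3 = 1 by rewrite mulVf// gt_eqF.
  have y1E : y.1 = w1 y + w2 y / 2.
    by rewrite /w1 /w2; field; rewrite gt_eqF.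
  have y2E : y.2 = w2 y * r3 / 2.
    by rewrite /w2 /r3; field; rewrite gt_eqF.
  move: (w1 y) (w2 y) y1E y2E => a b -> -> h1 h2 h3.
  by have := r3_le2; have := r3_ge1 => ? ?; split; apply/andP; split; nra.
have [/andP[a1 a2] /andP[b1 b2]] := coord z Dz.
have [/andP[c1 c2] /andP[d1 d2]] := coord w Dw.
have h1 : `|z.1 - w.1| <= 1 by rewrite ler_norml; apply/andP; split; lra.
have h2 : `|z.2 - w.2| <= 1 by rewrite ler_norml; apply/andP; split; lra.
lra.
Qed.

(* A cylinder is located by the integer parts [code 1], [code 2] of its rescaled
   coordinates, so a set of diameter [2^-n] meets at most 7 * 7 of them. *)
Fixpoint code (k : 'I_3) (io : seq 'I_3) : nat :=
  if io is i :: io' then ((i == k) * 2 ^ size io' + code k io')%N else 0%N.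

Let code_lt k io : (code k io < 2 ^ size io)%N.
Proof.
elim: io => //= i io IH; rewrite expnS mul2n -addnn.
by case: (i == k); rewrite ?mul1n ?mul0n; [rewrite ltn_add2l|rewrite ltn_addl].
Qed.

Let code_inj io io' : size io = size io' -> code 1%R io = code 1%R io' ->
  code (inord 2) io = code (inord 2) io' -> io = io'.
Proof.
elim: io io' => [|i io IH] [|i' io']//= [ss].
rewrite ss => c1 c2.
have key k : ((i == k) * 2 ^ size io' + code k io =
    (i' == k) * 2 ^ size io' + code k io')%N ->
    (i == k) = (i' == k) /\ code k io = code k io'.
  have := code_lt k io; rewrite ss; have := code_lt k io'.
  by move: (2 ^ _)%N => P; case: (i == k); case: (i' == k); split=> //; lia.
have [e1 d1] := key _ c1; have [e2 d2] := key _ c2.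
rewrite (IH io')//; congr (_ :: _); apply: val_inj => /=.
move: e1 e2; rewrite -!val_eqE/= !inordK//.
by case: i {c1 c2 key} => -[|[|[]]]//= _; case: i' => -[|[|[]]].
Qed.

Let w1_word io z : w1 (gasket_word io z) * 2 ^+ size io = w1 z + (code 1%R io)%:R.
Proof.
elim: io => [|i io IH] /=; first by rewrite mulr1 addr0.
by rewrite w1_map natrD natrM natrX addrCA -IH exprS; field.
Qed.

Let w2_word io z :
  w2 (gasket_word io z) * 2 ^+ size io = w2 z + (code (inord 2) io)%:R.
Proof.
elim: io => [|i io IH] /=; first by rewrite mulr1 addr0.
by rewrite w2_map natrD natrM natrX addrCA -IH exprS; field.
Qed.

Definition meets (U : set (R * R)) io := exists2 z, D z & U (gasket_word io z).

(** After multiplication by 2^n the coordinates differ by at most 2, the Lipschitz constant, and the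
    offsets [f z], [f w] in [0, 1] add at most 1. *)
Let code_close k (f : R * R -> R) (U : set (R * R)) io io' :
  (forall io z, f (gasket_word io z) * 2 ^+ size io = f z + (code k io)%:R) ->
  (forall z, D z -> 0 <= f z <= 1) ->
  (forall z w, `|f z - f w| <= 2 * euclid_dist z w) ->
  size io = size io' ->
  (forall z w, U z -> U w -> euclid_dist z w <= (2 ^+ size io)^-1) ->
  meets U io -> meets U io' -> (code k io <= code k io' + 3)%N.
Proof.
move=> fw f01 fd ss hU [z Dz Uz] [w Dw Uw].
have := fd (gasket_word io z) (gasket_word io' w).
have h := hU _ _ Uz Uw => fzw.
have {}h := le_trans fzw (ler_wpM2l (ler0n R 2) h).
move: h; rewrite -(ler_pM2r (_ : 0 < 2 ^+ size io)) ?exprn_gt0//.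
rewrite -mulrA mulVf ?mulr1 ?expf_neq0// -{1}[X in _ * X]ger0_norm ?exprn_ge0//.
rewrite -normrM mulrBl fw {1}ss fw ler_norml => /andP[_].
have /andP[? ?] := f01 _ Dz; have /andP[? ?] := f01 _ Dw.
move=> h; rewrite -(ler_nat R) natrD; lra.
Qed.

Lemma packing n (U : set (R * R)) :
  (forall z w, U z -> U w -> euclid_dist z w <= (2 ^+ n)^-1) ->
  \sum_(s <- words 'I_3 n) `[<meets U s>]%:R <= 49 :> R.
Proof.
move=> hU; pose S := [seq s <- words 'I_3 n | `[<meets U s>]].
have -> : \sum_(s <- words 'I_3 n) `[<meets U s>]%:R = (size S)%:R :> R.
  rewrite /S -sum1_size big_filter natr_sum [RHS]big_mkcond/=.
  by apply: eq_bigr => s _; case: asboolP.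
have SP s : s \in S -> size s = n /\ meets U s.
  by rewrite mem_filter mem_words => /andP[/asboolP ? /eqP].
rewrite (ler_nat R _ 49); case: (posnP (size S)) => [-> //|S0].
pose s0 := nth [::] S 0.
have s0S : s0 \in S by rewrite mem_nth.
have iS : (Num.sqrt 3 : R)^-1 <= 1 by rewrite invf_le1.
have i0 : 0 <= (Num.sqrt 3 : R)^-1 by rewrite invr_ge0.
have w101 z : D z -> 0 <= w1 z <= 1.
  by move=> Dz; have := w1_ge0 Dz; have := w2_ge0 Dz; have := w12_le1 Dz; lra.
have w201 z : D z -> 0 <= w2 z <= 1.
  by move=> Dz; have := w1_ge0 Dz; have := w2_ge0 Dz; have := w12_le1 Dz; lra.
have w1d z w : `|w1 z - w1 w| <= 2 * euclid_dist z w.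
  have [h1 h2] := dist_coord z w.
  have -> : w1 z - w1 w = (z.1 - w.1) - (z.2 - w.2) / Num.sqrt 3.
    by rewrite /w1; ring.
  apply: (le_trans (ler_normB _ _)); rewrite normrM (ger0_norm i0) mulr_natl mulr2n.
  by rewrite lerD//; apply: le_trans h2; rewrite ler_piMr.
have w2d z w : `|w2 z - w2 w| <= 2 * euclid_dist z w.
  have [h1 h2] := dist_coord z w.
  have -> : w2 z - w2 w = 2 * ((z.2 - w.2) / Num.sqrt 3) by rewrite /w2; ring.
  rewrite normrM ger0_norm// ler_pM2l// normrM (ger0_norm i0).
  by apply: le_trans h2; rewrite ler_piMr.
have c1 s s' : s \in S -> s' \in S -> (code 1%R s <= code 1%R s' + 3)%N.
  move=> /SP[ss ms] /SP[ss' ms']; apply: (code_close w1_word w101 w1d _ _ ms ms').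
    by rewrite ss.
  by rewrite ss.
have c2 s s' : s \in S -> s' \in S ->
    (code (inord 2) s <= code (inord 2) s' + 3)%N.
  move=> /SP[ss ms] /SP[ss' ms']; apply: (code_close w2_word w201 w2d _ _ ms ms').
    by rewrite ss.
  by rewrite ss.
pose phi s := ((code 1%R s + 3 - code 1%R s0)%N,
               (code (inord 2) s + 3 - code (inord 2) s0)%N).
rewrite -(size_map phi).
apply: (@leq_trans (size [seq (a, b) | a <- iota 0 7, b <- iota 0 7])) => //.
apply: uniq_leq_size.
  rewrite map_inj_in_uniq ?filter_uniq ?uniq_words// => s s' sS s'S [h1 h2].
  have := c1 _ _ s0S sS; have := c1 _ _ s0S s'S.
  have := c2 _ _ s0S sS; have := c2 _ _ s0S s'S.
  have [ss _] := SP _ sS; have [ss' _] := SP _ s'S => *.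
  by apply: code_inj; [rewrite ss|lia|lia].
move=> _ /mapP[s sS ->]; apply/allpairsP; exists (phi s).
have := c1 _ _ sS s0S; have := c2 _ _ sS s0S.
by rewrite !mem_iota /phi/= => *; split=> //; lia.
Qed.

Definition slice (x : R) := [set z | D z /\ xproj z = x].

(** A covering set charges the words of its own level whose cylinder it meets, at most 49 of them.
    Each valid word is realised by a point of the slice, so every branch is charged and Kraft's
    inequality applies. *)
Lemma finite_cover_mass m x n (U : nat -> set (R * R)) (lev : nat -> nat) :
  (0 < m)%N -> 0 <= x < N%:R -> slice x `<=` \bigcup_(i < n) U i ->
  (forall i z w, (i < n)%N -> U i z -> U i w ->
     euclid_dist z w <= (2 ^+ (lev i * m))^-1) ->
  1 <= 49 * \sum_(i < n) split_mass p q m (lev i) x.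
Proof.
move=> m0 xN cov hU; pose J := (\max_(i < n) lev i)%N.
pose W (s : seq 'I_3) : R :=
  \sum_(i < n) (size s == lev i * m)%N%:R * `[<meets (U i) s>]%:R.
have W0 s : 0 <= W s by apply: sumr_ge0 => i _; rewrite mulr_ge0.
have hW s : size s = (J * m)%N -> valid p q x s ->
    1 <= \sum_(j < J.+1) W (take (j * m) s).
  move=> sJ vs; have [z' Dz' z'E] := xproj_surj vs.
  have [|i /= ni Uz] := cov (gasket_word s z').
    split; first exact: gasket_word_in.
    by rewrite xproj_word z'E ginvK.
  have lJ : (lev i < J.+1)%N by rewrite ltnS (leq_bigmax (Ordinal ni)).
  rewrite (bigD1 (Ordinal lJ))//= -[leLHS]addr0 lerD//; last exact: sumr_ge0.
  rewrite /W (bigD1 (Ordinal ni))//= -[leLHS]addr0 lerD//; last first.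
    by apply: sumr_ge0 => k _; rewrite mulr_ge0.
  have -> : size (take (lev i * m) s) = (lev i * m)%N.
    by rewrite size_takel// sJ leq_mul2r -ltnS lJ orbT.
  rewrite eqxx mul1r.
  case: asboolP => // h; exfalso; apply: h.
  exists (gasket_word (drop (lev i * m) s) z'); first exact: gasket_word_in.
  by rewrite -gasket_word_cat cat_take_drop.
apply: (le_trans (kraft p0 q0 xN W0 hW)).
apply: (@le_trans _ _ (\sum_(j < J.+1) split_mass p q m j x *
   \sum_(i < n) (j == lev i :> nat)%:R * 49)).
  apply: ler_sum => j _; rewrite ler_wpM2l ?split_mass_ge0//.
  apply: (@le_trans _ _ (\sum_(s <- words 'I_3 (j * m)) W s)).
    by apply: ler_sum => s _; case: (valid _ _ _ _); rewrite ?mul1r ?mul0r.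
  rewrite exchange_big/=; apply: ler_sum => i _.
  rewrite big_seq; under eq_bigr => s.
    rewrite mem_words => /eqP ->; rewrite eqn_pmul2r//; over.
  rewrite -mulr_sumr -big_seq; case: eqP => [jE|_]; last by rewrite !mul0r.
  rewrite !mul1r; apply: packing => z w; rewrite jE; exact: hU.
under eq_bigr do rewrite mulr_sumr.
rewrite exchange_big/= mulr_sumr; apply: ler_sum => i _.
have lJ : (lev i < J.+1)%N by rewrite ltnS leq_bigmax.
rewrite (bigD1 (Ordinal lJ))//= eqxx mul1r [X in _ + X]big1.
  by rewrite addr0 [leLHS]mulrC.
by move=> j; rewrite -val_eqE/= => /negPf ->; rewrite mul0r mulr0.
Qed.

End GasketGeometry.

(** * Dimensions of a slice with given growth *)

Section DimensionBounds.
Context {R : realType}.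
Implicit Types (U E : set (R * R)).

Lemma diam_ge0 U : (0 <= diam U)%E.
Proof. by rewrite /diam le_max lexx. Qed.

Lemma diam_le U (r : R) : 0 <= r ->
  (forall z w, U z -> U w -> euclid_dist z w <= r) -> (diam U <= r%:E)%E.
Proof.
move=> r0 h; rewrite /diam ge_max lee_fin r0/=.
by apply: ge_ereal_sup => _ [z Uz [w Uw <-]]; rewrite lee_fin h.
Qed.

Lemma dist_le_diam U (r : R) z w : (diam U <= r%:E)%E -> U z -> U w ->
  euclid_dist z w <= r.
Proof.
rewrite /diam ge_max => /andP[_ h] Uz Uw; rewrite -lee_fin; apply: le_trans h.
by apply: ereal_sup_ubound; exists z => //; exists w.
Qed.

Lemma diam_pow_ge0 t U : (0 <= diam_pow t U)%E.
Proof. by rewrite /diam_pow; case: ifP => // _; exact: poweR_ge0. Qed.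

Lemma diam_pow_le t U (r : R) : 0 <= t -> 0 <= r -> (diam U <= r%:E)%E ->
  (diam_pow t U <= (r `^ t)%:E)%E.
Proof.
move=> t0 r0 h; rewrite /diam_pow; case: ifP => _; first by rewrite lee_fin powR_ge0.
by rewrite -poweR_EFin; apply: gt0_ler_poweR => //;
  rewrite in_itv/= ?diam_ge0 ?lee_fin ?r0 ?leey.
Qed.

Lemma hausdorff_premeasure_ge0 t r E : (0 <= hausdorff_premeasure t r E)%E.
Proof.
apply: le_ereal_inf_tmp => _ [U _ <-].
by apply: nneseries_ge0 => i _ _; exact: diam_pow_ge0.
Qed.

Lemma covering_number_le r E n (U : nat -> set (R * R)) :
  E `<=` \bigcup_(i < n) U i -> (forall i, (diam (U i) <= r%:E)%E) ->
  (covering_number r E <= (n%:R : R)%:E)%E.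
Proof.
move=> cov hU; apply: ereal_inf_lbound; exists n => //; exists (fun i : 'I_n => U i).
split=> // z /cov [i ni Uz]; by exists (Ordinal ni).
Qed.

Lemma le_covering_number (y : R) r E :
  (forall n (U : nat -> set (R * R)), E `<=` \bigcup_(i < n) U i ->
     (forall i, (i < n)%N -> (diam (U i) <= r%:E)%E) -> y <= n%:R) ->
  (y%:E <= covering_number r E)%E.
Proof.
move=> h; apply: le_ereal_inf_tmp => _ [n [U [cov hU]] <-]; rewrite lee_fin.
apply: (h n (fun i => if insub i is Some j then U j else set0)) => [z /cov[i _ Uz]|i ni].
  by exists i => /=; [exact: ltn_ord|rewrite valK].
by rewrite insubT.
Qed.

Lemma box_ratio_bounds E (r y K : R) : 0 < r < 1 -> 0 < y ->
  (y%:E <= covering_number r E)%E -> (covering_number r E <= K%:E)%E ->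
  ((ln y / - ln r)%:E <= box_ratio E r)%E /\ (box_ratio E r <= (ln K / - ln r)%:E)%E.
Proof.
move=> r01 y0; rewrite /box_ratio; move: (covering_number r E) => -[c| |] //.
  rewrite !lee_fin => yc cK; have c0 : 0 < c by exact: lt_le_trans yc.
  have i0 : 0 < (- ln r)^-1 by rewrite invr_gt0 oppr_gt0 ln_lt0.
  rewrite lne_EFin// -EFinM !lee_fin !ler_pM2r//.
  by rewrite !ler_ln ?posrE// (lt_le_trans c0).
Qed.

Lemma near0_itv (delta : R) : 0 < delta -> (0 : R)^'+ [set r | 0 < r < delta].
Proof.
move=> d0; near=> r => /=; apply/andP; split => //.
Unshelve. all: by end_near.
Qed.

Lemma has_box_dim_squeeze E (l : R) :
  (forall eps, 0 < eps -> exists2 delta, 0 < delta & forall r, 0 < r < delta ->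
    ((l - eps)%:E <= box_ratio E r)%E /\ (box_ratio E r <= (l + eps)%:E)%E) ->
  has_box_dim E l%:E.
Proof.
move=> h.
have up : (upper_box_dim E <= l%:E)%E.
  apply/lee_addgt0Pr => eps /h[delta d0 hd].
  apply: (@le_trans _ _ (ereal_sup (box_ratio E @` [set r | 0 < r < delta]))).
    by apply: ereal_inf_lbound; exists [set r | 0 < r < delta] => //; exact: near0_itv.
  by apply: ge_ereal_sup => _ [r /= /hd[_ hr] <-].
have lo : (l%:E <= lower_box_dim E)%E.
  apply/lee_subgt0Pr => eps /h[delta d0 hd]; rewrite /lower_box_dim limf_einfE.
  apply: (@le_trans _ _ (ereal_inf (box_ratio E @` [set r | 0 < r < delta]))).
    by apply: le_ereal_inf_tmp => _ [r /= /hd[hr _] <-].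
  by apply: ereal_sup_ubound; exists [set r | 0 < r < delta] => //; exact: near0_itv.
have lu : (lower_box_dim E <= upper_box_dim E)%E.
  rewrite /lower_box_dim limf_einfE; apply: ge_ereal_sup => _ [V FV <-].
  apply: le_ereal_inf_tmp => _ [W FW <-].
  have [r [Vr Wr]] : V `&` W !=set0 by exact: (filter_ex (filterI FV FW)).
  apply: (@le_trans _ _ (box_ratio E r)).
    by apply: ereal_inf_lbound; exists r.
  by apply: ereal_sup_ubound; exists r.
by split; apply/eqP; rewrite eq_le ?lo ?up ?(le_trans lu up) ?(le_trans lo lu).
Qed.

End DimensionBounds.

(** * Box and Hausdorff dimension from the growth of the counts *)

Section SliceDimension.
Context {R : realType} (p q : nat) (D : set (R * R)).
Let N := (p + q)%N.
Hypotheses (p0 : (0 < p)%N) (q0 : (0 < q)%N) (pq : coprime p q).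
Hypothesis hD : is_sierpinski_gasket D.
Variables (x g : R).
Hypothesis x_itv : 0 <= x < N%:R.
Hypothesis x_nondyadic : forall n k : nat, 2 ^+ n * x != k%:R.
Hypothesis growth_le : forall eps, 0 < eps -> exists n0, forall n, (n0 <= n)%N ->
  tot R p q (bits n x) <= expR (n%:R * (g + eps)).
Hypothesis mass_le : forall eps, 0 < eps -> exists m j0, (0 < m)%N /\
  forall j, (j0 <= j)%N -> split_mass p q m j x <= expR (- (j%:R * m%:R * (g - eps))).

Let E := slice p q D x.
Let L : R := ln 2.

Let L0 : 0 < L. Proof. by rewrite ln_gt0// ltr1n. Qed.
Let exp2 n : 2 ^+ n = expR (n%:R * L).
Proof. by rewrite expRM_natl lnK// posrE. Qed.

Lemma slice_cover n : exists K (V : nat -> set (R * R)),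
  [/\ (K%:R : R) <= tot R p q (bits n x), E `<=` \bigcup_(i < K) V i,
      forall i, (K <= i)%N -> V i = set0 &
      forall i, (diam (V i) <= (2 / 2 ^+ n)%:E)%E].
Proof.
pose S := [seq s <- words 'I_3 n | valid p q x s].
pose V i := if (i < size S)%N then gasket_word (nth [::] S i) @` D else set0.
exists (size S), V; split.
- have tN : (Num.truncn x < N)%N by rewrite truncn_lt_nat; case/andP: x_itv.
  apply: le_trans (cnt_le_tot R p0 _ (Ordinal tN)).
  rewrite -(@sum_valid R p q p0 q0 n x (Ordinal tN))// /S -sum1_size big_filter.
  by rewrite natr_sum big_mkcond/=; apply: ler_sum => s _; case: (valid _ _ _ _).
- move=> z [Dz xz]; have [io [z' [sio Dz' zE]]] := gasket_word_onto hD n Dz.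
  have yE : ginv (dig p q) io x = xproj p q z'.
    by rewrite -xz zE xproj_word gwordK.
  have vio : valid p q x io.
    have /andP[h1 h2] := xproj_itv p q hD Dz'.
    (* The value [N], possible for [xproj] but excluded by [valid], would make [x] dyadic. *)
    rewrite /valid yE h1 lt_neqAle h2 andbT; apply/eqP => yN.
    have [k hk] := ginv_shift (dig p q) io x.
    have /eqP := x_nondyadic (size io) (N + k); apply.
    by rewrite natrD -yN -yE hk subrK.
  have ioS : io \in S by rewrite mem_filter vio mem_words sio /=.
  exists (index io S); first by rewrite /= index_mem.
  by rewrite /V index_mem ioS nth_index//; exists z'.
- by move=> i; rewrite leqNgt /V => /negPf ->.
- move=> i; apply: diam_le; first by rewrite divr_ge0 ?exprn_ge0.
  move=> z w; rewrite /V; case: ifP => // iS [z' Dz' <-] [w' Dw' <-].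
  have := mem_nth [::] iS; rewrite mem_filter mem_words => /andP[_ /eqP <-].
  exact: (cylinder_diam hD _ Dz' Dw').
Qed.

Let g_ge0 : 0 <= g.
Proof.
apply/ler_addgt0Pr => eps /growth_le[n0 /(_ n0.+1 (leqnSn _)) h].
have := le_trans (@tot_ge1 R p q p0 (bits n0.+1 x)) h; rewrite -{1}(expR0 R) ler_expR.
by rewrite pmulr_rge0// addrC.
Qed.

Let cover_lower m j (r : R) n (U : nat -> set (R * R)) : (0 < m)%N ->
  r <= (2 ^+ (j * m))^-1 ->
  E `<=` \bigcup_(i < n) U i -> (forall i, (i < n)%N -> (diam (U i) <= r%:E)%E) ->
  1 <= 49 * (n%:R * split_mass p q m j x).
Proof.
move=> m0 rj cov hU.
have := finite_cover_mass p0 q0 pq hD (lev := fun=> j) m0 x_itv cov.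
rewrite sumr_const card_ord -[_ *+ n]mulr_natl; apply => i z w ni Uz Uw.
by apply: le_trans rj; exact: dist_le_diam (hU _ ni) Uz Uw.
Qed.

Lemma slice_box_dim : has_box_dim E (g / L)%:E.
Proof.
apply: has_box_dim_squeeze => eps eps0.
pose e1 := eps * L / 2; have e10 : 0 < e1 by rewrite divr_gt0// mulr_gt0.
have [n0 hn0] := growth_le e10.
have [m [j0 [m0 hj0]]] := mass_le e10.
have mR : 0 < m%:R :> R by rewrite ltr0n.
(* [C] collects the errors that do not grow with [- ln r]: rounding down to full blocks of length
   [m], the packing constant, and the two extra levels of the cover. *)
pose C := m%:R * `|g - e1| + ln 49 + 2 * (g + e1).
have C1 : 0 <= ln 49 :> R by rewrite ln_ge0// ler1n.
have C2 : 0 <= m%:R * `|g - e1| by rewrite mulr_ge0.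
have C3 : 0 <= 2 * (g + e1) by rewrite mulr_ge0// addr_ge0// ltW.
have C0 : 0 <= C by rewrite !addr_ge0.
have mL0 : 0 < m%:R * L by rewrite mulr_gt0.
have a1 : 0 <= n0%:R * L by rewrite mulr_ge0// ltW.
have a2 : 0 <= j0.+1%:R * (m%:R * L) by rewrite mulr_ge0// ltW.
have a3 : 0 <= 2 * C / eps by rewrite divr_ge0 ?mulr_ge0// ltW.
pose T := 1 + n0%:R * L + j0.+1%:R * (m%:R * L) + 2 * C / eps.
have T1 : 1 <= T by rewrite /T; lra.
exists (expR (- T)); first exact: expR_gt0.
move=> r /andP[r0 rT]; pose t := - ln r.
have rE : r = expR (- t) by rewrite opprK lnK.
have tT : T < t by move: rT; rewrite rE ltr_expR ltrN2.
have t0 : 0 < t by apply: lt_trans tT; apply: lt_le_trans T1.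
have r1 : 0 < r < 1 by rewrite r0 rE -expR0 ltr_expR oppr_lt0.
have tn0 : n0%:R * L <= t by move: tT; rewrite /T; lra.
have tj0 : j0.+1%:R * (m%:R * L) <= t by move: tT; rewrite /T; lra.
have tC : C / t <= eps / 2.
  rewrite ler_pdivrMr// -ler_pdivrMl ?divr_gt0//.
  have -> : (eps / 2)^-1 * C = 2 * C / eps by field; exact: lt0r_neq0.
  by move: tT; rewrite /T; lra.
have tL0 : 0 <= t / L by rewrite divr_ge0// ltW.
(* One extra level passes the scale [r], the other absorbs the factor 2 in the diameter of
   cylinders. *)
pose n := (Num.truncn (t / L)).+2.
have /andP[n1 n2] := truncn_itv tL0.
have nn0 : (n0 <= n)%N.
  rewrite ltnW// ltnS ltnW// ltnS truncn_ge_nat//.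
  by rewrite ler_pdivlMr.
have n_r : 2 / 2 ^+ n <= r.
  rewrite rE exprS invfM mulrA divff// mul1r exp2 -expRN ler_expR lerN2.
  by rewrite -ler_pdivrMr// ltW.
have n_t : n%:R * (g + e1) <= t / L * (g + e1) + C.
  apply: (@le_trans _ _ ((t / L + 2) * (g + e1))).
    apply: ler_wpM2r; first by rewrite addr_ge0// ltW.
    by rewrite /n -addn2 natrD lerD2r.
  by rewrite mulrDl lerD2l /C lerDr addr_ge0.
have [K [V [Ktot Vcov _ Vdiam]]] := slice_cover n.
have up : (covering_number r E <= (K%:R : R)%:E)%E.
  apply: covering_number_le Vcov _ => i; apply: (le_trans (Vdiam i)).
  by rewrite lee_fin.
have tmL0 : 0 <= t / (m%:R * L) by rewrite divr_ge0// ltW.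
pose j := Num.truncn (t / (m%:R * L)).
have /andP[j1 j2] := truncn_itv tmL0; rewrite -/j in j1 j2.
have jj0 : (j0 <= j)%N.
  apply: leq_trans (leqnSn j0) _; rewrite truncn_ge_nat// ler_pdivlMr// mulr_gt0//.
have j_r : r <= (2 ^+ (j * m))^-1.
  rewrite rE exp2 -expRN ler_expR lerN2 natrM -mulrA.
  by move: j1; rewrite ler_pdivlMr// mulr_gt0.
pose y := expR (j%:R * m%:R * (g - e1)) / 49.
have y0 : 0 < y by rewrite divr_gt0// expR_gt0.
have lo : (y%:E <= covering_number r E)%E.
  apply: le_covering_number => k U cov hU.
  have h := cover_lower m0 j_r cov hU.
  rewrite /y ler_pdivrMr//.
  have h2 : 49 * (k%:R * split_mass p q m j x) <=
     49 * (k%:R * expR (- (j%:R * m%:R * (g - e1)))).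
    by rewrite ler_pM2l// ler_wpM2l// hj0.
  have := le_trans h h2; rewrite expRN mulrA ler_pdivlMr ?expR_gt0// mul1r.
  by move=> /le_trans; apply; rewrite mulrC.
have [h1 h2] := box_ratio_bounds r1 y0 lo up.
have K0 : (0 < K)%N.
  rewrite lt0n; apply/eqP => K0; have := le_trans lo up; rewrite K0 lee_fin.
  by rewrite leNgt y0.
split; [apply: le_trans h1|apply: (le_trans h2)]; rewrite lee_fin -/t.
- rewrite ler_pdivlMr//.
  have -> : ln y = j%:R * m%:R * (g - e1) - ln 49.
    by rewrite /y ln_div ?posrE ?expR_gt0// expRK.
  have h : t / L * (g - e1) - m%:R * `|g - e1| <= j%:R * m%:R * (g - e1).
    have jm1 : j%:R * m%:R <= t / L.
      by rewrite ler_pdivlMr// -mulrA -ler_pdivlMr.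
    have jm2 : t / L - m%:R <= j%:R * m%:R.
      rewrite lerBlDr ler_pdivrMr// (_ : _ * L = j.+1%:R * (m%:R * L)).
        by rewrite -ler_pdivrMr// ltW.
      by rewrite -[j.+1%:R]natr1; ring.
    have [gp|gn] := leP 0 (g - e1).
      rewrite (ger0_norm gp) -mulrBl ler_wpM2r//.
    rewrite (ltr0_norm gn).
    have h1 : t / L * (g - e1) <= j%:R * m%:R * (g - e1) by rewrite ler_wnM2r// ltW.
    apply: le_trans h1; rewrite gerBl mulr_ge0// oppr_ge0 ltW//.
  have tC' : C <= eps / 2 * t by rewrite -ler_pdivrMr.
  have -> : (g / L - eps) * t = t / L * (g - e1) - eps / 2 * t.
    by rewrite /e1; field; exact: lt0r_neq0.
  have C' : m%:R * `|g - e1| + ln 49 <= eps / 2 * t.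
    by apply: le_trans tC'; rewrite /C lerDl.
  apply: (@le_trans _ _ (t / L * (g - e1) - (m%:R * `|g - e1| + ln 49))).
    by rewrite lerD2l lerN2.
  by rewrite opprD addrA lerD2r.
- rewrite ler_pdivrMr//.
  have lnK : ln K%:R <= n%:R * (g + e1).
    rewrite -[leRHS]expRK ler_ln ?posrE ?expR_gt0 ?ltr0n//.
    exact: le_trans Ktot (hn0 _ nn0).
  apply: (le_trans lnK); apply: (le_trans n_t).
  have tC' : C <= eps / 2 * t by rewrite -ler_pdivrMr.
  have -> : (g / L + eps) * t = t / L * (g + e1) + eps / 2 * t.
    by rewrite /e1; field; exact: lt0r_neq0.
  by rewrite lerD2l.
Qed.

Let hausdorff_measure_eq0 t : g / L < t -> hausdorff_measure t E = 0%E.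
Proof.
move=> gt; have t0 : 0 <= t by apply/ltW/(le_lt_trans _ gt); rewrite divr_ge0// ltW.
(* With this choice the at most [expR (n * (g + e1))] cylinders contribute, up to the factor [2^t],
   at most [expR (- (n * e1))]. *)
pose e1 := (t * L - g) / 2.
have e10 : 0 < e1 by rewrite divr_gt0// subr_gt0 -ltr_pdivrMr.
have [n0 hn0] := growth_le e10.
have pre r : 0 < r -> hausdorff_premeasure t r E = 0%E.
  move=> r0; apply/eqP; rewrite eq_le hausdorff_premeasure_ge0 andbT.
  apply/lee_addgt0Pr => eta eta0; rewrite add0e.
  have [n [nn0 nr neta]] : exists n, [/\ (n0 <= n)%N, 2 / 2 ^+ n <= r &
      2 `^ t * expR (- (n%:R * e1)) <= eta].
    pose n1 := Num.bound (2 / r); pose n2 := Num.bound (2 `^ t / eta / e1).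
    exists (n0 + n1 + n2)%N; split; first by rewrite -addnA leq_addr.
      rewrite ler_pdivrMr ?exprn_gt0// mulrC -ler_pdivrMr//.
      apply/ltW/(lt_trans (archi_boundP _)); first by rewrite divr_ge0// ltW.
      rewrite -natrX ltr_nat -/n1; apply: (leq_trans (ltn_expl n1 (ltnSn 1))).
      by rewrite leq_exp2l// addnAC leq_addl.
    rewrite expRN ler_pdivrMr ?expR_gt0// mulrC -ler_pdivrMr//.
    apply: (@le_trans _ _ ((n0 + n1 + n2)%:R * e1)); last first.
      by apply: le_trans (expR_ge1Dx _); rewrite lerDr.
    rewrite -ler_pdivrMr//; apply/ltW/(lt_le_trans (archi_boundP _)).
      apply: divr_ge0; last exact: ltW.
      by apply: divr_ge0; [exact: powR_ge0|exact: ltW].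
    by rewrite ler_nat leq_addl.
  have [K [V [Ktot Vcov V0 Vdiam]]] := slice_cover n.
  apply: (@le_trans _ _ (\sum_(0 <= i <oo) diam_pow t (V i))%E).
    apply: ereal_inf_lbound; exists V => //; split.
      by move=> z /Vcov [i _ Vz]; exists i.
    by move=> i; apply: (le_trans (Vdiam i)); rewrite lee_fin.
  rewrite (nneseries_split 0 K) => [|i _]; last exact: diam_pow_ge0.
  rewrite add0n [X in (_ + X)%E]eseries0 ?adde0 => [|i Ki _]; last first.
    by rewrite /diam_pow V0// eqxx.
  apply: (@le_trans _ _ (\sum_(0 <= i < K) ((2 / 2 ^+ n) `^ t)%:E)%E).
    by apply: lee_sum => i _; apply: diam_pow_le; rewrite ?divr_ge0 ?exprn_ge0.
  rewrite sumEFin lee_fin big_const_nat subn0 iter_addr_0 -[_ *+ K]mulr_natl.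
  apply: le_trans neta.
  have -> : (2 / 2 ^+ n) `^ t = 2 `^ t * expR (- (n%:R * L * t)) :> R.
    rewrite powRM ?invr_ge0 ?exprn_ge0//; congr (_ * _).
    by rewrite exp2 -expRN /powR gt_eqF ?expR_gt0// expRK mulrC mulNr.
  rewrite mulrCA ler_pM2l ?powR_gt0//.
  have Kle : K%:R <= expR (n%:R * (g + e1)) by exact: le_trans Ktot (hn0 _ nn0).
  apply: (@le_trans _ _ (expR (n%:R * (g + e1)) * expR (- (n%:R * L * t)))).
    by rewrite ler_pM2r ?expR_gt0.
  rewrite -expRD ler_expR.
  by rewrite le_eqVlt; apply/orP; left; apply/eqP; rewrite /e1; field.
apply/eqP; rewrite eq_le; apply/andP; split.
  by apply: ge_ereal_sup => _ [r /= r0 <-]; rewrite pre.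
by apply: ereal_sup_ubound; exists 1 => //=; rewrite pre.
Qed.

Let sup_ball (U : set (R * R)) (d : R) := \bigcup_(u in U) ball u d.

Let sup_ball_dist U (d c : R) z w : (diam U <= c%:E)%E ->
  sup_ball U d z -> sup_ball U d w -> euclid_dist z w <= 2 * c + 4 * d.
Proof.
move=> Uc [u Uu [/= a1 a2]] [v Uv [/= b1 b2]].
have uv := dist_le_diam Uc Uu Uv; have [c1 c2] := dist_coord u v.
apply: (le_trans (euclid_dist_le _ _)).
have key (a b a' b' : R) : `|a - a'| < d -> `|b - b'| < d -> `|a - b| <= c ->
    `|a' - b'| <= c + 2 * d.
  rewrite !ltr_norml !ler_norml => /andP[? ?] /andP[? ?] /andP[? ?].
  by apply/andP; split; lra.
have h1 := key _ _ _ _ a1 b1 (le_trans c1 uv).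
have h2 := key _ _ _ _ a2 b2 (le_trans c2 uv).
by lra.
Qed.

Let E_compact : compact E.
Proof.
have -> : E = D `&` (xproj p q @^-1` [set x]) by [].
have [_ cD _] := hD; apply: compact_closedI => //.
apply: closed_comp; last exact: closed_eq.
by move=> z _; exact: xproj_continuous.
Qed.

Let E_finite_cover (O : nat -> set (R * R)) : (forall i, open (O i)) ->
  E `<=` \bigcup_i O i -> exists n, E `<=` \bigcup_(i < n) O i.
Proof.
move=> oO cov; apply/not_existsP => h.
have /choice[z hz] n : exists z, E z /\ ~ (\bigcup_(i < n) O i) z.
  apply/not_existsP => hn; apply: (h n) => z Ez; apply: contrapT => nz.
  by apply: (hn z).
have [|z0 [Ez0 cl]] := E_compact (F := z @ \oo).
  by exists 0%N => // n _ /=; have [] := hz n.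
have [i _ Oz0] := cov _ Ez0.
have [|y [nOy Oy]] := cl (~` O i) (O i) _ (open_nbhs_nbhs (conj (oO i) Oz0)).
  exists i.+1 => // n /= ni Oz; have [_] := hz n; apply.
  by exists i.
exact: nOy.
Qed.

(** The mass bound is for finite covers, so a countable cover is thickened to an open one and
    compactness of the slice is used. Thickening by its own diameter costs a set only a constant
    factor; sets of tiny diameter get radii with a summable cost instead. *)
Let hausdorff_measure_neq0 t : 0 <= t -> t < g / L ->
  hausdorff_measure t E <> 0%E.
Proof.
move=> t0 tg H0.
(* Below [g / L], so that the split mass decays at least with exponent [t1]; positive even if
   [t = 0], so that tiny radii have tiny cost. *)
pose t1 := (t + g / L) / 2.
have tt1 : t < t1 by rewrite /t1; lra.
have t10 : 0 < t1 by exact: le_lt_trans tt1.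
pose e1 := g - t1 * L.
have e10 : 0 < e1.
  by rewrite subr_gt0 -ltr_pdivlMr// /t1; lra.
have [m [j0 [m0 hj0]]] := mass_le e10.
have mass j : (j0 <= j)%N -> split_mass p q m j x <= ((2 ^+ (j * m))^-1) `^ t1.
  move=> /hj0 /le_trans; apply.
  rewrite exp2 -expRN /powR gt_eqF ?expR_gt0// expRK ler_expR /e1 natrM.
  by rewrite le_eqVlt; apply/orP; left; apply/eqP; ring.
pose r0 : R := (2 ^+ (j0 * m))^-1 / 6.
have r00 : 0 < r0 by rewrite divr_gt0// invr_gt0 exprn_gt0.
have r01 : r0 <= 1.
  rewrite ler_pdivrMr// mul1r; apply: (@le_trans _ _ 1); last by rewrite ler1n.
  by rewrite invf_le1 ?exprn_gt0// exprn_ege1// ler1n.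
pose C1 : R := (2 ^+ m * 6) `^ t1.
have C10 : 0 < C1 by rewrite powR_gt0// mulr_gt0// exprn_gt0.
(* The factor 6 is the bound [2 c + 4 d] of [sup_ball_dist] at [c = d]; the constant [C1] pays for
   it and for rounding to a full block. *)
have level (d : R) : 0 < d -> d <= r0 -> exists j,
    6 * d <= (2 ^+ (j * m))^-1 /\ split_mass p q m j x <= C1 * d `^ t1.
  move=> d0 dr; have mL0 : 0 < m%:R * L by rewrite mulr_gt0// ltr0n.
  have d60 : 0 < 6 * d by rewrite mulr_gt0.
  pose y := - ln (6 * d) / (m%:R * L).
  have dE : 6 * d = expR (- (y * (m%:R * L))).
    by rewrite divfK ?gt_eqF// opprK lnK.
  have yj0 : j0%:R <= y.
    rewrite ler_pdivlMr// lerNr -ler_expR lnK ?posrE//.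
    by rewrite mulrA -natrM expRN -exp2 mulrC -ler_pdivlMr.
  have y0 : 0 <= y by exact: le_trans yj0.
  have /andP[y1 y2] := truncn_itv y0.
  exists (Num.truncn y); split.
    rewrite exp2 -expRN dE ler_expR lerN2 natrM -mulrA.
    by rewrite ler_pM2r.
  apply: (le_trans (mass _ _)); first by rewrite truncn_ge_nat.
  rewrite /C1 -powRM ?mulr_ge0 ?exprn_ge0//; last exact: ltW.
  apply: ge0_ler_powR; rewrite ?nnegrE ?invr_ge0 ?exprn_ge0//; first exact: ltW.
    by rewrite !mulr_ge0 ?exprn_ge0// ltW.
  rewrite -mulrA dE !exp2 -expRN -expRD ler_expR natrM.
  have : y * (m%:R * L) <= (Num.truncn y).+1%:R * (m%:R * L).
    by rewrite ler_pM2r// ltW.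
  rewrite -[(Num.truncn y).+1%:R]natr1 mulrDl mul1r mulrA -lerBlDr => h.
  by rewrite lerNl opprB -mulrA; move: h; rewrite mulrA.
(* The final sum is then at most [49 (C1 eta + eta) = 49/100], below the total mass 1. *)
pose eta := (100 * (C1 + 1))^-1.
have eta0 : 0 < eta by rewrite invr_gt0 mulr_gt0// addr_gt0.
have /ereal_inf_lt[_ [U [cov hU] <-] sumU] : (hausdorff_premeasure t r0 E < eta%:E)%E.
  apply: (@le_lt_trans _ _ 0%E); last by rewrite lte_fin.
  by rewrite -H0; apply: ereal_sup_ubound; exists r0.
pose d i := fine (diam (U i)).
have dE i : diam (U i) = (d i)%:E.
  rewrite fineK// ge0_fin_numE ?diam_ge0//; apply: le_lt_trans (hU i) _.
  exact: ltry.
have d0 i : 0 <= d i by rewrite -lee_fin -dE diam_ge0.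
have dr i : d i <= r0 by rewrite -lee_fin -dE.
pose a i : R := eta / 2 ^+ i.+1 / C1.
have a0 i : 0 < a i by rewrite !divr_gt0 ?exprn_gt0.
pose del i := Num.min r0 (a i `^ t1^-1).
have del0 i : 0 < del i by rewrite lt_min r00 powR_gt0.
have delr i : del i <= r0 by rewrite ge_min lexx.
have delsum i : C1 * del i `^ t1 <= eta / 2 ^+ i.+1.
  rewrite mulrC -ler_pdivlMr// -/(a i).
  rewrite [leRHS](_ : _ = (a i `^ t1^-1) `^ t1); last first.
    by rewrite -powRrM mulVf ?gt_eqF// powRr1// ltW.
  by apply: ge0_ler_powR; rewrite ?nnegrE ?powR_ge0 ?(ltW (del0 i)) ?(ltW t10)// ge_min lexx orbT.
pose dd i := Num.max (d i) (del i).
have dd0 i : 0 < dd i by rewrite lt_max del0 orbT.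
have ddr i : dd i <= r0 by rewrite ge_max dr delr.
have /choice[lev hlev] i := level (dd i) (dd0 i) (ddr i).
pose O i := sup_ball (U i) (dd i).
have [n ncov] : exists n, E `<=` \bigcup_(i < n) O i.
  apply: E_finite_cover => [i|z /cov[i _ Uz]].
    by apply: bigcup_open => u _; exact: ball_open.
  by exists i => //; exists z => //; exact: ballxx.
have := finite_cover_mass p0 q0 pq hD (lev := lev) m0 x_itv ncov.
have hO i z w : (i < n)%N -> O i z -> O i w ->
    euclid_dist z w <= (2 ^+ (lev i * m))^-1.
  move=> _ Oz Ow; apply: le_trans (proj1 (hlev i)).
  have ddi : (diam (U i) <= (dd i)%:E)%E by rewrite dE lee_fin le_max lexx.
  by apply: (le_trans (sup_ball_dist ddi Oz Ow)); lra.
move=> /(_ hO); rewrite leNgt => /negP; apply.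
have dpow i : ((d i `^ t1)%:E <= diam_pow t (U i))%E.
  rewrite /diam_pow; case: ifPn => [/eqP Ui|_].
    have -> : d i = 0.
      apply/eqP; rewrite eq_le d0 andbT -lee_fin -dE.
      by apply: diam_le => // z w; rewrite Ui.
    by rewrite powR0// gt_eqF.
  rewrite dE poweR_EFin lee_fin; have [->|di0] := eqVneq (d i) 0.
    by rewrite powR0 ?powR_ge0// gt_eqF.
  by apply: ger_powR; [rewrite lt0r di0 d0 (le_trans (dr i))|exact: ltW].
have sumd : \sum_(i < n) d i `^ t1 <= eta.
  rewrite -lee_fin -sumEFin; apply: le_trans (ltW sumU).
  apply: (@le_trans _ _ (\sum_(0 <= i < n) diam_pow t (U i))%E).
    by rewrite big_mkord; apply: lee_sum => i _; exact: dpow.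
  by apply: nneseries_lim_ge => i _ _; exact: diam_pow_ge0.
have sumeta : \sum_(i < n) eta / 2 ^+ i.+1 <= eta.
  have -> : \sum_(i < n) eta / 2 ^+ i.+1 = eta - eta / 2 ^+ n.
    elim: (n) => [|k IH]; first by rewrite big_ord0 divr1 subrr.
    by rewrite big_ord_recr/= IH exprS; field; rewrite expf_neq0.
  by rewrite gerBl divr_ge0 ?exprn_ge0// ltW.
apply: (@le_lt_trans _ _ (49 * (C1 * eta + eta))); last first.
  have -> : 49 * (C1 * eta + eta) = 49 / 100 by rewrite /eta; field; rewrite gt_eqF ?addr_gt0.
  by lra.
rewrite ler_pM2l//.
apply: (@le_trans _ _ (\sum_(i < n) (C1 * d i `^ t1 + eta / 2 ^+ i.+1))).
  apply: ler_sum => i _; apply: (le_trans (proj2 (hlev i))).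
  rewrite /dd; case: (leP (d i) (del i)) => _.
    by apply: (le_trans (delsum i)); rewrite lerDr mulr_ge0 ?powR_ge0// ltW.
  by rewrite lerDl divr_ge0 ?exprn_ge0// ltW.
by rewrite big_split/= -mulr_sumr lerD// ler_pM2l.
Qed.

Lemma slice_hausdorff_dim : hausdorff_dim E = (g / L)%:E.
Proof.
apply/eqP; rewrite eq_le; apply/andP; split.
  apply/lee_addgt0Pr => eps eps0; apply: ereal_inf_lbound.
  exists (g / L + eps) => //; split.
    by apply: addr_ge0; [apply: divr_ge0 => //|]; exact: ltW.
  by apply: hausdorff_measure_eq0; rewrite ltrDl.
apply: le_ereal_inf_tmp => _ [t [t0 H0] <-]; rewrite lee_fin leNgt.
by apply/negP => tg; exact: hausdorff_measure_neq0 H0.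
Qed.

End SliceDimension.

(** * Almost sure growth *)

Section DyadicWords.
Context {R : realType}.

Fixpoint nat_bits n k : seq bool :=
  if n is m.+1 then rcons (nat_bits m k./2) (odd k) else [::].

Lemma bits_truncn n (x : R) : 0 <= x ->
  bits n x = nat_bits n (Num.truncn (2 ^+ n * x)).
Proof.
move=> x0; elim: n => [//|n IH].
rewrite /bits mkseqS -/(bits n x) IH /=; congr (rcons (nat_bits _ _) _).
rewrite -truncn_half ?mulr_ge0 ?exprn_ge0//.
by congr Num.truncn; rewrite exprS; field.
Qed.

(** The lowest [n] bits of the integers below [M 2^n] run [M] times through all words. *)
Lemma sum_nat_bits M n (phi : seq bool -> R) :
  \sum_(k < M * 2 ^ n) phi (nat_bits n k) = M%:R * 2 ^+ n * wavg n phi.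
Proof.
elim: n phi => [|n IH] phi.
  by rewrite expn0 muln1 /= sumr_const card_ord mulr1 mulr_natl.
have dbl m (F : nat -> R) : \sum_(k < m.*2) F k = \sum_(k < m) (F k.*2 + F k.*2.+1).
  elim: m => [|m IHm]; first by rewrite !big_ord0.
  by rewrite doubleS !big_ord_recr/= IHm addrA.
rewrite expnS mulnCA mul2n (dbl _ (fun k => phi (nat_bits n.+1 k))).
transitivity (\sum_(k < M * 2 ^ n)
   (fun u => \sum_b phi (rcons u b)) (nat_bits n k)).
  apply: eq_bigr => k _; rewrite big_bool/= addrC uphalf_double.
  by rewrite doubleK odd_double.
rewrite (IH (fun u => \sum_b phi (rcons u b))).
have -> : wavg n.+1 phi = 2^-1 * wavg n (fun u => \sum_b phi (rcons u b)).
  rewrite -[X in wavg X _](addn1 n) wavg_cat -wavgZ; apply: eq_wavg => u _.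
  by rewrite /= card_bool; congr (_ * _); apply: eq_bigr => b _; rewrite cats1.
by rewrite exprS; field.
Qed.

End DyadicWords.

(** * Almost sure growth rates for measures dominated by a transducer *)

Section TypicalGrowth.
Context (R : realType) (p q : nat) {X : finType} (e : X -> nat) (K : nat).
Let N := (p + q)%N.
Hypotheses (p0 : (0 < p)%N) (q0 : (0 < q)%N) (pq : coprime p q).
Hypotheses (X0 : (0 < #|X|)%N) (K0 : (0 < K)%N).
Hypothesis eK : forall k x, (k < K -> (k + e x)./2 < K)%N.
Variables (gw : seq X) (k0 : nat).
Hypothesis gwP : forall l, (l < K)%N ->
  forall s t, 1 <= wmx R p q (output e gw l) s t.
Hypothesis gwS : forall l, (l < K)%N -> state e gw l = k0.

Variables (mu : {measure set R -> \bar R}) (xc : R -> R).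
Hypothesis dyadic_measurable : forall n k : nat,
  measurable [set a | k%:R <= 2 ^+ n * xc a < k.+1%:R].
Variable C : R.
Hypothesis C_ge0 : 0 <= C.

Definition word_set n (B : seq bool -> Prop) :=
  [set a | 0 <= xc a < N%:R /\ B (bits n (xc a))].

Hypothesis mu_word_set : forall n (B : seq bool -> Prop),
  (mu (word_set n B) <=
   (C * wavg n (fun io => `[< exists2 l, (l < K)%N & B (output e io l) >]%:R))%:E)%E.

Lemma word_set_measurable n B : measurable (word_set n B).
Proof.
have -> : word_set n B = \bigcup_(k in [set k | (k < N * 2 ^ n)%N /\ B (nat_bits n k)])
    [set a | k%:R <= 2 ^+ n * xc a < k.+1%:R].
  apply/seteqP; split => a.
    move=> [/andP[a0 aN] Ba]; have ha : 0 <= 2 ^+ n * xc a by rewrite mulr_ge0 ?exprn_ge0.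
    exists (Num.truncn (2 ^+ n * xc a)); last exact: truncn_itv.
    split; last by rewrite -bits_truncn.
    by rewrite truncn_lt_nat// natrM natrX mulrC ltr_pM2r ?exprn_gt0.
  move=> [k [kN Bk] /= ka]; have /andP[k1 k2] := ka.
  have ha : 0 <= xc a.
    by rewrite -(pmulr_rge0 _ (_ : 0 < 2 ^+ n)) ?exprn_gt0// (le_trans _ k1).
  have kE := truncn_def ka; split; last by rewrite bits_truncn// kE.
  rewrite ha/= -(ltr_pM2l (_ : 0 < 2 ^+ n)) ?exprn_gt0//; apply: (lt_le_trans k2).
  by rewrite -natrX -natrM ler_nat mulnC.
by apply: bigcup_measurable => k _; exact: dyadic_measurable.
Qed.

Lemma bsum_output m (g : seq bool -> R) (G : seq X -> R) j io l :
  (forall io l, size io = m -> (l < K)%N -> g (output e io l) <= G io) ->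
  size io = (j * m)%N -> (l < K)%N ->
  bsum m g j (output e io l) <= bsum m G j io.
Proof.
move=> gG; elim: j io l => [|j IH] io l; first by rewrite /bsum !big_ord0.
rewrite mulSn => sio lK; rewrite -(cat_take_drop m io) output_cat.
have st : size (take m io) = m by rewrite size_takel// sio leq_addr.
have sd : size (drop m io) = (j * m)%N by rewrite size_drop sio addKn.
have kK : (state e (drop m io) l < K)%N by apply: state_lt lK.
rewrite !bsum_cat ?size_output//; apply: lerD; first exact: gG.
exact: IH.
Qed.

(** Borel-Cantelli. The majorant [G] is valid for every state, so the unknown starting state in the
    bound for [mu] disappears and only independent input blocks remain. *)
Lemma ae_block_average m (g : seq bool -> R) (G : seq X -> R) eps : 0 < eps ->
  (forall io l, size io = m -> (l < K)%N -> g (output e io l) <= G io) ->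
  mu.-negligible [set a | 0 <= xc a < N%:R /\
    ~ exists j0, forall j, (j0 <= j)%N ->
      bsum m g j (bits (j * m) (xc a)) <= j%:R * (wavg m G + eps)].
Proof.
move=> eps0 gG; have [rho /andP[r0 r1] hrho] := wavg_large_deviation m G X0 eps0.
pose B j u := j%:R * (wavg m G + eps) < bsum m g j u.
pose F j := word_set (j * m) (B j).
have mF j : measurable (F j) by exact: word_set_measurable.
have muF j : (mu (F j) <= (C * rho ^+ j)%:E)%E.
  apply: (le_trans (mu_word_set _ _)); rewrite lee_fin ler_wpM2l//.
  apply: le_trans (hrho j); apply: le_wavg => io sio.
  case: asboolP => [[l lK Bl]|_] //.
  by rewrite (lt_le_trans Bl)// bsum_output.
exists (lim_sup_set F); split.
- by apply: bigcap_measurable => // n _; exact: bigcup_measurable.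
- apply: lim_sup_set_cvg0 => //.
  apply: (@le_lt_trans _ _ (C / (1 - rho))%:E); last exact: ltry.
  apply: lime_le; first exact: is_cvg_nneseries.
  apply: nearW => n; apply: (@le_trans _ _ (\sum_(0 <= i < n) (C * rho ^+ i)%:E)%E).
    exact: lee_sum.
  rewrite sumEFin lee_fin -mulr_sumr ler_wpM2l// big_mkord.
  have h : (\sum_(i < n) rho ^+ i) * (1 - rho) = 1 - rho ^+ n.
    elim: (n) => [|k IH]; first by rewrite big_ord0 mul0r expr0 subrr.
    by rewrite big_ord_recr/= mulrDl IH exprSr; ring.
  by rewrite -[leRHS]mul1r ler_pdivlMr ?subr_gt0// h gerBl exprn_ge0// ltW.
- move=> a [aN nj] n _; apply: contrapT => hn; apply: nj; exists n => j nj.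
  rewrite leNgt; apply/negP => hj; apply: hn; exists j => //.
Qed.

Let s0 := size gw.
Let f u : R := ln (tot R p q u).
Let h u : R := ln (mincnt R p q u).
Let a j : R := wavg (j * s0) (fun io => f (output e io 0)).

(** The two conditions on [x] from which both dimensions of its slice are computed. *)
Definition typical (g x : R) :=
  (forall eps, 0 < eps -> exists n0, forall n, (n0 <= n)%N ->
     tot R p q (bits n x) <= expR (n%:R * (g + eps))) /\
  (forall eps, 0 < eps -> exists m j0, (0 < m)%N /\ forall j, (j0 <= j)%N ->
     split_mass p q m j x <= expR (- (j%:R * m%:R * (g - eps)))).

Let ln_tot_bsum m j u : size u = (j * m)%N -> f u <= ln (p + q)%:R + bsum m f j u.
Proof.
elim: j u => [|j IH] u; first by move=> /size0nil ->; rewrite /bsum big_ord0 addr0 /f /tot;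
  under eq_bigr do rewrite cnt_nil; rewrite sumr_const card_ord.
rewrite mulSn => su; rewrite -(cat_take_drop m u).
have st : size (take m u) = m by rewrite size_takel// su leq_addr.
have sd : size (drop m u) = (j * m)%N by rewrite size_drop su addKn.
rewrite bsum_cat//; apply: le_trans; first exact: ln_tot_cat.
by rewrite addrCA lerD2l IH.
Qed.

Lemma split_massE m j x :
  split_mass p q m j x = expR (- bsum m h j (bits (j * m) x)).
Proof.
rewrite /bsum -sumrN expR_sum; apply: eq_bigr => i _.
by rewrite bits_block// expRN lnK// posrE mincnt_gt0.
Qed.

Let a_bound j : a j <= ln (p + q)%:R + (j * s0)%:R * ln 2.
Proof.
rewrite -(wavg_cst X0 (j * s0) (ln (p + q)%:R + (j * s0)%:R * ln 2)).
apply: le_wavg => io sio.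
have N0 : (0 < p + q)%N by rewrite addn_gt0 p0.
rewrite mulr_natl -lnXn// -lnM ?posrE ?exprn_gt0 ?ltr0n//.
rewrite ler_ln ?posrE ?tot_gt0 ?mulr_gt0 ?exprn_gt0 ?ltr0n//.
by apply: le_trans; [exact: tot_le|rewrite size_output sio].
Qed.

(** As in Fekete's lemma, [g] is a supremum of corrected means. [C2] and [M] are left free because
    the means are later compared with bounds that hold up to an additive constant and only at
    multiples of [M]. *)
Theorem typical_growth : exists2 C1, 0 <= C1 &
  (forall j l, (l < K)%N ->
     wavg (j * s0) (fun io => f (output e io l)) <= a j + C1) /\
  forall C2 M, C1 <= C2 -> (0 < M)%N -> exists g,
  [/\ forall j, (0 < j)%N -> a (j * M) - C2 <= g * (j * M * s0)%:R,
      forall c, (forall j, (0 < j)%N -> a (j * M) - C2 <= c * (j * M * s0)%:R) -> g <= c &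
      mu.-negligible [set a | 0 <= xc a < N%:R /\ ~ typical g (xc a)]].
Proof.
have [C1 C10 hC1] := block_bounds p0 q0 pq X0 K0 eK gwP gwS.
have s00 : (0 < s0)%N by exact: good_word_size gwP.
exists C1 => //; split.
  move=> j l lK; have [F [H [FH hF _]]] := hC1 j; apply: le_trans hF.
  by apply: le_wavg => io sio; have [] := FH io l sio lK.
move=> C2 M C12 M0; have C20 : 0 <= C2 by exact: le_trans C12.
have m0 j : (0 < j)%N -> 0 < (j * M * s0)%:R :> R.
  by move=> j0; rewrite ltr0n !muln_gt0 j0 M0.
pose S := [set r | exists2 j, (0 < j)%N & r = (a (j * M) - C2) / (j * M * s0)%:R].
have supS : has_sup S.
  split; first by exists ((a (1 * M) - C2) / (1 * M * s0)%:R); exists 1%N.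
  exists (ln (p + q)%:R + ln 2) => _ [j j0 ->].
  rewrite ler_pdivrMr ?m0//; have := a_bound (j * M).
  have l0 : 0 <= ln (p + q)%:R :> R by rewrite ln_ge0// ler1n; lia.
  have m1 : 1 <= (j * M * s0)%:R :> R by rewrite ler1n !muln_gt0 j0 M0.
  have := ler_peMl l0 m1 => h1 h2; rewrite mulrDl.
  apply: (@le_trans _ _ (a (j * M))); first by rewrite gerBl.
  by apply: (le_trans h2); rewrite [X in _ + X]mulrC lerD2r mulrC.
exists (sup S); set g := sup S; split.
- move=> j j0; rewrite -ler_pdivrMr ?m0//; apply: ub_le_sup; first by case: supS.
  by exists j.
- move=> c hc; apply: ge_sup; first by case: supS.
  by move=> _ [j j0 ->]; rewrite ler_pdivrMr ?m0// hc.
pose ep k : R := k.+1%:R^-1.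
have ep0 k : 0 < ep k by rewrite invr_gt0 ltr0n.
(* One block length nearly attains the supremum, and there the mean of the lower function [H] is at
   least the corrected mean, because [C1 <= C2]. *)
have low k : exists m, (0 < m)%N /\ exists H : seq X -> R,
    m%:R * (g - ep k / 2) <= wavg m H /\
    forall io l, size io = m -> (l < K)%N -> - h (output e io l) <= - H io.
  have [_ [j j0 ->]] := sup_adherent (divr_gt0 (ep0 k) (ltr0n R 2)) supS.
  rewrite -/g => hj; exists (j * M * s0)%N; split; first by rewrite !muln_gt0 j0 M0.
  have [F [H [FH _ hH]]] := hC1 (j * M)%N; exists H; split.
    apply: le_trans hH; move/ltW: hj; rewrite ler_pdivlMr ?m0// mulrC => /le_trans; apply.
    by rewrite lerD2l lerN2.
  by move=> io l sio lK; rewrite lerN2; have [] := FH io l sio lK.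
have up k : exists m, (0 < m)%N /\ exists F : seq X -> R,
    wavg m F <= m%:R * (g + ep k / 4) /\
    forall io l, size io = m -> (l < K)%N -> f (output e io l) <= F io.
  (* Long enough for the additive error [2 C2] to be at most [ep k / 4] per letter. *)
  pose j := (Num.bound (2 * C2 * 4 / ep k)).+1.
  have j0 : (0 < j)%N by [].
  exists (j * M * s0)%N; split; first by rewrite !muln_gt0 j0 M0.
  have [F [H [FH hF _]]] := hC1 (j * M)%N; exists F; split; last first.
    by move=> io l sio lK; have [] := FH io l sio lK.
  apply: (le_trans hF).
  have h1 : a (j * M) - C2 <= g * (j * M * s0)%:R.
    rewrite -ler_pdivrMr ?m0//; apply: ub_le_sup; first by case: supS.
    by exists j.
  have h2 : 2 * C2 <= (j * M * s0)%:R * (ep k / 4).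
    rewrite -ler_pdivrMr ?divr_gt0// invf_div mulrA.
    apply/ltW/(lt_le_trans (archi_boundP _)).
      by rewrite !mulr_ge0 ?invr_ge0 ?(ltW (ep0 k)).
    rewrite ler_nat -mulnA (leq_trans (leqnSn _))// leq_pmulr// muln_gt0 M0//.
  by rewrite mulrDr [_ * g]mulrC; move: h1 h2 C12; rewrite -/(a _); lra.
have /choice[ml /all_and2[ml0 /choice[Hl /all_and2[Hl1 Hl2]]]] := low.
have /choice[mv /all_and2[mv0 /choice[Fv /all_and2[Fv1 Fv2]]]] := up.
pose Bl k := [set y | 0 <= xc y < N%:R /\ ~ exists j0, forall j, (j0 <= j)%N ->
   bsum (ml k) (fun u => - h u) j (bits (j * ml k) (xc y)) <=
   j%:R * (wavg (ml k) (fun io => - Hl k io) + (ml k)%:R * (ep k / 2))].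
pose Bv k := [set y | 0 <= xc y < N%:R /\ ~ exists j0, forall j, (j0 <= j)%N ->
   bsum (mv k) f j (bits (j * mv k) (xc y)) <=
   j%:R * (wavg (mv k) (Fv k) + (mv k)%:R * (ep k / 4))].
apply: (@negligibleS _ _ _ mu (\bigcup_k (Bl k `|` Bv k))); last first.
  apply: negligible_bigcup => k; apply: negligibleU.
    apply: ae_block_average; first by rewrite mulr_gt0 ?divr_gt0 ?ltr0n.
    exact: Hl2.
  apply: ae_block_average; first by rewrite mulr_gt0 ?divr_gt0 ?ltr0n.
  exact: Fv2.
move=> y [yN ny]; apply: contrapT => nB; apply: ny.
have exk eps : 0 < eps -> exists k, ep k <= eps.
  move=> eps0; exists (Num.bound eps^-1); rewrite /ep.
  rewrite -[leRHS]invrK lef_pV2 ?posrE ?invr_gt0 ?ltr0n//.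
  apply/ltW/(lt_trans (archi_boundP _)); first by rewrite invr_ge0 ltW.
  by rewrite ltr_nat.
split=> eps /exk[k hk].
- have [j0 hj0] : exists j0, forall j, (j0 <= j)%N ->
      bsum (mv k) f j (bits (j * mv k) (xc y)) <=
      j%:R * (wavg (mv k) (Fv k) + (mv k)%:R * (ep k / 4)).
    by apply: contrapT => hn; apply: nB; exists k => //; right.
  set m := mv k in hj0; have mm0 : 0 < m%:R :> R by rewrite ltr0n mv0.
  pose g' := g + ep k / 2; pose l := ln (p + q)%:R : R.
  have l0 : 0 <= l by rewrite ln_ge0// ler1n; lia.
  pose n1 := Num.bound ((l + m%:R * `|g'|) / (ep k / 2)).
  (* [n] is rounded up to full blocks, which can only increase [tot]; the at most [m] additional
     letters cost [m |g'|], absorbed for [n >= n1]. *)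
  exists (n1 + j0 * m)%N => n hn; pose j := (n %/ m).+1.
  have jm1 : (n <= j * m)%N by rewrite ltnW// -ltn_divLR ?mv0.
  have jm2 : (j * m <= n + m)%N by rewrite /j mulSn addnC leq_add2r leq_trunc_div.
  have jj0 : (j0 <= j)%N.
    by rewrite leqW// leq_divRL ?mv0// (leq_trans _ hn)// leq_addl.
  have n_n1 : l + m%:R * `|g'| <= n%:R * (ep k / 2).
    rewrite -ler_pdivrMr ?divr_gt0//; apply/ltW/(lt_le_trans (archi_boundP _)).
      apply: divr_ge0; first by rewrite addr_ge0// mulr_ge0.
      by apply/ltW/divr_gt0.
    by rewrite ler_nat (leq_trans _ hn)// leq_addr.
  have jg : (j * m)%:R * g' <= n%:R * g' + m%:R * `|g'|.
    have -> : (j * m)%:R = n%:R + (j * m - n)%:R :> R by rewrite -natrD subnKC.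
    rewrite mulrDl lerD2l; apply: (le_trans (ler_norm _)); rewrite normrM ger0_norm//.
    by rewrite ler_wpM2r// ler_nat leq_subLR.
  apply: (@le_trans _ _ (tot R p q (bits (j * m) (xc y)))).
    by rewrite -(subnKC jm1) bits_add tot_cat_ge.
  rewrite -[leLHS]lnK ?posrE ?tot_gt0// ler_expR.
  apply: (le_trans (ln_tot_bsum (size_bits _ _))).
  apply: (@le_trans _ _ (l + (j * m)%:R * g')).
    rewrite lerD2l; apply: (le_trans (hj0 _ jj0)); rewrite natrM -mulrA ler_wpM2l//.
    by have := Fv1 k; rewrite -/m /g'; lra.
  have hk' : n%:R * ep k <= n%:R * eps by rewrite ler_wpM2l.
  by move: jg n_n1 hk'; rewrite /g'; lra.
- have [j0 hj0] : exists j0, forall j, (j0 <= j)%N ->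
      bsum (ml k) (fun u => - h u) j (bits (j * ml k) (xc y)) <=
      j%:R * (wavg (ml k) (fun io => - Hl k io) + (ml k)%:R * (ep k / 2)).
    by apply: contrapT => hn; apply: nB; exists k => //; left.
  exists (ml k), j0; split => // j /hj0.
  rewrite split_massE ler_expR /bsum sumrN => /le_trans; apply.
  rewrite -mulrA -mulrN ler_wpM2l// wavgN.
  have hk' : (ml k)%:R * ep k <= (ml k)%:R * eps by rewrite ler_wpM2l.
  by have := Hl1 k; lra.
Qed.

End TypicalGrowth.

(** * The two exponents *)

Section Exponents.
Context (R : realType) (p q : nat).
Let N := (p + q)%N.
Hypotheses (p0 : (0 < p)%N) (q0 : (0 < q)%N) (pq : coprime p q).
Variables (mu : {measure set R -> \bar R}) (xc : R -> R) (C : R).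
Hypothesis dyadic_measurable : forall n k : nat,
  measurable [set a | k%:R <= 2 ^+ n * xc a < k.+1%:R].
Hypothesis C_ge0 : 0 <= C.

Let one : 'I_(p + q) -> R := fun=> 1.

(** With bits as digits the carry stays 0 and the transducer is the identity, so fair bits are the
    case [K = 1]. *)
Lemma output_bool u l : (l < 1)%N -> output nat_of_bool u l = u.
Proof.
rewrite ltnS leqn0 => /eqP ->.
suff [_ ->] : state nat_of_bool u 0 = 0%N /\ output nat_of_bool u 0 = u by [].
by elim: u => //= b u [-> ->]; case: b.
Qed.

Let N0 : (0 < N)%N. Proof. by rewrite addn_gt0 p0. Qed.

Section Vector.
Variable v : 'I_(p + q) -> nat.
Hypothesis v0 : forall s, (0 < v s)%N.
Let V := pair_v v one.

Let V1 : 1 <= V.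
Proof.
rewrite /V /pair_v (bigD1 (Ordinal N0))//= -[leLHS]addr0 lerD//.
  by rewrite mul1r ler1n.
by rewrite sumr_ge0// => s _; rewrite mulr_ge0.
Qed.

Let pairE u : pair_v v (rowmul one u) = \sum_t \sum_s wmx R p q u s t * (v t)%:R.
Proof.
apply: eq_bigr => t _; rewrite mulr_suml; apply: eq_bigr => s _.
by rewrite mul1r.
Qed.

Lemma tot_le_pair u : tot R p q u <= pair_v v (rowmul one u).
Proof.
rewrite pairE exchange_big/=; apply: ler_sum => s _; apply: ler_sum => t _.
by rewrite ler_peMr ?wmx_ge0// ler1n.
Qed.

Lemma pair_le_tot u : pair_v v (rowmul one u) <= V * tot R p q u.
Proof.
rewrite pairE exchange_big/= mulr_sumr; apply: ler_sum => s _.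
rewrite mulr_sumr; apply: ler_sum => t _; rewrite mulrC ler_wpM2r ?wmx_ge0//.
rewrite /V /pair_v (bigD1 t)//= mul1r lerDl sumr_ge0// => r _.
by rewrite mulr_ge0.
Qed.

End Vector.

Lemma lebesgue_exponent :
  (forall n (B : seq bool -> Prop), (mu (word_set p q xc n B) <=
     (C * wavg n (fun u : seq bool => `[< B u >]%:R))%:E)%E) ->
  exists2 g, g < ln (3 / 2) &
    mu.-negligible [set a | 0 <= xc a < N%:R /\ ~ typical p q g (xc a)].
Proof.
move=> mu_le; have [w hw] := positive_word R p0 q0 pq.
have B0 : (0 < #|{: bool}|)%N by rewrite card_bool.
have eK k (x : bool) : (k < 1 -> (k + x)./2 < 1)%N by case: x; case: k.
have gwP l : (l < 1)%N -> forall s t, 1 <= wmx R p q (output nat_of_bool w l) s t.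
  by move=> l1; rewrite output_bool.
have gwS l : (l < 1)%N -> state nat_of_bool w l = 0%N.
  move=> l1; apply/eqP; rewrite -leqn0 -ltnS.
  by apply: (@state_lt _ nat_of_bool 1).
have mu_word n (B : seq bool -> Prop) : (mu (word_set p q xc n B) <= (C * wavg n
    (fun io => `[< exists2 l, (l < 1)%N & B (output nat_of_bool io l) >]%:R))%:E)%E.
  apply: (le_trans (mu_le n B)); rewrite lee_fin ler_wpM2l//.
  apply: le_wavg => u _; case: asboolP => // Bu; case: asboolP => // nB.
  by exfalso; apply: nB; exists 0%N => //; rewrite output_bool.
have [C1 C10 [_ hC1]] := typical_growth p0 q0 pq B0 (ltn0Sn 0) eK gwP gwS
  dyadic_measurable C_ge0 mu_word.
have [v [vne vE]] := @nat_perron_vector R p q p0.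
have v0 s : (0 < v s)%N by exact: (perron_gt0 p0 q0 pq vE vne s).
have [M [de [M0 de0 up _]]] := lyapunov_gap p0 q0 pq vE vne.
set V := pair_v v one; have V1 : 1 <= V.
  rewrite /V /pair_v (bigD1 (Ordinal N0))//= -[leLHS]addr0 lerD//.
    by rewrite mul1r ler1n.
  by rewrite sumr_ge0// => s _; rewrite mulr_ge0.
have lV : 0 <= ln V by rewrite ln_ge0.
(* The additional [ln V] swallows the initial term of the Lyapunov bound, so every corrected mean,
   and with it the supremum, is at most [ln (3 / 2) - de / M] per letter. *)
have [g [_ gle gneg]] := hC1 (C1 + ln V) M (ler_wpDr lV (lexx _)) M0.
exists g => //; have MR : 0 < M%:R :> R by rewrite ltr0n.
apply: (@le_lt_trans _ _ (ln (3 / 2) - de / M%:R)); last first.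
  by rewrite ltrBlDr ltrDl divr_gt0.
apply: gle => j j0; rewrite lerBlDr.
set s0 := size w.
apply: (@le_trans _ _ (wavg (j * s0 * M) (fun u => ln (pair_v v (rowmul one u))))).
  rewrite mulnAC; apply: le_wavg => u _; rewrite output_bool//.
  have t0 := tot_gt0 R q p0 u.
  by rewrite ler_ln ?posrE ?(lt_le_trans t0) ?tot_le_pair.
apply: (le_trans (up (j * s0)%N one _)) => [s|]; first exact: ltr01.
have -> : (j * s0)%:R * (M%:R * ln (3 / 2) - de) =
    (ln (3 / 2) - de / M%:R) * (j * M * s0)%:R.
  by rewrite !natrM; field; exact: lt0r_neq0.
by rewrite -/V addrC lerD2l lerDr.
Qed.

Lemma natural_exponent :
  (forall n (B : seq bool -> Prop), (mu (word_set p q xc n B) <=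
    (C * wavg n (fun io =>
      `[< exists2 l, (l < N)%N & B (output (dig p q) io l) >]%:R))%:E)%E) ->
  exists2 g, ln (3 / 2) < g &
    mu.-negligible [set a | 0 <= xc a < N%:R /\ ~ typical p q g (xc a)].
Proof.
move=> mu_le; have [w [k0 [gwP gwS]]] := good_word R p0 q0 pq.
have X0 : (0 < #|'I_3|)%N by rewrite card_ord.
have eK k i : (k < N -> (k + dig p q i)./2 < N)%N by exact: dig_half.
have [C1 C10 [a_l hC1]] := typical_growth p0 q0 pq X0 N0 eK gwP gwS
  dyadic_measurable C_ge0 mu_le.
have [v [vne vE]] := @nat_perron_vector R p q p0.
have v0 s : (0 < v s)%N by exact: (perron_gt0 p0 q0 pq vE vne s).
have [M [de [M0 de0 _ lo]]] := lyapunov_gap p0 q0 pq vE vne.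
set V := pair_v v one; have V1 : 1 <= V.
  rewrite /V /pair_v (bigD1 (Ordinal N0))//= -[leLHS]addr0 lerD//.
    by rewrite mul1r ler1n.
  by rewrite sumr_ge0// => s _; rewrite mulr_ge0.
have V0 : 0 < V by exact: lt_le_trans ltr01 V1.
have [g [ge _ gneg]] := hC1 C1 M (lexx _) M0.
exists g => //; rewrite ltNge; apply/negP => gle.
set s0 := size w in ge a_l.
have s00 : (0 < s0)%N by exact: good_word_size gwP.
pose a j := wavg (j * s0) (fun io => ln (tot R p q (output (dig p q) io 0))) : R.
(* Weighting the starting states by [v] turns, through [wavg_output], the means over digit words
   into the size-biased mean over fair bits. Replacing each starting state by 0 costs [C1], and
   [tot] is at least the pairing divided by [V]. *)
have key j : (j * s0)%:R * (M%:R * ln (3 / 2) + de) <= a (j * M)%N + C1.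
  rewrite -(ler_pM2l V0).
  apply: (@le_trans _ _ (\sum_l (v l)%:R * wavg (j * M * s0)
      (fun io => ln (tot R p q (output (dig p q) io l))))); last first.
    have -> : V * (a (j * M)%N + C1) = \sum_l (v l)%:R * (a (j * M)%N + C1).
      by rewrite -mulr_suml /V /pair_v; under eq_bigr do rewrite mul1r.
    by apply: ler_sum => l _; rewrite ler_wpM2l//; exact: a_l.
  have -> : \sum_l (v l)%:R * wavg (j * M * s0)
      (fun io => ln (tot R p q (output (dig p q) io l))) =
      wavg (j * s0 * M) (fun u => (2 / 3) ^+ (j * s0 * M) *
        (pair_v v (rowmul one u) * ln (tot R p q u))).
    rewrite mulnAC; under eq_bigr => l _.
      rewrite (@wavg_output R p q _ l (fun u _ => ln (tot R p q u))) -wavgZ.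
      over.
    rewrite -wavg_sum; apply: eq_wavg => u _.
    under eq_bigr do rewrite mulrCA.
    rewrite -mulr_sumr; congr (_ * _); rewrite mulr_suml; apply: eq_bigr => l _.
    rewrite mulrC mulr_suml /rowmul mulr_suml mulr_suml; apply: eq_bigr => s _.
    by rewrite mul1r mulrAC.
  have := lo (j * s0)%N one (fun=> ltr01); rewrite -/V => h.
  have hV : V * (ln V + (j * s0)%:R * (M%:R * ln (3 / 2) + de)) - ln V * V <=
     wavg (j * s0 * M) (fun u => (2 / 3) ^+ (j * s0 * M) * (pair_v v (rowmul one u) *
       ln (pair_v v (rowmul one u)))) - ln V * V by rewrite lerD2r.
  have e1 : V * (ln V + (j * s0)%:R * (M%:R * ln (3 / 2) + de)) - ln V * V =
     V * ((j * s0)%:R * (M%:R * ln (3 / 2) + de)) by ring.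
  rewrite -e1; apply: (le_trans hV).
  have VE : V = wavg (j * s0 * M) (fun u =>
      (2 / 3) ^+ (j * s0 * M) * pair_v v (rowmul one u)).
    by rewrite wavg_pair_v.
  rewrite [X in _ - _ * X]VE -wavgZ -wavgN -wavgD.
  apply: le_wavg => u _.
  have P0 : 0 < pair_v v (rowmul one u) by rewrite (lt_le_trans (tot_gt0 R q p0 u))// tot_le_pair.
  set P := pair_v v (rowmul one u) in P0 *; set c := (2 / 3) ^+ _.
  have c0 : 0 < c by rewrite exprn_gt0// divr_gt0.
  have -> : c * (P * ln P) - ln V * (c * P) = c * (P * (ln P - ln V)) by ring.
  rewrite ler_pM2l// ler_pM2l// lerBlDr -lnM ?posrE ?tot_gt0//.
  by rewrite ler_ln ?posrE ?mulr_gt0 ?tot_gt0// mulrC pair_le_tot.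
(* If [g <= ln (3 / 2)], then [key] would give [j s0 de <= 2 C1] for all positive [j]; this one
   violates it. *)
pose j := (Num.bound (2 * C1 / de)).+1.
have hj : 2 * C1 < (j * s0)%:R * de.
  rewrite -ltr_pdivrMr//; apply: (lt_le_trans (archi_boundP _)).
    by rewrite divr_ge0 ?mulr_ge0// ltW.
  by rewrite ler_nat (leq_trans (leqnSn _))// leq_pmulr.
have h1 := key j; have := ge j (ltn0Sn _); rewrite -/(a _) => h2.
have h3 : g * (j * M * s0)%:R <= ln (3 / 2) * (j * M * s0)%:R by rewrite ler_wpM2r.
have h4 : (j * s0)%:R * (M%:R * ln (3 / 2) + de) =
    ln (3 / 2) * (j * M * s0)%:R + (j * s0)%:R * de by rewrite !natrM; ring.
by move: h1; rewrite h4 leNgt => /negP; apply; lra.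
Qed.

End Exponents.

(** * The two measures *)

Section ScaledCoordinate.
Context {R : realType} (kappa : R) (p : nat).
Hypothesis kappa0 : 0 < kappa.

Definition xcoord (a : R) := a / kappa + p%:R.

Lemma dyadic_setE n k : [set a | k%:R <= 2 ^+ n * xcoord a < k.+1%:R] =
  `[kappa * (k%:R / 2 ^+ n - p%:R), kappa * (k.+1%:R / 2 ^+ n - p%:R)[%classic.
Proof.
have n0 : 0 < 2 ^+ n :> R by rewrite exprn_gt0.
have e1 (r a : R) : (r <= 2 ^+ n * xcoord a) = (kappa * (r / 2 ^+ n - p%:R) <= a).
  rewrite /xcoord -ler_pdivrMl// [_^-1 * r]mulrC -lerBlDr ler_pdivlMr//.
  by rewrite [X in (X <= a) = _]mulrC.
by apply/seteqP; split => a; rewrite /= in_itv/= !ltNge !e1.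
Qed.

Lemma dyadic_set_measurable n k :
  measurable [set a | k%:R <= 2 ^+ n * xcoord a < k.+1%:R].
Proof. by rewrite dyadic_setE; exact: measurable_itv. Qed.

Lemma xcoord_eqE n k : [set a | 2 ^+ n * xcoord a = k%:R] =
  [set kappa * (k%:R / 2 ^+ n - p%:R)].
Proof.
have n0 : 2 ^+ n != 0 :> R by rewrite expf_neq0.
have k0 : kappa != 0 by rewrite gt_eqF.
apply/seteqP; split => a; rewrite /= /xcoord; last by move=> ->; field; rewrite k0.
by move=> <-; rewrite mulrAC divff// mul1r addrK mulrC divfK.
Qed.

Lemma lebesgue_word_set q n (B : seq bool -> Prop) :
  (lebesgue_measure (word_set p q xcoord n B) <=
   (kappa * (p + q)%:R * wavg n (fun u : seq bool => `[< B u >]%:R))%:E)%E.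
Proof.
have n0 : 0 < 2 ^+ n :> R by rewrite exprn_gt0.
pose I k := [set a | k%:R <= 2 ^+ n * xcoord a < k.+1%:R].
pose A k := if `[< B (nat_bits n k) >] then I k else set0.
have mA k : measurable (A k).
  by rewrite /A; case: ifP => // _; exact: dyadic_set_measurable.
have muA k : lebesgue_measure (A k) = (`[< B (nat_bits n k) >]%:R * (kappa / 2 ^+ n))%:E.
  rewrite /A; case: asboolP => _; last by rewrite measure0 mul0r.
  rewrite /I dyadic_setE lebesgue_measure_itv/= lte_fin ltr_pM2l// ltrD2r.
  rewrite ltr_pM2r ?invr_gt0// ltr_nat ltnSn -EFinD mul1r; congr (_%:E).
  by rewrite -natr1; field; rewrite gt_eqF.
have mU : measurable (\big[setU/set0]_(k < (p + q) * 2 ^ n) A k).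
  by apply: bigsetU_measurable => k _; exact: mA.
apply: (@le_trans _ _ (lebesgue_measure (\big[setU/set0]_(k < (p + q) * 2 ^ n) A k))).
  apply: le_measure; rewrite ?inE.
  - by apply: word_set_measurable => *; exact: dyadic_set_measurable.
  - exact: mU.
  move=> a [/andP[a0 aN] Ba].
  have ha : 0 <= 2 ^+ n * xcoord a by rewrite mulr_ge0// ltW.
  rewrite -bigcup_mkord; exists (Num.truncn (2 ^+ n * xcoord a)) => /=.
    by rewrite truncn_lt_nat// natrM natrX mulrC ltr_pM2r.
  rewrite /A -bits_truncn//; case: asboolP => // _; exact: truncn_itv.
apply: (@le_trans _ _ (\sum_(k < (p + q) * 2 ^ n) lebesgue_measure (A k))%E).
  by apply: Boole_inequality => k _; exact: mA.
rewrite (eq_bigr _ (fun (k : 'I__) _ => muA k)).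
rewrite sumEFin lee_fin -mulr_suml (sum_nat_bits (p + q) n (fun u => `[< B u >]%:R)).
by rewrite le_eqVlt; apply/orP; left; apply/eqP; field; rewrite gt_eqF.
Qed.

End ScaledCoordinate.

(** * Support, atoms and digit words of the projected natural measure *)

Section NaturalMeasure.
Context {R : realType} (p q : nat) (nu : probability (R * R)%type R).
Let N := (p + q)%N.
Hypotheses (p0 : (0 < p)%N) (q0 : (0 < q)%N).
Hypothesis hnu : is_natural_measure nu.
Let e := dig p q.

Lemma xproj_measurable : measurable_fun [set: R * R] (@xproj R p q).
Proof.
pose a := (q%:R * 2 / Num.sqrt 3 + p%:R / Num.sqrt 3 : R).
have -> : @xproj R p q = (fun z => p%:R + a * z.2 - p%:R * z.1).
  by apply/funext => z; rewrite /xproj /a /w1 /w2; ring.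
apply: measurable_funB; last by apply: measurable_funM => //; exact: measurable_fst.
apply: measurable_funD => //; apply: measurable_funM => //; exact: measurable_snd.
Qed.

Definition nux (A : set R) : R := fine (nu (xproj p q @^-1` A)).

Lemma preimage_xproj_measurable (A : set R) :
  measurable A -> measurable (@xproj R p q @^-1` A).
Proof. by move=> mA; rewrite -[X in measurable X]setTI; exact: xproj_measurable. Qed.

Let nuxE A : measurable A -> nu (xproj p q @^-1` A) = (nux A)%:E.
Proof.
by move=> mA; rewrite fineK// fin_num_measure//; exact: preimage_xproj_measurable.
Qed.

Let nux_ge0 A : 0 <= nux A.
Proof. by rewrite fine_ge0. Qed.

Let nux_le A B : measurable A -> measurable B -> A `<=` B -> nux A <= nux B.
Proof.
move=> mA mB AB; rewrite -lee_fin -!nuxE//; apply: le_measure; rewrite ?inE;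
  by [exact: preimage_xproj_measurable|move=> z; exact: AB].
Qed.

Let half_map i (y : R) := (y + (e i)%:R) / 2.

Let half_map_measurable i A : measurable A -> measurable (half_map i @^-1` A).
Proof.
move=> mA; rewrite -[X in measurable X]setTI.
suff : measurable_fun [set: R] (half_map i) by apply.
by apply: measurable_funM => //; exact: measurable_funD.
Qed.

Let gword_measurable io (A : set R) : measurable A -> measurable (gword e io @^-1` A).
Proof.
elim: io A => [|i io IH] A mA; first exact: mA.
have -> : gword e (i :: io) @^-1` A = gword e io @^-1` (half_map i @^-1` A) by [].
by apply: IH; exact: half_map_measurable.
Qed.

Let nux_split A : measurable A -> nux A = #|'I_3|%:R^-1 * \sum_i nux (half_map i @^-1` A).
Proof.
move=> mA; apply: EFin_inj; rewrite -nuxE// hnu; last exact: preimage_xproj_measurable.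
rewrite card_ord mulr_sumr -sumEFin; apply: eq_bigr => i _.
rewrite EFinM -nuxE; last exact: half_map_measurable.
congr (_ * nu _)%E; apply/seteqP.
by split => z; rewrite /= xproj_map.
Qed.

Let nux_words n A : measurable A -> nux A = wavg n (fun io => nux (gword e io @^-1` A)).
Proof.
elim: n A => [//|n IH] A mA; rewrite nux_split//=; congr (_ * _).
by apply: eq_bigr => i _; rewrite (IH _ (half_map_measurable i mA)).
Qed.

(** Preimages under the maps at least double the distance [r] outside [0, N], so the mass of [S 1]
    is bounded by that of [S (2^n)], which tends to 0. For [S 0], including the endpoint [N], the
    preimage under the inner digit [p] lies in the null set [S 1], so the mass is at most two thirds
    of itself. *)
Let nux_outside : nux (~` `[0, N%:R[) = 0.
Proof.
pose S (r : R) := ~` `[- r, N%:R + r[%classic : set R.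
have mS r : measurable (S r) by apply: measurableC; exact: measurable_itv.
have SP r y : S r y <-> (y < - r \/ N%:R + r <= y).
  rewrite /S/= in_itv/=; split => [/negP|].
    by rewrite negb_and -ltNge -leNgt => /orP.
  by case=> h /andP[h1 h2]; lra.
have eN i : (e i)%:R <= N%:R :> R.
  by rewrite ler_nat; case: i => -[|[|[]]]//= i; rewrite /e /dig/= /N; lia.
have S2 r : 0 <= r -> nux (S r) <= nux (S (2 * r)).
  move=> r0; rewrite nux_split// card_ord ler_pdivrMl//.
  have -> : 3 * nux (S (2 * r)) = \sum_(i < 3) nux (S (2 * r)).
    by rewrite sumr_const card_ord mulr_natl.
  apply: ler_sum => i _.
  apply: nux_le => //; first exact: half_map_measurable.
  have e0 : 0 <= (e i)%:R :> R by []; have eNi := eN i.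
  move=> y /SP; rewrite /half_map ltr_pdivrMr// ler_pdivlMr// => h.
  by apply/SP; case: h => h; [left|right]; lra.
have S2n n : nux (S 1) <= nux (S (2 ^+ n)).
  elim: n => [|n IH]; first by rewrite expr0.
  by apply: (le_trans IH); rewrite exprS; apply: S2; rewrite exprn_ge0.
have S1 : nux (S 1) = 0.
  apply/eqP; rewrite eq_le nux_ge0 andbT -lee_fin.
  pose F n := xproj p q @^-1` S (2 ^+ n).
  have F0 : \bigcap_n F n = set0.
    apply/seteqP; split => // z hz.
    pose n := Num.bound (`|xproj p q z| + 1).
    have : (`|xproj p q z| + 1 < 2 ^+ n).
      apply: (lt_trans (archi_boundP _)); first by rewrite addr_ge0.
      by rewrite -natrX ltr_nat ltn_expl.
    have /SP := hz n I; have : 0 <= N%:R :> R by [].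
    have := ler_norm (xproj p q z); have := ler_norm (- xproj p q z); rewrite normrN.
    by move=> ? ? ? [] ? ?; lra.
  have mF n : measurable (F n) by exact: preimage_xproj_measurable.
  have cF : (nu \o F) @ \oo --> nu (\bigcap_n F n).
    apply: nonincreasing_cvg_mu => //.
    - by rewrite (le_lt_trans (probability_le1 _ (mF 0%N)))// ltry.
    - by rewrite F0.
    - move=> m n mn; apply/subsetPset => z /SP h; apply/SP.
      have : 2 ^+ m <= 2 ^+ n :> R by rewrite ler_weXn2l// ler1n.
      by case: h => h ?; [left|right]; lra.
  have limE : lim ((nu \o F) @ \oo) = 0%E by rewrite (cvg_lim _ cF)// F0 measure0.
  rewrite -[leRHS]limE.
  apply: lime_ge; first by apply/cvg_ex; exists (nu (\bigcap_n F n)).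
  by apply: nearW => n; rewrite /= nuxE// lee_fin.
have S0 : nux (S 0) = 0.
  apply/eqP; rewrite eq_le nux_ge0 andbT.
  have piece i : nux (half_map i @^-1` S 0) <=
      (i == inord 2)%:R * nux (S 0) + (i == 1)%:R * nux (S 0).
    rewrite -!val_eqE/= inordK//.
    have p1 : 1 <= p%:R :> R by rewrite ler1n.
    have q1 : 1 <= q%:R :> R by rewrite ler1n.
    have NE : N%:R = p%:R + q%:R :> R by rewrite natrD.
    case: i => -[|[|[]]]//= i; rewrite ?mul0r ?mul1r ?addr0 ?add0r.
    - rewrite -S1; apply: nux_le => //; first exact: half_map_measurable.
      move=> y /SP; rewrite /half_map /e /dig/= ltr_pdivrMr// ler_pdivlMr// => h.
      by apply/SP; case: h => h; [left|right]; lra.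
    - apply: nux_le => //; first exact: half_map_measurable.
      move=> y /SP; rewrite /half_map /e /dig/= ltr_pdivrMr// ler_pdivlMr// => h.
      by apply/SP; case: h => h; [left|right]; lra.
    - apply: nux_le => //; first exact: half_map_measurable.
      move=> y /SP; rewrite /half_map /e /dig/= ltr_pdivrMr// ler_pdivlMr// => h.
      by apply/SP; case: h => h; [left|right]; lra.
  have := nux_split (mS 0); rewrite card_ord => h.
  have : nux (S 0) <= 3^-1 * \sum_(i < 3) ((i == inord 2)%:R * nux (S 0) + (i == 1)%:R * nux (S 0)).
    by rewrite {1}h ler_pM2l ?invr_gt0//; apply: ler_sum => i _; exact: piece.
  rewrite !big_ord_recl big_ord0/= -!val_eqE/= /bump/= inordK//=.
  rewrite !mul0r !mul1r; have := nux_ge0 (S 0); lra.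
apply/eqP; rewrite eq_le nux_ge0 andbT -[leRHS]S0; apply: nux_le => //.
  by apply: measurableC; exact: measurable_itv.
by move=> y; rewrite /S oppr0 addr0.
Qed.

(** Unfolding [n] levels gives an average over digit words. A word contributes at most 1, and
    nothing if no integer part below [N] makes it emit a word of [B], because the measure lives on
    [0, N). *)
Lemma natural_word_set n (B : seq bool -> Prop) :
  (nu (xproj p q @^-1` word_set p q id n B) <=
   (1 * wavg n (fun io => `[< exists2 l, (l < N)%N & B (output e io l) >]%:R))%:E)%E.
Proof.
have mW : measurable (word_set p q (id : R -> R) n B).
  apply: word_set_measurable => m k.
  have -> : [set a : R | k%:R <= 2 ^+ m * id a < k.+1%:R] =
      [set a | k%:R <= 2 ^+ m * xcoord 1 0 a < k.+1%:R].
    by apply/seteqP; split => a; rewrite /= /xcoord divr1 addr0.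
  exact: dyadic_set_measurable.
rewrite nuxE// lee_fin mul1r (nux_words n mW); apply: le_wavg => io sio.
case: asboolP => [_|nB].
  rewrite -lee_fin -nuxE; last exact: gword_measurable.
  by apply: probability_le1; apply: preimage_xproj_measurable; exact: gword_measurable.
rewrite -[leRHS]nux_outside; apply: nux_le; first exact: gword_measurable.
  by apply: measurableC; exact: measurable_itv.
move=> y [_ By] /=; rewrite in_itv/= => /andP[y0 yN]; apply: nB.
exists (Num.truncn y); first by rewrite truncn_lt_nat.
by rewrite -bits_gword// sio.
Qed.

(** At most two of the three preimages [2 y - d] lie in [0, N): [d = 0] requires [2 y < N] and
    [d = p + q] requires the opposite. Each level thus gains a factor 2/3. *)
Lemma natural_set1 x : nu (xproj p q @^-1` [set x]) = 0%E.
Proof.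
suff h n y : nux [set y] <= (2 / 3) ^+ n.
  rewrite nuxE; last exact: measurable_set1.
  congr (_%:E); apply/eqP; rewrite eq_le nux_ge0 andbT.
  have /cvgrPdist_le cv : (fun j => (2 / 3 : R) ^+ j) @ \oo --> (0 : R).
    by apply: cvg_expr; rewrite ger0_norm; lra.
  apply/ler_addgt0Pr => eps /cv[j _ /(_ j (leqnn j))]/=.
  rewrite sub0r normrN ger0_norm ?exprn_ge0// add0r => /(le_trans (h j x)); exact.
elim: n y => [|n IH] y.
  rewrite expr0 -lee_fin -nuxE; last exact: measurable_set1.
  by apply: probability_le1; apply: preimage_xproj_measurable; exact: measurable_set1.
have out z : ~~ (0 <= z < N%:R) -> nux [set z] = 0.
  move=> zN; apply/eqP; rewrite eq_le nux_ge0 andbT -[leRHS]nux_outside; apply: nux_le.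
  - exact: measurable_set1.
  - by apply: measurableC; exact: measurable_itv.
  - by move=> _ -> /=; rewrite in_itv/=; apply/negP.
have pre i : half_map i @^-1` [set y] = [set 2 * y - (e i)%:R].
  apply/seteqP; split => z; rewrite /= /half_map; last by move=> ->; field.
  by move=> <-; field.
rewrite nux_split ?card_ord; last exact: measurable_set1.
rewrite !big_ord_recl big_ord0/= !pre /e /dig/= /bump/= subr0 addr0.
have [yN|yN] := ltP (2 * y) N%:R.
  rewrite [X in _ + (_ + X)]out; last by rewrite subr_ge0 leNgt yN.
  by have := IH (2 * y - p%:R); have := IH (2 * y); rewrite exprS; lra.
rewrite [X in _ + (X + _)]out; last by rewrite ltNge yN andbF.
by have := IH (2 * y - p%:R); have := IH (2 * y - (p + q)%:R); rewrite exprS; lra.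
Qed.

End NaturalMeasure.

(** * Almost every slice *)

Section Slices.
Context {R : realType} (p q : nat) (D : set (R * R)) (theta : R).
Hypotheses (p0 : (0 < p)%N) (q0 : (0 < q)%N) (pq : coprime p q).
Hypothesis hD : is_sierpinski_gasket D.
Hypothesis htan : tan theta = Num.sqrt 3 * p%:R / (2 * q%:R + p%:R).

Definition slice_scale : R := Num.sqrt 3 / (2 * q%:R + p%:R).
Let kappa := slice_scale.
Let xc := xcoord kappa p.

Lemma slice_scale_gt0 : 0 < slice_scale.
Proof.
by rewrite divr_gt0 ?sqrtr_gt0// addr_gt0 ?mulr_gt0 ?ltr0n.
Qed.

Lemma xcoord_proj z : xc (proj_theta theta z) = xproj p q z.
Proof.
rewrite /xc /xcoord (proj_thetaE p0 q0 pq z htan) -/slice_scale mulrAC.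
by rewrite divff ?gt_eqF ?slice_scale_gt0// mul1r subrK.
Qed.

Lemma xcoord_inj : injective xc.
Proof.
move=> a b /addIr; apply: mulIf.
by rewrite invr_eq0 gt_eqF ?slice_scale_gt0.
Qed.

Lemma gasket_sliceE a : gasket_slice D theta a = slice p q D (xc a).
Proof.
apply/seteqP; split => -[x y].
  case=> -[x' _ [<- <-]] Dz; split => //.
  by rewrite -xcoord_proj /proj_theta/= addrK.
case=> Dz; rewrite -xcoord_proj => /xcoord_inj <-; split => //.
by exists x => //; rewrite /proj_theta/= subrK.
Qed.

Lemma proj_theta_measurable : measurable_fun [set: R * R] (proj_theta theta).
Proof.
apply: measurable_funB; first exact: measurable_snd.
by apply: measurable_funM => //; exact: measurable_fst.
Qed.

Lemma ae_slice_dim (mu : {measure set R -> \bar R}) g :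
  (forall n k, mu [set kappa * (k%:R / 2 ^+ n - p%:R)] = 0%E) ->
  mu.-negligible [set a | 0 <= xc a < (p + q)%:R /\ ~ typical p q g (xc a)] ->
  {ae mu, forall a, (proj_theta theta @` D) a ->
     has_box_dim (gasket_slice D theta a) (g / ln 2)%:E /\
     hausdorff_dim (gasket_slice D theta a) = (g / ln 2)%:E}.
Proof.
move=> mu1 muT.
(* The dyadic coordinates, at which a cylinder may touch the slice only at the excluded endpoint;
   they are countably many and [mu] gives each of them mass 0. *)
pose Z n := \bigcup_k [set a | 2 ^+ n * xc a = k%:R].
have muZ : mu.-negligible (\bigcup_n Z n).
  apply: negligible_bigcup => n; apply: negligible_bigcup => k.
  rewrite xcoord_eqE; last exact: slice_scale_gt0.
  by apply/negligibleP; [exact: measurable_set1|exact: mu1].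
apply: negligibleS (negligibleU muT muZ) => a /= na.
have [Za|nZ] := pselect ((\bigcup_n Z n) a); [by right|left].
have nd n k : 2 ^+ n * xc a != k%:R.
  by apply/eqP => h; apply: nZ; exists n => //; exists k.
split.
  have := na; rewrite not_implyE => -[[z Dz za] _].
  have /andP[x0 xN] := xproj_itv p q hD Dz.
  rewrite -za xcoord_proj x0/= lt_neqAle xN andbT.
  by have := nd 0%N (p + q)%N; rewrite expr0 mul1r -za xcoord_proj.
move=> [h1 h2]; apply: na => -[z Dz za].
have x_itv : 0 <= xc a < (p + q)%:R.
  have /andP[x0 xN] := xproj_itv p q hD Dz.
  rewrite -za xcoord_proj x0/= lt_neqAle xN andbT.
  by have := nd 0%N (p + q)%N; rewrite expr0 mul1r -za xcoord_proj.
rewrite gasket_sliceE; split.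
  exact: slice_box_dim p0 q0 pq hD _ _ x_itv nd h1 h2.
exact: slice_hausdorff_dim p0 q0 pq hD _ _ x_itv nd h1 h2.
Qed.

Let gap_ln : ln 3 / ln 2 - 1 = ln (3 / 2) / ln 2 :> R.
Proof.
have l2 : 0 < ln 2 :> R by rewrite ln_gt0 ?ltr1n.
by rewrite ln_div ?posrE// mulrBl divff ?gt_eqF.
Qed.

Lemma lebesgue_slice_dim : exists2 alpha : R, alpha < ln 3 / ln 2 - 1 &
  {ae lebesgue_measure, forall a : R, (proj_theta theta @` D) a ->
     has_box_dim (gasket_slice D theta a) alpha%:E /\
     hausdorff_dim (gasket_slice D theta a) = alpha%:E}.
Proof.
have k0 := slice_scale_gt0.
have C0 : 0 <= kappa * (p + q)%:R by rewrite mulr_ge0// ltW.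
have mid : measurable_fun [set: measurableTypeR R] (id : _ -> R).
  by move=> _ A mA; rewrite setTI; exact: mA.
pose mu : {measure set R -> \bar R} :=
  measure_function_pushforward__canonical__measure_function_Measure
    lebesgue_measure mid.
have [g g1 g2] := @lebesgue_exponent R p q p0 q0 pq mu _ _
  (dyadic_set_measurable p k0) C0 (lebesgue_word_set p k0 q).
exists (g / ln 2); first by rewrite gap_ln ltr_pM2r// invr_gt0 ln_gt0 ?ltr1n.
by apply: (@ae_slice_dim mu) g2 => n k; exact: lebesgue_measure_set1.
Qed.

Lemma natural_slice_dim (nu : probability (R * R)%type R) :
  is_natural_measure nu ->
  exists2 beta : R, ln 3 / ln 2 - 1 < beta &
  {ae proj_measure nu theta, forall a : R, (proj_theta theta @` D) a ->
     has_box_dim (gasket_slice D theta a) beta%:E /\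
     hausdorff_dim (gasket_slice D theta a) = beta%:E}.
Proof.
move=> hnu; have k0 := slice_scale_gt0.
pose mu := measure_function_pushforward__canonical__measure_function_Measure nu
  proj_theta_measurable.
have muE (A : set R) : mu (xc @^-1` A) = nu (xproj p q @^-1` A).
  congr (nu _); apply/seteqP.
  by split => z; rewrite /= xcoord_proj.
have hmu n (B : seq bool -> Prop) : (mu (word_set p q xc n B) <=
    (1 * wavg n (fun io =>
      `[< exists2 l, (l < p + q)%N & B (output (dig p q) io l) >]%:R))%:E)%E.
  have -> : word_set p q xc n B = xc @^-1` word_set p q id n B by [].
  by rewrite muE; exact: natural_word_set.
have [g g1 g2] := @natural_exponent R p q p0 q0 pq mu _ _
  (dyadic_set_measurable p k0) ler01 hmu.
exists (g / ln 2); first by rewrite gap_ln ltr_pM2r// invr_gt0 ln_gt0 ?ltr1n.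
apply: (@ae_slice_dim mu) g2 => n k.
rewrite -xcoord_eqE//.
have -> : [set a | 2 ^+ n * xcoord kappa p a = k%:R] = xc @^-1` [set k%:R / 2 ^+ n].
  have n0 : 2 ^+ n != 0 :> R by rewrite expf_neq0.
  apply/seteqP; split => a; rewrite /= -/xc; first by move=> <-; rewrite mulrAC divff// mul1r.
  by move=> ->; rewrite mulrC divfK.
by rewrite muE; exact: natural_set1.
Qed.

End Slices.

Theorem theorem1p4 (R : realType) (D : set (R * R))
    (nu : probability (R * R)%type R)
    (hD : is_sierpinski_gasket D) (hnu : is_natural_measure nu)
    (p q : nat) (hp : (0 < p)%N) (hq : (0 < q)%N)
    (theta : R) (htheta : 0 < theta < pi / 3)
    (htan : tan theta = Num.sqrt 3 * p%:R / (2 * q%:R + p%:R)) :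
  let s : R := ln 3 / ln 2 in
  exists alpha beta : R,
    (alpha < s - 1 /\
     {ae lebesgue_measure, forall a : R, (proj_theta theta @` D) a ->
        has_box_dim (gasket_slice D theta a) alpha%:E /\
        hausdorff_dim (gasket_slice D theta a) = alpha%:E}) /\
    (s - 1 < beta /\
     {ae proj_measure nu theta, forall a : R, (proj_theta theta @` D) a ->
        has_box_dim (gasket_slice D theta a) beta%:E /\
        hausdorff_dim (gasket_slice D theta a) = beta%:E}).
Proof.
move=> s; pose d := gcdn p q.
have d0 : (0 < d)%N by rewrite gcdn_gt0 hp.
have pE : (p %/ d * d = p)%N by rewrite divnK// dvdn_gcdl.
have qE : (q %/ d * d = q)%N by rewrite divnK// dvdn_gcdr.
have p0 : (0 < p %/ d)%N by move: hp; rewrite -{1}pE muln_gt0 => /andP[].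
have q0 : (0 < q %/ d)%N by move: hq; rewrite -{1}qE muln_gt0 => /andP[].
have pq : coprime (p %/ d) (q %/ d).
  by rewrite /coprime -(eqn_pmul2r d0) mul1n muln_gcdl pE qE.
have tanE : tan theta =
    Num.sqrt 3 * (p %/ d)%:R / (2 * (q %/ d)%:R + (p %/ d)%:R).
  have dR : d%:R != 0 :> R by rewrite pnatr_eq0 -lt0n.
  rewrite htan -[in LHS]pE -[in LHS]qE !natrM [2 * _]mulrA -mulrDl mulrA.
  by rewrite -mulf_div divff// mulr1.
have [alpha a1 a2] := lebesgue_slice_dim p0 q0 pq hD tanE.
have [beta b1 b2] := natural_slice_dim p0 q0 pq hD tanE hnu.
by exists alpha, beta.
Qed.
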